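(* Let $\rho,\gamma,L\ge 0$ and $\delta,\sigma>0$. Let $\varphi:\mathbb{R}^d\to(-\infty,+\infty]$ be a proper, lower semicontinuous, $(\rho,\gamma)$-semiconvex function such that $|\varphi(x)-\varphi(y)|\le L+L|x-y|$ for all $x,y\in\mathrm{Dom}(\varphi)$, and such that $\mathrm{Dom}(\varphi)$ satisfies the $(\gamma,\delta,\sigma)$-shifted uniform interior ball condition. Let $x_0\in\overline{\mathrm{Dom}(\varphi)}$ and let $m:\mathbb{R}_+\to\mathbb{R}^d$ be continuous with $m(0)=0$. Then the generalized Skorohod problem $$x(t)+k(t)=x_0+m(t),\quad t\ge 0,\qquad dk(t)\in\partial^-\varphi(x(t))(dt)$$ has a unique solution $(x,k)$, i.e. there is exactly one pair $(x,k)=\mathcal{SP}(\partial^-\varphi;x_0,m)$.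
   Context: Here $|\cdot|$ and $\langle\cdot,\cdot\rangle$ are the Euclidean norm and inner product, $\overline B(x,r)$ is the closed ball, $\mathrm{Bd}(E)$ is the boundary of $E$. For $\varphi:\mathbb{R}^d\to(-\infty,+\infty]$, $\mathrm{Dom}(\varphi)=\{v:\varphi(v)<+\infty\}$; $\varphi$ is proper if $\mathrm{Dom}(\varphi)$ is nonempty and has no isolated points. The Fréchet subdifferential is $\partial^-\varphi(x)=\emptyset$ if $x\notin\mathrm{Dom}(\varphi)$, and for $x\in\mathrm{Dom}(\varphi)$ $$\partial^-\varphi(x)=\Big\{\hat x\in\mathbb{R}^d:\liminf_{y\to x}\frac{\varphi(y)-\varphi(x)-\langle\hat x,y-x\rangle}{|y-x|}\ge 0\Big\}.$$ A nonempty closed set $E\subset\mathbb{R}^d$ is $\gamma$-semiconvex ($\gamma\ge0$) if for every $x\in\mathrm{Bd}(E)$ there is $\hat x\in\mathbb{R}^d\setminus\{0\}$ with $\langle\hat x,y-x\rangle\le\gamma|\hat x||y-x|^2$ for all $y\in E$. The function $\varphi$ is $(\rho,\gamma)$-semiconvex ($\rho,\gamma\ge0$) if: $\overline{\mathrm{Dom}(\varphi)}$ is $\gamma$-semiconvex; $\partial^-\varphi(x)\ne\emptyset$ for some $x$; and for all $x$, all $\hat x\in\partial^-\varphi(x)$ and all $y\in\mathbb{R}^d$, $\langle\hat x,y-x\rangle+\varphi(x)\le\varphi(y)+(\rho+\gamma|\hat x|)|y-x|^2$. A set $E$ satisfies the $(\gamma,\delta,\sigma)$-shifted uniform interior ball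 condition if for every $y\in E$ there exist $\lambda_y\in(0,1]$ and $v_y\in\mathbb{R}^d$, $|v_y|\le1$, with $\lambda_y-(|v_y|+\lambda_y)^2\gamma\ge\sigma$ and $\overline B(x+v_y,\lambda_y)\subset E$ for all $x\in E\cap\overline B(y,\delta)$. $\mathrm{Var}_t(k)$ denotes the total variation of $k$ on $[0,t]$; $BV_{loc}(\mathbb{R}_+;\mathbb{R}^d)$ is the set of functions with $\mathrm{Var}_t(k)<\infty$ for all $t$. A pair $(x,k)$ of continuous functions $\mathbb{R}_+\to\mathbb{R}^d$ is a solution of the generalized Skorohod problem, written $(x,k)=\mathcal{SP}(\partial^-\varphi;x_0,m)$, if: (j) $x(t)\in\overline{\mathrm{Dom}(\varphi)}$ for all $t\ge0$ and $\varphi(x(\cdot))\in L^1_{loc}(\mathbb{R}_+)$; (jj) $k\in BV_{loc}(\mathbb{R}_+;\mathbb{R}^d)$, $k(0)=0$; (jjj) $x(t)+k(t)=x_0+m(t)$ for all $t\ge0$; (jv) for all $0\le s\le t$ and all continuous $y:\mathbb{R}_+\to\mathbb{R}^d$, $$\int_s^t\langle y(r)-x(r),dk(r)\rangle+\int_s^t\varphi(x(r))dr\le\int_s^t\varphi(y(r))dr+\int_s^t|y(r)-x(r)|^2\big(\rho\,dr+\gamma\,d\mathrm{Var}_r(k)\big).$$ The notation $dk(t)\in\partial^-\varphi(x(t))(dt)$ means that $x,k$ are continuous and (j), (jj), (jv) hold. *)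

(* Defs.v *)
From HB Require Import structures.
From mathcomp Require Import all_boot all_order all_algebra.
From mathcomp Require Import all_classical all_reals all_analysis.

Set Implicit Arguments.
Unset Strict Implicit.
Unset Printing Implicit Defensive.

Import Order.TTheory GRing.Theory Num.Theory.
Import numFieldNormedType.Exports.

Local Open Scope classical_set_scope.
Local Open Scope ring_scope.

(** R^d is ['rV[R]_d]. The library norm [`|v|] on it is the
    sup norm; it induces the Euclidean topology, so library topological notions
    are used directly, but lengths are measured with [enorm]. *)

Section Euclidean.
Context {R : realType} {d : nat}.
Implicit Types (u v c : 'rV[R]_d) (E : set 'rV[R]_d).

Definition dotv u v : R := \sum_(i < d) u ord0 i * v ord0 i.

Definition enorm u : R := Num.sqrt (dotv u u).

Definition ecball c (r : R) : set 'rV[R]_d := [set z | enorm (z - c) <= r].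

Definition boundary E : set 'rV[R]_d := closure E `\` interior E.

Definition semiconvex_set (gamma : R) E : Prop :=
  [/\ E !=set0, closed E &
      forall x, boundary E x -> exists xh : 'rV[R]_d, xh != 0 /\
        forall y, E y ->
          dotv xh (y - x) <= gamma * enorm xh * enorm (y - x) ^+ 2].

Definition shifted_interior_ball (gamma delta sigma : R) E : Prop :=
  forall y, E y -> exists (lambda : R) (v : 'rV[R]_d),
    [/\ 0 < lambda <= 1, enorm v <= 1,
        sigma <= lambda - (enorm v + lambda) ^+ 2 * gamma &
        forall x, (E `&` ecball y delta) x -> ecball (x + v) lambda `<=` E].

End Euclidean.

(** Functions with values in (-oo, +oo] are functions to [\bar R] that never
    take the value [-oo]; this is a separate hypothesis where they are used. *)
Section Semiconvex.
Context {R : realType} {d : nat}.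
Implicit Types (phi : 'rV[R]_d -> \bar R).

Definition Dom phi : set 'rV[R]_d := [set v | (phi v < +oo)%E].

Definition proper_fun phi : Prop :=
  Dom phi !=set0 /\ isolated (Dom phi) = set0.

Definition frechet_subdiff phi (x : 'rV[R]_d) : set 'rV[R]_d :=
  [set xh | Dom phi x /\
    (0 <= limf_einf (fun y => (phi y - phi x - (dotv xh (y - x))%:E)
                                * ((enorm (y - x))^-1)%:E) x^')%E].

Definition semiconvex_fun (rho gamma : R) phi : Prop :=
  [/\ semiconvex_set gamma (closure (Dom phi)),
      exists x, frechet_subdiff phi x !=set0 &
      forall x xh, frechet_subdiff phi x xh -> forall y,
        ((dotv xh (y - x))%:E + phi x <=
         phi y + ((rho + gamma * enorm xh) * enorm (y - x) ^+ 2)%:E)%E].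

End Semiconvex.

(** Total variation for the Euclidean norm; [a :: p] lists the points of a
    subdivision of [a, b] when [itv_partition a b p]. *)
Section Variation.
Context {R : realType} {d : nat}.
Implicit Types (k : R -> 'rV[R]_d).

Definition Var k (t : R) : \bar R :=
  ereal_sup [set (\sum_(i < size p)
      enorm (k (nth 0 (0 :: p) i.+1) - k (nth 0 (0 :: p) i)))%:E
    | p in itv_partition 0 t].

Definition BV_loc k : Prop := forall t, 0 <= t -> (Var k t < +oo)%E.

End Variation.

(** Riemann-Stieltjes integrals. The product [b] is [dotv] for
    [int <f(r), dg(r)>] and multiplication for real-valued [f] and [g]. *)
Section RiemannStieltjes.
Context {R : realType} {U V : zmodType}.
Implicit Types (b : U -> V -> R) (f : R -> U) (g : R -> V).

Definition RS_sum b f g (s : R) (p : seq R) (xi : nat -> R) : R :=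
  \sum_(i < size p)
    b (f (xi i)) (g (nth 0 (s :: p) i.+1) - g (nth 0 (s :: p) i)).

Definition is_RS_int b f g (s t I : R) : Prop :=
  forall e : R, 0 < e -> exists2 eta : R, 0 < eta &
    forall (p : seq R) (xi : nat -> R), itv_partition s t p ->
      (forall i, (i < size p)%N ->
         nth 0 (s :: p) i <= xi i <= nth 0 (s :: p) i.+1
         /\ nth 0 (s :: p) i.+1 - nth 0 (s :: p) i < eta) ->
      `|RS_sum b f g s p xi - I| < e.

(** Defaults to 0 if the integral does not exist. It exists when [f] is
    continuous and [g] has bounded variation on [s, t]. *)
Definition RS_int b f g (s t : R) : R := xget 0 (is_RS_int b f g s t).

End RiemannStieltjes.

(** Functions on R_+ are functions on R of which only the values on [0, +oo[
    matter. *)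
Section Skorohod.
Context {R : realType} {d : nat}.
Implicit Types (phi : 'rV[R]_d -> \bar R) (x k y m : R -> 'rV[R]_d).
Local Notation mu := (@lebesgue_measure R).

Definition continuous_Rplus y : Prop :=
  {within [set` `[0%R, +oo[], continuous y}.

Definition variational_ineq (rho gamma : R) phi x k : Prop :=
  forall s t : R, 0 <= s -> s <= t -> forall y, continuous_Rplus y ->
  ((RS_int dotv (fun r => y r - x r) k s t)%:E
     + \int[mu]_(r in `[s, t]) phi (x r)
   <= \int[mu]_(r in `[s, t]) phi (y r)
     + (rho * \int[mu]_(r in `[s, t]) (enorm (y r - x r) ^+ 2)
        + gamma * RS_int (fun a c : R => a * c)
                    (fun r => enorm (y r - x r) ^+ 2)
                    (fun r => fine (Var k r)) s t)%:E)%E.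

(** Renders the notation dk(t) in the Frechet subdifferential of phi at x(t),
    (dt). *)
Definition driven_by_subdiff (rho gamma : R) phi x k : Prop :=
  [/\ continuous_Rplus x /\ continuous_Rplus k,
      (forall t, 0 <= t -> closure (Dom phi) (x t))
        /\ (forall T, 0 <= T -> mu.-integrable `[0, T] (fun t => phi (x t))),
      BV_loc k /\ k 0 = 0 &
      variational_ineq rho gamma phi x k].

Definition skorohod_solution (rho gamma : R) phi (x0 : 'rV[R]_d) m x k : Prop :=
  driven_by_subdiff rho gamma phi x k
  /\ (forall t, 0 <= t -> x t + k t = x0 + m t).

End Skorohod.

(* Main.v *)
Require Import Defs.
From HB Require Import structures.
From mathcomp Require Import all_boot all_order all_algebra.
From mathcomp Require Import all_classical all_reals all_analysis.
From mathcomp Require Import measurable_realfun.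
From mathcomp Require Import ring lra.

(** Implicit Euler (catching-up) scheme with mesh [h]: [X (i+1)] minimises
    [h phi(y) + |y - (X i + dm i)|^2 / 2] and the residual [dK i] is [h] times a
    Frechet subgradient at [X (i+1)].  Testing semiconvexity at
    [X (i+1) + v + lambda dK i / |dK i|] (interior ball) gives
    [sigma |dK i| <= - <dK i, v> + C h] as long as [X] stays near its starting
    point, hence a bound on the variation, equicontinuity, and limits [x], [k]
    along an ultrafilter.  The discrete variations may converge to something
    larger than [Var k]; the inequality with [Var k] itself is recovered by
    summing, over blocks of many steps, an inequality involving only the total
    increment of [K] over the block ([coarse_inequality]).  Uniqueness is a
    Gronwall argument on [|x - x'|^2]. *)

Set Implicit Arguments.
Unset Strict Implicit.
Unset Printing Implicit Defensive.

Import Order.TTheory GRing.Theory Num.Theory.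
Import numFieldNormedType.Exports.

Local Open Scope classical_set_scope.
Local Open Scope ring_scope.

(** * Euclidean space *)

Section EuclideanTheory.
Context {R : realType} {d : nat}.
Implicit Types (u v w x y z : 'rV[R]_d) (a b c e : R).

(** Two difficulties shape the proof. A variation bound requires the path to stay near its starting
    point, and staying there requires a variation bound. The loop closes because, on a window where
    X moves by at most e and m by e^2, the variation is of order e while |K b - K a|^2 is of order
    e^2 times the variation, up to a time term; for small e this is far below e^2. The vector v is
    fixed over a window so that its contribution telescopes, and sigma is what remains of lambda
    once the semiconvexity error gamma |dK| |z - X|^2 is absorbed. The other difficulty is that phi
    is only lower semicontinuous and that the test path y may leave its domain. The term phi(x)
    passes to the limit by Fatou's lemma, on the side where it stands. The term phi(y) is never
    evaluated along the scheme: on each cell the coarse inequality is used with a fixed point z =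
    y(r), for every r in the cell, and then averaged over r. The bound with L permits jumps of phi
    inside the domain, but it makes the domain closed and the proximal functional coercive. *)

Lemma dotvC u v : dotv u v = dotv v u.
Proof. by apply: eq_bigr => i _; rewrite mulrC. Qed.

Lemma dotvDl u v w : dotv (u + v) w = dotv u w + dotv v w.
Proof. by rewrite -big_split; apply: eq_bigr => i _; rewrite !mxE mulrDl. Qed.

Lemma dotvZl a u v : dotv (a *: u) v = a * dotv u v.
Proof. by rewrite /dotv mulr_sumr; apply: eq_bigr => i _; rewrite !mxE mulrA. Qed.

Lemma dotvNl u v : dotv (- u) v = - dotv u v.
Proof. by rewrite -scaleN1r dotvZl mulN1r. Qed.

Lemma dotvBl u v w : dotv (u - v) w = dotv u w - dotv v w.
Proof. by rewrite dotvDl dotvNl. Qed.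

Lemma dotvDr u v w : dotv u (v + w) = dotv u v + dotv u w.
Proof. by rewrite dotvC dotvDl !(dotvC u). Qed.

Lemma dotvZr a u v : dotv u (a *: v) = a * dotv u v.
Proof. by rewrite dotvC dotvZl dotvC. Qed.

Lemma dotvNr u v : dotv u (- v) = - dotv u v.
Proof. by rewrite dotvC dotvNl dotvC. Qed.

Lemma dotvBr u v w : dotv u (v - w) = dotv u v - dotv u w.
Proof. by rewrite dotvDr dotvNr. Qed.

Lemma dotv0l u : dotv 0 u = 0.
Proof. by rewrite -(scale0r 0) dotvZl mul0r. Qed.

Lemma dotv0r u : dotv u 0 = 0.
Proof. by rewrite dotvC dotv0l. Qed.

Definition dotvE := (dotvDl, dotvDr, dotvNl, dotvNr, dotvZl, dotvZr).

Lemma dotvv_ge0 u : 0 <= dotv u u.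
Proof. by apply: sumr_ge0 => i _; rewrite -expr2 sqr_ge0. Qed.

Lemma enorm_ge0 u : 0 <= enorm u.
Proof. exact: sqrtr_ge0. Qed.

Lemma enorm_sqr u : enorm u ^+ 2 = dotv u u.
Proof. by rewrite sqr_sqrtr ?dotvv_ge0. Qed.

Lemma enorm_le u c : 0 <= c -> dotv u u <= c ^+ 2 -> enorm u <= c.
Proof. by move=> c0 H; rewrite -(ler_pXn2r (n := 2)) ?nnegrE ?enorm_ge0// enorm_sqr. Qed.

Lemma enorm_eq0 u : enorm u = 0 -> u = 0.
Proof.
move=> u0; have := enorm_sqr u; rewrite u0 expr0n /= => /esym/eqP.
rewrite psumr_eq0 => [/allP u2|i _]; last by rewrite -expr2 sqr_ge0.
apply/rowP => i; rewrite mxE.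
by have := u2 i (mem_index_enum _); rewrite /= mulf_eq0 orbb => /eqP ->.
Qed.

Lemma enorm0 : enorm (0 : 'rV[R]_d) = 0.
Proof. by rewrite /enorm dotv0l sqrtr0. Qed.

Lemma enormN u : enorm (- u) = enorm u.
Proof. by rewrite /enorm dotvNl dotvNr opprK. Qed.

Lemma enormB u v : enorm (u - v) = enorm (v - u).
Proof. by rewrite -enormN opprB. Qed.

Lemma enormZ a u : enorm (a *: u) = `|a| * enorm u.
Proof.
by rewrite /enorm dotvZl dotvZr mulrA -expr2 sqrtrM ?sqr_ge0// sqrtr_sqr.
Qed.

Lemma dotv_le u v : dotv u v <= enorm u * enorm v.
Proof.
have [u0|u0] := eqVneq (enorm u) 0.
  by rewrite u0 (enorm_eq0 u0) dotv0l mul0r.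
have [v0|v0] := eqVneq (enorm v) 0.
  by rewrite v0 (enorm_eq0 v0) dotv0r mulr0.
have pu : 0 < enorm u by rewrite lt_neqAle eq_sym u0 enorm_ge0.
have pv : 0 < enorm v by rewrite lt_neqAle eq_sym v0 enorm_ge0.
have := dotvv_ge0 (enorm v *: u - enorm u *: v).
rewrite !dotvE (dotvC v u) -!enorm_sqr => H.
have H2 : 0 <= (enorm u * enorm v) * (enorm u * enorm v - dotv u v) by nra.
by rewrite -subr_ge0 -(pmulr_rge0 _ (mulr_gt0 pu pv)).
Qed.

Lemma dotv_norm u v : `|dotv u v| <= enorm u * enorm v.
Proof. by rewrite ler_norml dotv_le andbT lerNl -dotvNl -(enormN u) dotv_le. Qed.

Lemma enormD_sqr u v :
  enorm (u + v) ^+ 2 = enorm u ^+ 2 + 2 * dotv u v + enorm v ^+ 2.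
Proof. by rewrite !enorm_sqr !dotvE (dotvC v u); ring. Qed.

Lemma ler_enormD u v : enorm (u + v) <= enorm u + enorm v.
Proof.
apply: enorm_le; first by rewrite addr_ge0 ?enorm_ge0.
rewrite -enorm_sqr enormD_sqr; have := dotv_le u v; lra.
Qed.

Lemma ler_enormB u v : enorm (u - v) <= enorm u + enorm v.
Proof. by rewrite -(enormN v) ler_enormD. Qed.

Lemma ler_enorm_trans u v w : enorm (u - w) <= enorm (u - v) + enorm (v - w).
Proof. by have := ler_enormD (u - v) (v - w); rewrite addrA subrK. Qed.

Lemma ler_enorm_sum (I : Type) (r : seq I) (P : pred I) (F : I -> 'rV[R]_d) :
  enorm (\sum_(i <- r | P i) F i) <= \sum_(i <- r | P i) enorm (F i).
Proof.
elim/big_rec2: _ => [|i a u _ H]; first by rewrite enorm0.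
by apply: le_trans (ler_enormD _ _) _; rewrite lerD2l.
Qed.

Lemma dotv_suml (I : Type) (r : seq I) (P : pred I) (F : I -> 'rV[R]_d) v :
  dotv (\sum_(i <- r | P i) F i) v = \sum_(i <- r | P i) dotv (F i) v.
Proof.
elim/big_rec2: _ => [|i a u _ <-]; [exact: dotv0l|exact: dotvDl].
Qed.

Lemma abs_le_enorm u i : `|u ord0 i| <= enorm u.
Proof.
rewrite -(ler_pXn2r (n := 2)) ?nnegrE ?enorm_ge0// enorm_sqr.
rewrite /dotv (bigD1 i) //= real_normK ?num_real// -expr2 lerDl.
by apply: sumr_ge0 => j _; rewrite -expr2 sqr_ge0.
Qed.

Lemma enorm_le_sum u : enorm u <= \sum_(i < d) `|u ord0 i|.
Proof.
apply: enorm_le; first by apply: sumr_ge0.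
rewrite expr2 mulr_suml; apply: ler_sum => i _.
apply: le_trans (ler_norm _) _; rewrite normrM ler_wpM2l//.
by rewrite (bigD1 i)//= lerDl; apply: sumr_ge0.
Qed.

Lemma norm_le_enorm u : `|u| <= enorm u.
Proof.
rewrite [leLHS]/Num.norm /= mx_normrE; apply/bigmax_leP; split=> [|[i j] _ /=].
  exact: enorm_ge0.
by rewrite ord1 abs_le_enorm.
Qed.

Lemma enorm_le_norm u : enorm u <= d%:R * `|u|.
Proof.
apply: le_trans (enorm_le_sum u) _.
have -> : d%:R * `|u| = \sum_(i < d) `|u|.
  by rewrite mulr_natl sumr_const card_ord.
apply: ler_sum => i _.
rewrite [leRHS]/Num.norm /= mx_normrE.
exact: (le_bigmax_cond _ (fun ij : 'I_1 * 'I_d => `|u ij.1 ij.2|) (j := (ord0, i))).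
Qed.

Lemma nbhs_enormP x (A : set 'rV[R]_d) :
  nbhs x A <-> exists2 e : R, 0 < e & forall y, enorm (y - x) < e -> A y.
Proof.
rewrite -nbhs_ballE; split=> [[e /= e0 H]|[e e0 H]].
  exists e => // y yx; apply: H; rewrite -ball_normE /ball_ /=.
  by apply: le_lt_trans yx; rewrite enormB norm_le_enorm.
have d0 : 0 < d%:R + 1 :> R by rewrite ltr_wpDl.
exists (e / (d%:R + 1)); first by rewrite /= divr_gt0.
move=> y; rewrite -ball_normE /ball_ /= ltr_pdivlMr// => yx; apply: H.
rewrite enormB; apply: le_lt_trans (enorm_le_norm _) _.
by apply: le_lt_trans yx; have := normr_ge0 (x - y); nra.
Qed.

Lemma closure_enormP (E : set 'rV[R]_d) x :
  closure E x -> forall e : R, 0 < e -> exists2 y, E y & enorm (y - x) < e.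
Proof.
move=> Ex e e0; have [|y [Ey xy]] := Ex [set y | enorm (y - x) < e].
  by apply/nbhs_enormP; exists e.
by exists y.
Qed.

(** Continuity within [0, +oo[ splits into two-sided continuity inside and right continuity at 0;
    the two cases merge here into one Euclidean epsilon-delta statement, the form used below. *)
Lemma continuous_RplusP (y : R -> 'rV[R]_d) :
  continuous_Rplus y <-> forall t, 0 <= t -> forall e : R, 0 < e ->
    exists2 eta : R, 0 < eta & forall r, 0 <= r -> `|r - t| < eta ->
      enorm (y r - y t) < e.
Proof.
rewrite /continuous_Rplus; split=> [/continuous_within_itvcyP[cy cy0]|H].
  move=> t t0 e e0.
  have nb z : nbhs z [set u | enorm (u - z) < e].
    by apply/nbhs_enormP; exists e.
  move: t0; rewrite le_eqVlt => /orP[/eqP <-|t0].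
    have /cy0 := nb (y 0); rewrite /nbhs /= /within/= => -[eta /= eta0 H].
    exists eta => // r; rewrite le_eqVlt => /orP[/eqP <- _|r0].
      by rewrite subrr enorm0.
    by move=> r0e; apply: H => //=; rewrite distrC.
  have /(cy t) : t \in `]0, +oo[ by rewrite in_itv/= t0.
  move=> /(_ _ (nb (y t))); rewrite /nbhs /= => -[eta /= eta0 H].
  by exists eta => // r r0 rt; apply: H => /=; rewrite distrC.
apply/continuous_within_itvcyP; split.
  move=> t; rewrite in_itv/= andbT => t0 A /nbhs_enormP[e e0 eA].
  have [eta eta0 He] := H t (ltW t0) e e0.
  exists (Num.min eta t); first by rewrite /= lt_min eta0.
  move=> r /=; rewrite lt_min => /andP[rt rt'].
  apply: eA; apply: He; last by rewrite distrC.
  by move: rt'; rewrite ltr_norml => /andP[_]; lra.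
move=> A /nbhs_enormP[e e0 eA].
have [eta eta0 He] := H 0 (lexx _) e e0.
exists eta => // r /= r1 r0; apply: eA; apply: He; first exact: ltW.
by rewrite distrC.
Qed.

End EuclideanTheory.

(** * Uniform continuity and boundedness of paths on compact intervals *)

Section UniformContinuity.
Context {R : realType} {d : nat}.
Implicit Types (y : R -> 'rV[R]_d).

(** Heine's theorem from the near-covering form of compactness, with the modulus [eta] as a
    parameter tending to 0 from the right: a modulus valid near each point becomes one valid on the
    whole interval. *)
Lemma continuous_Rplus_unif y (T : R) : continuous_Rplus y ->
  forall e : R, 0 < e -> exists2 eta : R, 0 < eta & forall r r' : R,
    0 <= r <= T -> 0 <= r' <= T -> `|r' - r| < eta -> enorm (y r' - y r) < e.
Proof.
move=> /continuous_RplusP cy e e0.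
have := @segment_compact R 0 T; rewrite compact_near_coveringP.
pose P (eta r : R) := 0 <= r <= T -> forall r',
    0 <= r' <= T -> `|r' - r| < eta -> enorm (y r' - y r) < e.
move=> /(_ R (nbhs 0^'+) P); case.
  move=> r /=; rewrite in_itv /= => /andP[r0 rT].
  have [eta eta0 H] := cy r r0 (e / 2) ltac:(lra).
  have e20 : 0 < eta / 2 by lra.
  (* Half of the local modulus goes to the move of the base point, half to the move of [r']. *)
  exists (ball r (eta / 2), [set a | a < eta / 2]).
    split=> /=; first exact: nbhsx_ballx.
    exact: nbhs_right_lt.
  move=> -[r1 a] /= [rr1 ae] /andP[r10 r1T] r' /andP[r'0 r'T] rr'.
  apply: le_lt_trans (ler_enorm_trans _ (y r) _) _.
  have h1 : `|r1 - r| < eta.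
    by move: rr1; rewrite /ball/= distrC; lra.
  have h2 : `|r' - r| < eta.
    have : `|r' - r| <= `|r' - r1| + `|r1 - r| by exact: ler_distD.
    by move: rr1; rewrite /ball/= distrC; lra.
  by rewrite (enormB (y r)); have := H _ r10 h1; have := H _ r'0 h2; lra.
move=> eta /= eta0 H; exists (eta / 2); first by lra.
move=> r r' r0T r'0T rr'; have e2 : 0 < eta / 2 by lra.
apply: (H (eta / 2)) rr' => //=.
by rewrite distrC subr0 gtr0_norm; lra.
Qed.

Lemma continuous_Rplus_bounded y (T : R) : continuous_Rplus y ->
  exists2 B : R, 0 <= B & forall r : R, 0 <= r <= T -> enorm (y r) <= B.
Proof.
move=> /continuous_RplusP cy.
have := @segment_compact R 0 T; rewrite compact_near_coveringP.
pose P (B r : R) := 0 <= r <= T -> enorm (y r) <= B.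
move=> /(_ R (nbhs +oo) P); case.
  move=> r /=; rewrite in_itv /= => /andP[r0 rT].
  have [eta eta0 H] := cy r r0 1 ltr01.
  exists (ball r eta, [set a | enorm (y r) + 1 < a]).
    by split=> /=; [exact: nbhsx_ballx|apply: nbhs_pinfty_gt; rewrite num_real].
  move=> -[r1 a] /= [rr1 ae] /andP[r10 r1T].
  have := ler_enorm_trans (y r1) (y r) 0; rewrite !subr0.
  have := H r1 r10; rewrite distrC => /(_ rr1); lra.
move=> B [Br H]; exists (Num.max 0 (B + 1)); first by rewrite le_max lexx.
move=> r rT; apply: (H (Num.max 0 (B + 1))) => //=.
by rewrite lt_max ltrDl ltr01 orbT.
Qed.

End UniformContinuity.

(** * Limits along ultrafilters *)

Section UltraLimits.
Context {R : realType}.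

(* Limits along a fixed ultrafilter replace subsequence extraction. *)
Lemma nat_ultrafilter : exists U : set_system nat,
  UltraFilter U /\ forall N, U [set n | (N <= n)%N].
Proof.
have [U [UU H]] := @ultraFilterLemma nat (nbhs \oo) _.
by exists U; split=> // N; apply: H; exists N.
Qed.

Lemma ultra_ex3 (T : Type) (U : set_system T) (A B C : set T) : UltraFilter U ->
  U A -> U B -> U C -> exists n, [/\ A n, B n & C n].
Proof.
move=> UU UA UB UC.
have [n [[An Bn] Cn]] := @filter_ex _ U _ _ (filterI (filterI UA UB) UC).
by exists n.
Qed.

(** Compactness of [-B, B] gives a cluster point, and a cluster point of an ultrafilter is a limit:
    the indices that stay away from it by [e] cannot form a member of [U]. *)
Lemma ultra_real_cvg (U : set_system nat) (u : nat -> R) (B : R) :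
  UltraFilter U -> U [set n | `|u n| <= B] ->
  exists l, forall e : R, 0 < e -> U [set n | `|u n - l| < e].
Proof.
move=> UU uB.
have := @segment_compact R (- B) B => /(_ (u @ U) _) [].
  change (U [set n | u n \in `[- B, B]]); apply: filterS uB => n /=.
  by rewrite in_itv/= ler_norml.
move=> l [_ ul]; exists l => e e0.
have [//|H] := in_ultra_setVsetC [set n | `|u n - l| < e] UU.
have [||z [/= zl lz]] := ul [set z | ~ `|z - l| < e] [set z | `|z - l| < e].
- exact: H.
- by exists e => //= z /=; rewrite distrC.
by [].
Qed.

Lemma ultra_enorm_cvg (d : nat) (U : set_system nat) (u : nat -> 'rV[R]_d) (B : R) :
  UltraFilter U -> U [set n | enorm (u n) <= B] ->
  exists l, forall e : R, 0 < e -> U [set n | enorm (u n - l) < e].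
Proof.
move=> UU uB.
have /choice[l Hl] : forall i, exists li, forall e : R, 0 < e -> U [set n | `|u n ord0 i - li| < e].
  move=> i; apply: (@ultra_real_cvg U (fun n => u n ord0 i) B) => //.
  by apply: filterS uB => n /=; apply: le_trans; exact: abs_le_enorm.
exists (\row_i l i) => e e0.
(* The dimension may be 0, hence the division by [d + 1]. *)
have d0 : 0 < d%:R + 1 :> R by rewrite ltr_wpDl.
have : U [set n | forall i, `|u n ord0 i - l i| < e / (d%:R + 1)].
  by apply: filter_forall => i; apply: Hl; rewrite divr_gt0.
apply: filterS => n /= H.
apply: le_lt_trans (enorm_le_sum _) _.
apply: (@le_lt_trans _ _ (\sum_(i < d) e / (d%:R + 1))).
  by apply: ler_sum => i _; rewrite !mxE; exact/ltW/H.
by rewrite sumr_const card_ord -[ltLHS]mulr_natr mulrAC ltr_pdivrMr//; nra.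
Qed.

End UltraLimits.

(** * Riemann-Stieltjes integrals *)

Section UniformPartition.
Context {R : realType}.
Implicit Types (s t : R).

Definition grid s t N (i : nat) : R := s + (t - s) * i%:R / N%:R.

Definition grid_partition s t N : seq R := [seq grid s t N i.+1 | i <- iota 0 N].

Lemma grid0 s t N : grid s t N 0 = s.
Proof. by rewrite /grid mulr0 mul0r addr0. Qed.

Lemma gridN s t N : (0 < N)%N -> grid s t N N = t.
Proof. by move=> N0; rewrite /grid mulfK ?pnatr_eq0 -?lt0n// addrC subrK. Qed.

Lemma gridS s t N i : grid s t N i.+1 - grid s t N i = (t - s) / N%:R.
Proof. by rewrite /grid -natr1; ring. Qed.

Lemma grid_le s t N i j : s <= t -> (i <= j)%N -> grid s t N i <= grid s t N j.
Proof.
move=> st ij; rewrite lerD2l ler_wpM2r ?invr_ge0// ler_wpM2l ?subr_ge0//.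
by rewrite ler_nat.
Qed.

Lemma grid_in s t N i : s <= t -> (i <= N)%N -> s <= grid s t N i <= t.
Proof.
move=> st iN; rewrite -{1}(grid0 s t N) grid_le//=.
case: N iN => [|N iN]; last by rewrite -{2}(@gridN s t N.+1)// grid_le.
by rewrite leqn0 => /eqP ->; rewrite grid0.
Qed.

Lemma nth_grid_partition s t N i : (i <= N)%N ->
  nth 0 (s :: grid_partition s t N) i = grid s t N i.
Proof.
case: i => [|i iN] /=; first by rewrite grid0.
by rewrite (nth_map 0%N) ?size_iota// nth_iota.
Qed.

Lemma size_grid_partition s t N : size (grid_partition s t N) = N.
Proof. by rewrite size_map size_iota. Qed.

Lemma grid_itv_partition s t N : s < t -> (0 < N)%N ->
  itv_partition s t (grid_partition s t N).
Proof.
move=> st N0; split.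
  apply/(pathP 0) => i; rewrite size_grid_partition => iN.
  rewrite nth_grid_partition ?(ltnW iN)//.
  have -> : nth 0 (grid_partition s t N) i = grid s t N i.+1.
    by rewrite -nth_grid_partition.
  by rewrite -subr_gt0 gridS divr_gt0 ?subr_gt0// ltr0n.
by rewrite (last_nth 0) size_grid_partition nth_grid_partition// gridN.
Qed.

Lemma grid_small s t (eta : R) : 0 < eta ->
  exists2 N0, (0 < N0)%N & forall N, (N0 <= N)%N -> (t - s) / N%:R < eta.
Proof.
move=> eta0; have [] := @nbhs_infty_gtr R (Num.max 1 ((t - s) / eta)).
move=> N0 _ H; exists N0.+1 => // N N0N.
have := H N (ltnW N0N); rewrite /= gt_max => /andP[N1].
by rewrite ltr_pdivrMr// mulrC -ltr_pdivrMr//; lra.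
Qed.

Lemma fine_partition s t (eta : R) : s <= t -> 0 < eta ->
  exists2 p, itv_partition s t p & forall i, (i < size p)%N ->
    nth 0 (s :: p) i <= nth 0 (s :: p) i.+1
    /\ nth 0 (s :: p) i.+1 - nth 0 (s :: p) i < eta.
Proof.
rewrite le_eqVlt => /orP[/eqP <- _|st eta0]; first by exists [::] => //; split=> //=.
have [N N0 HN] := grid_small s t eta0.
exists (grid_partition s t N); first exact: grid_itv_partition.
move=> i; rewrite size_grid_partition => iN.
rewrite !nth_grid_partition ?(ltnW iN)// gridS; split; last exact: HN.
by rewrite grid_le// ltW.
Qed.

End UniformPartition.

Section RSTheory.
Context {R : realType} {U V : zmodType}.
Variables (b : U -> V -> R).
Implicit Types (f : R -> U) (g : R -> V) (s t e I : R) (p : seq R).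

Lemma RS_sum_cons f g s a p xi :
  RS_sum b f g s (a :: p) xi =
  b (f (xi 0%N)) (g a - g s) + RS_sum b f g a p (fun i => xi i.+1).
Proof. by rewrite /RS_sum big_ord_recl. Qed.

(** [J] plays the indefinite integral. A local error proportional to an increment of [G] telescopes
    along any partition, so the number of its points does not enter the bound. *)
Lemma RS_sum_approx f g (J G : R -> R) s t eta e p xi :
  itv_partition s t p ->
  (forall i, (i < size p)%N -> nth 0 (s :: p) i <= xi i <= nth 0 (s :: p) i.+1
    /\ nth 0 (s :: p) i.+1 - nth 0 (s :: p) i < eta) ->
  (forall q r x, s <= q -> q <= x <= r -> r <= t -> r - q < eta ->
     `|b (f x) (g r - g q) - (J r - J q)| <= e * (G r - G q)) ->
  `|RS_sum b f g s p xi - (J t - J s)| <= e * (G t - G s).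
Proof.
elim: p s xi => [|a p ih] s xi /=.
  move=> /itv_partition_nil -> _ _; rewrite /RS_sum big_ord0 !subrr mulr0.
  by rewrite normr0.
move=> sp tags H; rewrite RS_sum_cons.
have ap := itv_partition_cons sp.
have sa : s < a by case: sp => /= /andP[].
have at_ : a <= t by exact: itv_partition_le ap.
have := tags 0%N isT; rewrite /= => -[xi0 eta0].
have := H s a (xi 0%N) (lexx _) xi0 at_ eta0.
have := ih a (fun i => xi i.+1) ap (fun i => tags i.+1)
  (fun q r x aq => H q r x (le_trans (ltW sa) aq)).
set S := RS_sum _ _ _ _ _ _; set B := b _ _ => h1 h2.
have -> : B + S - (J t - J s) = (S - (J t - J a)) + (B - (J a - J s)) by ring.
by apply: le_trans (ler_normD _ _) _; lra.
Qed.

Lemma is_RS_int_approx f g (J G : R -> R) s t : s <= t -> G s <= G t ->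
  (forall e : R, 0 < e -> exists2 eta : R, 0 < eta &
     forall q r x, s <= q -> q <= x <= r -> r <= t -> r - q < eta ->
     `|b (f x) (g r - g q) - (J r - J q)| <= e * (G r - G q)) ->
  is_RS_int b f g s t (J t - J s).
Proof.
move=> st Gst H e e0.
have D0 : 0 < G t - G s + 1 by lra.
have [eta eta0 He] := H (e / (G t - G s + 1)) (divr_gt0 e0 D0).
exists eta => // p xi sp tags.
apply: le_lt_trans (RS_sum_approx sp tags He) _.
by rewrite mulrAC ltr_pdivrMr//; nra.
Qed.

Lemma is_RS_int_le f g s t I c e eta' : s <= t -> 0 < eta' -> is_RS_int b f g s t I ->
  (forall p xi, itv_partition s t p ->
    (forall i, (i < size p)%N ->
       nth 0 (s :: p) i <= xi i <= nth 0 (s :: p) i.+1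
       /\ nth 0 (s :: p) i.+1 - nth 0 (s :: p) i < eta') ->
    `|RS_sum b f g s p xi - c| <= e) ->
  `|I - c| <= e.
Proof.
move=> st eta'0 HI H; apply/ler_addgt0Pr => e' e'0.
have [eta eta0 He] := HI e' e'0.
have [|p sp tp] := @fine_partition R s t (Num.min eta eta') st.
  by rewrite lt_min eta0.
pose xi i := nth 0 (s :: p) i.
have h1 : `|RS_sum b f g s p xi - c| <= e.
  by apply: H => // i ip; have [h] := tp i ip; rewrite lt_min lexx h => /andP[].
have h2 : `|RS_sum b f g s p xi - I| < e'.
  by apply: He => // i ip; have [h] := tp i ip; rewrite lt_min lexx h => /andP[].
have -> : I - c = (RS_sum b f g s p xi - c) - (RS_sum b f g s p xi - I) by ring.
by apply: le_trans (ler_normB _ _) _; lra.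
Qed.

Lemma is_RS_int_unique f g s t I I' : s <= t ->
  is_RS_int b f g s t I -> is_RS_int b f g s t I' -> I = I'.
Proof.
move=> st HI HI'; apply/eqP; rewrite -subr_eq0 -normr_le0.
apply/ler_addgt0Pr => e e0; rewrite add0r.
have [eta eta0 He] := HI (e / 2) ltac:(lra).
have [eta' eta'0 He'] := HI' (e / 2) ltac:(lra).
have [|p sp tp] := @fine_partition R s t (Num.min eta eta') st.
  by rewrite lt_min eta0.
pose xi i := nth 0 (s :: p) i.
have h1 : `|RS_sum b f g s p xi - I| < e / 2.
  by apply: He => // i ip; have [h] := tp i ip; rewrite lt_min lexx h => /andP[].
have h2 : `|RS_sum b f g s p xi - I'| < e / 2.
  by apply: He' => // i ip; have [h] := tp i ip; rewrite lt_min lexx h => /andP[].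
have -> : I - I' = (RS_sum b f g s p xi - I') - (RS_sum b f g s p xi - I) by ring.
by apply: le_trans (ler_normB _ _) _; lra.
Qed.

Lemma RS_intE f g s t I : s <= t -> is_RS_int b f g s t I -> RS_int b f g s t = I.
Proof.
move=> st HI; apply: (@is_RS_int_unique f g s t) => //.
by rewrite /RS_int; apply: xgetPex; exists I.
Qed.

Lemma is_RS_int_grid f g s t I e : s < t -> is_RS_int b f g s t I -> 0 < e ->
  exists2 n0, (0 < n0)%N & forall n, (n0 <= n)%N ->
    `|\sum_(i < n) b (f (grid s t n i)) (g (grid s t n i.+1) - g (grid s t n i)) - I| < e.
Proof.
move=> st HI e0; have [eta eta0 He] := HI e e0.
have [n0 n00 hn] := grid_small s t eta0; exists n0 => // n n0n.
have npos : (0 < n)%N by exact: leq_trans n0n.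
have := He (grid_partition s t n) (grid s t n) (grid_itv_partition st npos).
rewrite /RS_sum size_grid_partition.
under eq_bigr do rewrite !nth_grid_partition ?(ltnW (ltn_ord _))//.
apply=> i iN; rewrite !nth_grid_partition ?(ltnW iN)// gridS lexx grid_le ?ltW//.
by split=> //; exact: hn.
Qed.

(** The constant [c] has the exact indefinite integral [b c (g r)], and replacing [f] by [c] costs
    at most [e] times the increment of [G] on each cell. *)
Lemma is_RS_int_near f g (N : U -> R) (G : R -> R) s t I c e :
  (forall u u' v, b (u - u') v = b u v - b u' v) ->
  (forall u v v', b u (v - v') = b u v - b u v') ->
  s <= t -> is_RS_int b f g s t I ->
  (forall q r, s <= q -> q <= r -> r <= t -> G q <= G r) ->
  (forall u q r, s <= q -> q <= r -> r <= t ->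
     `|b u (g r - g q)| <= N u * (G r - G q)) ->
  (forall r, s <= r <= t -> N (f r - c) <= e) ->
  `|I - b c (g t - g s)| <= e * (G t - G s).
Proof.
move=> bBl bBr st HI Gnd bG fc; rewrite bBr.
apply: (@is_RS_int_le f g s t I _ _ 1) => // p xi sp tags.
apply: (@RS_sum_approx f g (fun r => b c (g r)) G s t 1) => // q r x sq /andP[qx xr] rt _.
have qr := le_trans qx xr.
rewrite -bBr -bBl; apply: le_trans (bG _ _ _ sq qr rt) _.
by rewrite ler_wpM2r ?subr_ge0 ?Gnd// fc// (le_trans sq)//= (le_trans xr).
Qed.

End RSTheory.

(** * Existence of the Riemann-Stieltjes integral *)

Section RSExistence.
Context {R : realType} {U V : zmodType}.
Variables (b : U -> V -> R) (N : U -> R).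
Hypothesis N_ge0 : forall u, 0 <= N u.
Hypothesis bBl : forall u u' v, b (u - u') v = b u v - b u' v.
Hypothesis bBr : forall u v v', b u (v - v') = b u v - b u v'.
Variables (f : R -> U) (g : R -> V) (G : R -> R) (s t B : R).
Hypothesis st : s <= t.
Hypothesis Gnd : forall q r, s <= q -> q <= r -> r <= t -> G q <= G r.
Hypothesis bG : forall u q r, s <= q -> q <= r -> r <= t ->
  `|b u (g r - g q)| <= N u * (G r - G q).
Hypothesis fB : forall r, s <= r <= t -> N (f r) <= B.
Hypothesis fU : forall e : R, 0 < e -> exists2 eta : R, 0 < eta & forall r r' : R,
  s <= r <= t -> s <= r' <= t -> `|r' - r| < eta -> N (f r' - f r) < e.

Let h n : R := (t - s) / n.+1%:R.
Let x n i : R := grid s t n.+1 i.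

(* The Riemann sum over the grid of [s, t] with the integrator stopped at [q];
   its limit in [n] is an indefinite integral. *)
Definition clipped_sum n q : R := \sum_(i < n.+1)
  b (f (x n i)) (g (Num.min q (x n i.+1)) - g (Num.min q (x n i))).

Let clip p q r : R := Num.max p (Num.min q r).

Let clip_in p q r : p <= q -> p <= clip p q r <= q.
Proof. by move=> pq; rewrite le_max lexx /= ge_max pq ge_min lexx. Qed.

Let clip_le p q r r' : r <= r' -> clip p q r <= clip p q r'.
Proof.
move=> rr'; rewrite ge_max !le_max lexx /= !le_min !ge_min lexx/= rr' orbT /=.
by rewrite orbT.
Qed.

Let clipE p q r : p <= q ->
  g (Num.min q r) - g (Num.min p r) = g (clip p q r) - g p.
Proof.
move=> pq; rewrite /clip; have [pr|rp] := leP p r.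
  by rewrite max_r// le_min pq.
by rewrite min_r ?(le_trans (ltW rp))// subrr max_l ?subrr// ltW.
Qed.

(** This is the local hypothesis of [is_RS_int_approx], uniformly in large [n]: the increment of the
    clipped sum over [q, r] sees only grid cells meeting [q, r], where [f] is close to [f z]. *)
Lemma clipped_sum_close (e : R) : 0 < e -> exists2 eta : R, 0 < eta &
  exists n0, forall n, (n0 <= n)%N -> forall q r z,
    s <= q -> q <= z <= r -> r <= t -> r - q < eta ->
    `|b (f z) (g r - g q) - (clipped_sum n r - clipped_sum n q)|
      <= e * (G r - G q).
Proof.
move=> e0; have [eta eta0 fe] := fU e0.
have eta2 : 0 < eta / 2 by lra.
have [n0 _ hn] := grid_small s t eta2.
exists (eta / 2) => //; exists n0 => n n0n q r z sq /andP[qz zr] rt rq.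
have qr := le_trans qz zr.
have hlt : forall i, x n i.+1 - x n i < eta / 2.
  by move=> i; rewrite gridS; apply: hn; exact: leqW.
(* Grid points pushed into [q, r]: they start at [q], end at [r], and cut [g r - g q] and the
   difference of clipped sums into the same cells. *)
pose c i := clip q r (x n i).
have c0 : c 0%N = q.
  by rewrite /c /x grid0 /clip max_l// ge_min sq orbT.
have cn : c n.+1 = r.
  by rewrite /c /x gridN// /clip min_l// max_r.
have tele (T : zmodType) (F : R -> T) :
    F r - F q = \sum_(i < n.+1) (F (c i.+1) - F (c i)).
  rewrite -cn -[in F q]c0.
  by rewrite -(big_mkord xpredT (fun i => F (c i.+1) - F (c i))) telescope_sumr.
have bsum u : b u (g r - g q) = \sum_(i < n.+1) b u (g (c i.+1) - g (c i)).
  by rewrite bBr (tele _ (b u \o g)); apply: eq_bigr => i _; rewrite bBr.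
have -> : b (f z) (g r - g q) - (clipped_sum n r - clipped_sum n q) =
    \sum_(i < n.+1) b (f z - f (x n i)) (g (c i.+1) - g (c i)).
  rewrite bsum /clipped_sum -sumrB -sumrB; apply: eq_bigr => i _.
  rewrite bBl; congr (_ - _); rewrite -bBr; congr (b _ _).
  rewrite -[g (c i.+1)](subrK (g q)) -[g (c i)](subrK (g q)) -!clipE//.
  by rewrite [in RHS]opprD addrACA subrr addr0 !opprB addrACA [in RHS]addrACA;
     congr (_ + _); rewrite addrC.
apply: le_trans (ler_norm_sum _ _ _) _.
rewrite (tele _ G) mulr_sumr; apply: ler_sum => i _.
have ci : c i <= c i.+1 by apply: clip_le; rewrite grid_le.
have [qci _] := andP (clip_in (x n i) qr).
have [_ cir] := andP (clip_in (x n i.+1) qr).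
have sci : s <= c i by rewrite (le_trans sq).
have cit : c i.+1 <= t by rewrite (le_trans cir).
have [xz|] := ltP `|z - x n i| eta.
  apply: le_trans (bG _ sci ci cit) _.
  rewrite ler_wpM2r ?subr_ge0 ?Gnd//.
  apply/ltW/fe => //; first by rewrite grid_in// ltnW.
  by rewrite (le_trans sq)//= (le_trans zr).
(* Mesh and [r - q] are below [eta / 2], so a grid point at distance [eta] from [z] has its whole
   cell on one side of [q, r], and clipping collapses the cell to a point. *)
move=> xz; suff -> : c i.+1 = c i.
  by rewrite !subrr -[X in b _ X](subrr 0) bBr subrr normr0 mulr0.
have hi := hlt i.
have xx : x n i <= x n i.+1 by rewrite grid_le.
move: xz; rewrite /c /clip ler_normr => /orP[xz|xz].
  by rewrite !min_r ?max_l; lra.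
by rewrite !min_l ?max_r; lra.
Qed.

Lemma clipped_sum_le n q : s <= q <= t -> `|clipped_sum n q| <= B * (G t - G s).
Proof.
move=> /andP[sq qt]; apply: le_trans (ler_norm_sum _ _ _) _.
have Gsq : G q - G s = \sum_(i < n.+1) (G (Num.min q (x n i.+1)) - G (Num.min q (x n i))).
  rewrite -(big_mkord xpredT (fun i => G (Num.min q (x n i.+1)) - G (Num.min q (x n i)))).
  by rewrite (telescope_sumr (fun i => G (Num.min q (x n i))))// /x gridN// grid0 min_l// min_r.
have B0 : 0 <= B by rewrite (le_trans (N_ge0 _) (fB (r := s) _))// lexx.
apply: (@le_trans _ _ (B * (G q - G s))); last first.
  by rewrite ler_wpM2l// lerD2r Gnd.
rewrite Gsq mulr_sumr; apply: ler_sum => i _.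
have xi := grid_in st (ltn_ord i); have xi' := grid_in st (ltnW (ltn_ord i)).
have smin : s <= Num.min q (x n i) by rewrite le_min sq; case/andP: xi'.
have mint : Num.min q (x n i.+1) <= t by rewrite ge_min qt.
have mm : Num.min q (x n i) <= Num.min q (x n i.+1).
  by rewrite le_min !ge_min lexx /= grid_le// orbT.
apply: le_trans (bG _ smin mm mint) _.
by rewrite ler_wpM2r ?subr_ge0 ?Gnd ?fB.
Qed.

(** The limit [J q] of the clipped sums is taken for each [q] separately. The local estimate is
    closed under limits, so it compares [J] with arbitrary tagged partitions although only uniform
    grids enter the construction. *)
Theorem is_RS_int_exists : exists I, is_RS_int b f g s t I.
Proof.
have [UF [UU Utail]] := nat_ultrafilter.
have /choice[J HJ] : forall q, exists l, s <= q <= t ->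
    forall e : R, 0 < e -> UF [set n | `|clipped_sum n q - l| < e].
  move=> q; case: (boolP (s <= q <= t)) => sqt; last by exists 0.
  have [|l Hl] := @ultra_real_cvg R UF (clipped_sum ^~ q) (B * (G t - G s)) UU.
    by apply: filterS (Utail 0%N) => n _; exact: clipped_sum_le.
  by exists l.
exists (J t - J s); apply: (@is_RS_int_approx _ _ _ b f g J G) => //.
  exact: Gnd.
move=> e e0; have [eta eta0 [n0 H]] := clipped_sum_close e0.
exists eta => // q r z sq qzr rt rq; apply/ler_addgt0Pr => e' e'0.
have qr : q <= r by case/andP: qzr; exact: le_trans.
have e'2 : 0 < e' / 2 by lra.
have Hq := HJ q; rewrite sq (le_trans qr rt) in Hq.
have Hr := HJ r; rewrite (le_trans sq qr) rt in Hr.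
have [n [/= h1 h2 /H h3]] := ultra_ex3 UU (Hq isT _ e'2) (Hr isT _ e'2) (Utail n0).
have := h3 q r z sq qzr rt rq.
set X := b _ _ => h4.
have -> : X - (J r - J q) = (X - (clipped_sum n r - clipped_sum n q))
   - (clipped_sum n q - J q) + (clipped_sum n r - J r) by ring.
apply: le_trans (ler_normD _ _) _.
by have := ler_normB (X - (clipped_sum n r - clipped_sum n q)) (clipped_sum n q - J q); lra.
Qed.

End RSExistence.

(** * Total variation and integrals against it *)

Section VarTheory.
Context {R : realType} {d : nat}.
Implicit Types (k f : R -> 'rV[R]_d) (p q s t : R).

Lemma Var_ge0 k t : 0 <= t -> (0 <= Var k t)%E.
Proof.
move=> t0.
have [pt tp _] := fine_partition t0 ltr01.
apply: le_trans (ereal_sup_ubound _); last by exists pt.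
by rewrite lee_fin sumr_ge0// => i _; exact: enorm_ge0.
Qed.

Lemma Var_fin k t : BV_loc k -> 0 <= t -> (fine (Var k t))%:E = Var k t.
Proof.
move=> bk t0; rewrite fineK// ge0_fin_numE; first exact: bk.
exact: Var_ge0.
Qed.

(** Appending [q] to a subdivision of [0, p] adds exactly [enorm (k q - k p)] to its sum. This
    inequality is what lets [Var k] serve as the dominating function [G] of the integration
    lemmas. *)
Lemma enorm_le_Var k p q : BV_loc k -> 0 <= p -> p <= q ->
  enorm (k q - k p) <= fine (Var k q) - fine (Var k p).
Proof.
move=> bk p0; rewrite le_eqVlt => /orP[/eqP <-|pq].
  by rewrite !subrr enorm0.
have q0 : 0 <= q by rewrite (le_trans p0)// ltW.
suff : (Var k p <= (fine (Var k q) - enorm (k q - k p))%:E)%E.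
  by rewrite -Var_fin// lee_fin; lra.
apply: ge_ereal_sup => _ [P pP <-]; rewrite lee_fin lerBrDr.
have qP : itv_partition 0 q (rcons P q).
  by rewrite -cats1; apply: itv_partition_cat pP _; exact: itv_partition1.
rewrite -lee_fin Var_fin//; apply: ereal_sup_ubound.
exists (rcons P q) => //; congr (_%:E).
rewrite size_rcons big_ord_recr /=; congr (_ + _).
  apply: eq_bigr => i _; rewrite -!rcons_cons !nth_rcons /= ltnS.
  by rewrite ltn_ord (ltnW (ltn_ord _)).
rewrite nth_rcons ltnn eqxx -rcons_cons nth_rcons/= ltnS leqnn.
congr (enorm (_ - k _)).
by case: pP => _ /eqP <-; rewrite (last_nth 0).
Qed.

Lemma Var_nd k p q : BV_loc k -> 0 <= p -> p <= q ->
  fine (Var k p) <= fine (Var k q).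
Proof.
by move=> bk p0 pq; rewrite -subr_ge0 (le_trans _ (enorm_le_Var bk p0 pq))// enorm_ge0.
Qed.

Lemma Var_le k (V : R -> R) t :
  (forall p q, 0 <= p -> p <= q -> enorm (k q - k p) <= V q - V p) ->
  0 <= t -> (Var k t <= (V t - V 0)%:E)%E.
Proof.
move=> kV t0; apply: ge_ereal_sup => _ [P + <-]; rewrite lee_fin.
suff H : forall a, 0 <= a -> itv_partition a t P ->
   \sum_(i < size P) enorm (k (nth 0 (a :: P) i.+1) - k (nth 0 (a :: P) i)) <= V t - V a.
  by move=> /H; apply.
elim: P => [|x P ih] a a0 aP.
  by rewrite big_ord0 (itv_partition_nil aP) subrr.
have ax : a <= x by case: aP => /= /andP[/ltW].
rewrite /= big_ord_recl/=.
have := ih x (le_trans a0 ax) (itv_partition_cons aP).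
have := kV _ _ a0 ax; rewrite /=; lra.
Qed.

Section Integrals.
Variables (k : R -> 'rV[R]_d) (f : R -> 'rV[R]_d).
Hypotheses (bk : BV_loc k) (cf : continuous_Rplus f).

Let dotv_bnd u q r : 0 <= q -> q <= r ->
  `|dotv u (k r - k q)| <= enorm u * (fine (Var k r) - fine (Var k q)).
Proof.
move=> q0 qr; apply: le_trans (dotv_norm _ _) _.
by rewrite ler_wpM2l ?enorm_ge0// enorm_le_Var.
Qed.

Let Var_bnd (u : R) q r : 0 <= q -> q <= r ->
  `|u * (fine (Var k r) - fine (Var k q))| <= `|u| * (fine (Var k r) - fine (Var k q)).
Proof. by move=> q0 qr; rewrite normrM [X in _ * X <= _]ger0_norm// subr_ge0 Var_nd. Qed.

Lemma sq_enorm_unif (T : R) (e : R) : 0 < e -> exists2 eta : R, 0 < eta & forall r r' : R,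
    0 <= r <= T -> 0 <= r' <= T -> `|r' - r| < eta ->
    `|enorm (f r') ^+ 2 - enorm (f r) ^+ 2| < e.
Proof.
move=> e0; have [B B0 fB] := continuous_Rplus_bounded T cf.
have B2 : 0 < 2 * B + 1 by lra.
have [eta eta0 H] := continuous_Rplus_unif T cf (divr_gt0 e0 B2).
exists eta => // r r' rT r'T rr'; have := H r r' rT r'T rr'.
rewrite ltr_pdivlMr// => h.
have h1 := fB r rT; have h2 := fB r' r'T.
have := ler_enorm_trans (f r') (f r) 0; have := ler_enorm_trans (f r) (f r') 0.
rewrite !subr0 (enormB (f r)) => h3 h4.
have h5 := enorm_ge0 (f r); have h6 := enorm_ge0 (f r').
have h7 := enorm_ge0 (f r' - f r).
rewrite subr_sqr normrM [X in _ * X]ger0_norm ?addr_ge0//.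
apply: (@le_lt_trans _ _ (enorm (f r' - f r) * (2 * B))); last by lra.
apply: ler_pM => //; first by lra.
  by rewrite ler_norml; apply/andP; split; lra.
by lra.
Qed.

Lemma RS_dotv_is s t : 0 <= s -> s <= t -> is_RS_int dotv f k s t (RS_int dotv f k s t).
Proof.
move=> s0 st; apply: xgetPex.
have [B B0 fB] := continuous_Rplus_bounded t cf.
apply: (@is_RS_int_exists _ _ _ dotv enorm enorm_ge0 _ _ f k (fun r => fine (Var k r)) s t B) => //.
- by move=> *; rewrite dotvBl.
- by move=> *; rewrite dotvBr.
- by move=> q r sq qr _; apply: Var_nd => //; exact: le_trans sq.
- by move=> u q r sq qr _; apply: dotv_bnd => //; exact: le_trans sq.
- by move=> r /andP[sr rt]; apply: fB; rewrite (le_trans s0).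
move=> e e0; have [eta eta0 H] := continuous_Rplus_unif t cf e0.
exists eta => // r r' /andP[sr rt] /andP[sr' r't]; apply: H.
  by rewrite (le_trans s0).
by rewrite (le_trans s0).
Qed.

Lemma RS_sq_is s t : 0 <= s -> s <= t ->
  is_RS_int (fun a c : R => a * c) (fun r => enorm (f r) ^+ 2) (fun r => fine (Var k r)) s t
   (RS_int (fun a c : R => a * c) (fun r => enorm (f r) ^+ 2) (fun r => fine (Var k r)) s t).
Proof.
move=> s0 st; apply: xgetPex.
have [B B0 fB] := continuous_Rplus_bounded t cf.
apply: (@is_RS_int_exists _ _ _ (fun a c : R => a * c) Num.norm (@normr_ge0 _ _) _ _ _ _
  (fun r => fine (Var k r)) s t (B ^+ 2)) => //.
- by move=> *; rewrite mulrBl.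
- by move=> *; rewrite mulrBr.
- by move=> q r sq qr _; apply: Var_nd => //; exact: le_trans sq.
- by move=> u q r sq qr _; apply: Var_bnd => //; exact: le_trans sq.
- move=> r /andP[sr rt]; rewrite ger0_norm ?sqr_ge0//.
  by rewrite lerXn2r ?nnegrE ?enorm_ge0// fB// (le_trans s0).
move=> e e0; have [eta eta0 H] := sq_enorm_unif t e0.
exists eta => // r r' /andP[sr rt] /andP[sr' r't]; apply: H.
  by rewrite (le_trans s0).
by rewrite (le_trans s0).
Qed.

Lemma RS_dotv_near s t c e : 0 <= s -> s <= t ->
  (forall r, s <= r <= t -> enorm (f r - c) <= e) ->
  `|RS_int dotv f k s t - dotv c (k t - k s)| <= e * (fine (Var k t) - fine (Var k s)).
Proof.
move=> s0 st H.
apply: (@is_RS_int_near _ _ _ dotv f k enorm (fun r => fine (Var k r))) => //.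
- by move=> *; rewrite dotvBl.
- by move=> *; rewrite dotvBr.
- exact: RS_dotv_is.
- by move=> q r sq qr _; apply: Var_nd => //; exact: le_trans sq.
- by move=> u q r sq qr _; apply: dotv_bnd => //; exact: le_trans sq.
Qed.

Lemma RS_sq_le s t e : 0 <= s -> s <= t ->
  (forall r, s <= r <= t -> enorm (f r) ^+ 2 <= e) ->
  RS_int (fun a c : R => a * c) (fun r => enorm (f r) ^+ 2) (fun r => fine (Var k r)) s t
  <= e * (fine (Var k t) - fine (Var k s)).
Proof.
move=> s0 st H.
apply: le_trans (ler_norm _) _.
set I := RS_int _ _ _ _ _.
(* Freezing the integrand at the constant 0 turns the approximation lemma into a bound. *)
have -> : I = I - 0 * (fine (Var k t) - fine (Var k s)) by rewrite mul0r subr0.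
apply: (@is_RS_int_near _ _ _ (fun a c : R => a * c) (fun r => enorm (f r) ^+ 2)
  (fun r => fine (Var k r)) Num.norm (fun r => fine (Var k r)) s t) => //.
- by move=> *; rewrite mulrBl.
- by move=> *; rewrite mulrBr.
- exact: RS_sq_is.
- by move=> q r sq qr _; apply: Var_nd => //; exact: le_trans sq.
- by move=> u q r sq qr _; apply: Var_bnd => //; exact: le_trans sq.
- by move=> r rst; rewrite subr0 ger0_norm ?sqr_ge0// H.
Qed.

End Integrals.
End VarTheory.

(** * The implicit Euler scheme *)

Section Scheme.
Context {R : realType} {d : nat}.
Variables (rho gamma L delta sigma : R) (D : set 'rV[R]_d) (f : 'rV[R]_d -> R).
Hypotheses (rho0 : 0 <= rho) (gamma0 : 0 <= gamma) (L0 : 0 <= L)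
  (delta0 : 0 < delta) (sigma0 : 0 < sigma).
Hypothesis fL : forall x y, D x -> D y -> `|f x - f y| <= L + L * enorm (x - y).
Hypothesis Dball : shifted_interior_ball gamma delta sigma D.

(** The discrete counterpart of k = x0 + m - x. *)
Definition reflection (mm X : nat -> 'rV[R]_d) i := X 0%N + mm i - X i.

Definition reflection_step mm X i := reflection mm X i.+1 - reflection mm X i.

(** The consequences of minimality that the estimates use: comparing [X i.+1] with [X i] controls a
    single step, and the subgradient inequality is multiplied by [h], so that it involves
    [reflection_step] itself rather than a quotient. *)
Definition is_scheme (h : R) (mm X : nat -> 'rV[R]_d) : Prop :=
  [/\ forall i, D (X i),
    forall i, enorm (reflection_step mm X i) ^+ 2 <=
      enorm (mm i.+1 - mm i) ^+ 2 + 2 * h * (L + L * enorm (X i.+1 - X i)) &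
    forall i z, D z ->
      dotv (reflection_step mm X i) (z - X i.+1) + h * f (X i.+1) <=
      h * f z + (rho * h + gamma * enorm (reflection_step mm X i))
                * enorm (z - X i.+1) ^+ 2].

Section Window.
Variables (h : R) (mm X : nat -> 'rV[R]_d).
Hypotheses (h0 : 0 < h) (sX : is_scheme h mm X).
Local Notation K := (reflection mm X).
Local Notation dK := (reflection_step mm X).

Lemma reflectionB a b : K b - K a = (mm b - mm a) - (X b - X a).
Proof. by apply/rowP => j; rewrite !mxE; ring. Qed.

Lemma reflection_sum a b : (a <= b)%N -> K b - K a = \sum_(a <= i < b) dK i.
Proof. by move=> ab; rewrite telescope_sumr. Qed.

(** The square of the reflection step is bounded by a term linear in the jump with a small factor,
    so a reflection step longer than [e] is contradictory. The constant is [e] for the reflection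
    plus [e / 4] for the driving path. *)
Lemma scheme_jump e i : 0 < e <= 1 -> enorm (mm i.+1 - mm i) <= e / 4 ->
  2 * h * L <= e ^+ 2 / 16 -> enorm (X i.+1 - X i) <= 5 / 4 * e.
Proof.
move=> /andP[e0 e1] mi hL; case: sX => _ /(_ i) + _.
set q := enorm (dK i); set w := enorm (mm i.+1 - mm i) in mi * => Hq.
have w0 : 0 <= w by exact: enorm_ge0.
have q0 : 0 <= q by exact: enorm_ge0.
set x := enorm (X i.+1 - X i) in Hq *.
have x0 : 0 <= x by exact: enorm_ge0.
have xqw : x <= q + w.
  have -> : x = enorm ((mm i.+1 - mm i) - dK i).
    by rewrite /x /reflection_step reflectionB subKr.
  by apply: le_trans (ler_enormB _ _) _; rewrite addrC.
suff : q <= e by lra.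
rewrite leNgt; apply/negP => eq.
have h1 : w ^+ 2 <= e ^+ 2 / 16 by nra.
have h2 : 2 * h * (L + L * x) <= e ^+ 2 / 16 * (1 + q + e / 4).
  have -> : 2 * h * (L + L * x) = 2 * h * L * (1 + x) by ring.
  apply: ler_pM; [|lra|exact: hL|lra].
  by rewrite !mulr_ge0// ltW.
have h3 : e ^+ 2 * q <= e * q ^+ 2.
  have : 0 <= e * q * (q - e) by rewrite !mulr_ge0// ?subr_ge0 ltW.
  by lra.
have h4 : e * q ^+ 2 <= q ^+ 2 by nra.
have h5 : e ^+ 2 * e <= e ^+ 2 by nra.
have h6 : e ^+ 2 < q ^+ 2 by nra.
nra.
Qed.

(** The ball condition at [X a] gives one [v] for the whole window, so the sum of the
    [dotv (dK i) v] telescopes to an increment of [K]. Since the test point is within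
    [enorm v + lam <= 2] of [X i.+1], the change of [f] costs [L + 2 L] and the quadratic term
    [4 rho] per unit of time. *)
Lemma window_variation a b : (a <= b)%N ->
  (forall i, (a < i <= b)%N -> enorm (X i - X a) <= delta) ->
  sigma * \sum_(a <= i < b) enorm (dK i) <=
  enorm (K b - K a) + (3 * L + 4 * rho) * (h * (b%:R - a%:R)).
Proof.
case: sX => XD _ Xvi ab Xab.
have [lam [v [/andP[lam0 lam1] v1 slv ball]]] := Dball (XD a).
have one i : (a < i.+1 <= b)%N ->
    sigma * enorm (dK i) <= - dotv (dK i) v + (3 * L + 4 * rho) * h.
  move=> ib; set n := enorm (dK i).
  (* For a vanishing step [n^-1] is 0 by convention, and [u = 0] is still admissible. *)
  pose u := n^-1 *: dK i.
  have n0 : 0 <= n by exact: enorm_ge0.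
  have v0 := enorm_ge0 v.
  have u1 : enorm u <= 1.
    rewrite enormZ ger0_norm ?invr_ge0// -/n.
    have [->|nn0] := eqVneq n 0; first by rewrite mulr0.
    by rewrite mulVf.
  have du : dotv (dK i) u = n.
    rewrite dotvZr -enorm_sqr -/n expr2 mulrA.
    have [->|nn0] := eqVneq n 0; first by rewrite mulr0.
    by rewrite mulVf// mul1r.
  pose z := X i.+1 + v + lam *: u.
  have lu : enorm (lam *: u) <= lam by rewrite enormZ gtr0_norm// ler_piMr// ltW.
  have Dz : D z.
    apply: (ball (X i.+1)); first by split; [exact: XD|exact: Xab].
    by rewrite /ecball /= /z addrAC subrr add0r.
  have zX : z - X i.+1 = v + lam *: u by apply/rowP => j; rewrite !mxE; ring.
  have nz : enorm (z - X i.+1) <= enorm v + lam.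
    by rewrite zX; apply: le_trans (ler_enormD _ _) _; rewrite lerD2l.
  have := Xvi i z Dz; rewrite {1}zX dotvDr dotvZr du -/n.
  have fz : f z - f (X i.+1) <= 3 * L.
    apply: le_trans (ler_norm _) _; apply: le_trans (fL Dz (XD _)) _.
    have : L * enorm (z - X i.+1) <= L * 2 by rewrite ler_wpM2l//; lra.
    by lra.
  have hfz : h * f z - h * f (X i.+1) <= h * (3 * L).
    by rewrite -mulrBr ler_wpM2l// ltW.
  have zz : enorm (z - X i.+1) ^+ 2 <= (enorm v + lam) ^+ 2.
    by rewrite lerXn2r ?nnegrE ?enorm_ge0// addr_ge0 ?enorm_ge0// ltW.
  have zz4 : (enorm v + lam) ^+ 2 <= 4 by nra.
  have rh : (rho * h + gamma * n) * enorm (z - X i.+1) ^+ 2 <=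
      rho * h * 4 + gamma * n * (enorm v + lam) ^+ 2.
    rewrite mulrDl lerD//.
      by rewrite ler_wpM2l// ?(le_trans zz)// mulr_ge0// ltW.
    by rewrite ler_wpM2l// mulr_ge0.
  have := ler_wpM2r n0 slv; lra.
have {one} : forall c, (a <= c <= b)%N ->
    sigma * \sum_(a <= i < c) enorm (dK i) <=
    - dotv (K c - K a) v + (3 * L + 4 * rho) * (h * (c%:R - a%:R)).
  elim=> [|c ih] /andP[ac cb].
    by move: ac; rewrite leqn0 => /eqP ->; rewrite big_geq// !subrr dotv0l !mulr0 oppr0 addr0.
  move: ac; rewrite leq_eqVlt => /orP[/eqP ->|]; last rewrite ltnS => ac.
    by rewrite big_geq// !subrr dotv0l !mulr0 oppr0 addr0.
  have := ih _; rewrite ac (ltnW cb) => /(_ isT).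
  rewrite big_nat_recr//=.
  have := one c; rewrite ltnS ac cb => /(_ isT).
  have -> : K c.+1 - K a = dK c + (K c - K a) by rewrite /reflection_step addrA subrK.
  by rewrite [dotv (dK c + _) _]dotvDl -[c.+1%:R]natr1; lra.
move=> /(_ b); rewrite ab leqnn => /(_ isT) H; apply: le_trans H _.
rewrite lerD2r -dotvNl; apply: le_trans (dotv_le _ _) _.
by rewrite enormN ler_piMr// enorm_ge0.
Qed.

(** Here the test point is [X a]. The growth of [|K c - K a|^2] in one step is at most twice
    [dotv (dK c) (K c.+1 - K a)], and [K c.+1 - K a] is the increment of [mm] minus that of [X]: the
    first costs [w] times [|dK c|], the second is the tested quantity. *)
Lemma window_displacement a b e w : (a <= b)%N -> 0 <= e <= 1 ->
  (forall i, (a < i <= b)%N -> enorm (X i - X a) <= e) ->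
  (forall i, (a < i <= b)%N -> enorm (mm i - mm a) <= w) ->
  enorm (K b - K a) ^+ 2 <= 2 * (2 * L + rho) * (h * (b%:R - a%:R)) +
    2 * (gamma * e ^+ 2 + w) * \sum_(a <= i < b) enorm (dK i).
Proof.
case: sX => XD _ Xvi ab /andP[e0 e1] Xe mw.
suff : forall c, (a <= c <= b)%N ->
  enorm (K c - K a) ^+ 2 <= 2 * (2 * L + rho) * (h * (c%:R - a%:R)) +
    2 * (gamma * e ^+ 2 + w) * \sum_(a <= i < c) enorm (dK i).
  by apply; rewrite ab leqnn.
have base : enorm (K a - K a) ^+ 2 <= 2 * (2 * L + rho) * (h * (a%:R - a%:R)) +
    2 * (gamma * e ^+ 2 + w) * \sum_(a <= i < a) enorm (dK i).
  by rewrite big_geq// !subrr !mulr0 addr0 enorm0 expr0n.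
elim=> [|c ih] /andP[ac cb].
  by move: ac; rewrite leqn0 => /eqP a0; move: base; rewrite a0.
move: ac; rewrite leq_eqVlt => /orP[/eqP <- //|]; rewrite ltnS => ac.
have := ih _; rewrite ac (ltnW cb) => /(_ isT).
rewrite big_nat_recr//= -[c.+1%:R]natr1.
have -> : K c - K a = (K c.+1 - K a) - dK c.
  by rewrite /reflection_step; apply/rowP => j; rewrite !mxE; ring.
have := enormD_sqr (K c.+1 - K a) (- dK c); rewrite enormN => ->.
have := sqr_ge0 (enorm (dK c)).
have acb : (a < c.+1 <= b)%N by rewrite ltnS ac.
have := Xvi c (X a) (XD a); rewrite (enormB (X a)).
have := Xe _ acb; have := mw _ acb; set x := enorm (X _ - _).
move=> hw hx.
have x0 : 0 <= x by exact: enorm_ge0.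
have k0 : 0 <= enorm (dK c) by exact: enorm_ge0.
have hf : h * f (X a) - h * f (X c.+1) <= h * (2 * L).
  rewrite -mulrBr ler_wpM2l//; first exact: ltW.
  apply: le_trans (ler_norm _) _; apply: le_trans (fL (XD _) (XD _)) _.
  rewrite enormB -/x; have : L * x <= L * 1 by rewrite ler_wpM2l//; lra.
  by lra.
have xe2 : x ^+ 2 <= e ^+ 2 by rewrite lerXn2r ?nnegrE.
have e21 : e ^+ 2 <= 1 by nra.
have hr : (rho * h + gamma * enorm (dK c)) * x ^+ 2 <=
    rho * h + gamma * enorm (dK c) * e ^+ 2.
  rewrite mulrDl lerD//.
    by rewrite ler_piMr// ?(le_trans xe2)// mulr_ge0// ltW.
  by rewrite ler_wpM2l// mulr_ge0.
have : dotv (dK c) (mm c.+1 - mm a) <= enorm (dK c) * w.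
  by apply: le_trans (dotv_le _ _) _; rewrite ler_wpM2l.
rewrite reflectionB dotvNr !(dotvC _ (dK c)) !dotvBr.
by lra.
Qed.

(** [delta] keeps the window inside the ball condition, 1/4 gives [e ^+ 2 <= e / 4], and the last
    bound amounts to [16 * (gamma + 1) * (3 * e) <= sigma], where [3 * e / sigma] bounds the
    variation. *)
Definition window_radius := Num.min delta (Num.min (1 / 4) (sigma / (48 * (gamma + 1)))).

Lemma window_radius_gt0 : 0 < window_radius.
Proof.
have g48 : 0 < 48 * (gamma + 1) :> R by rewrite mulr_gt0// ltr_wpDl.
by rewrite !lt_min delta0 (divr_gt0 sigma0 g48) andbT; lra.
Qed.

(** Self-improvement from [e] to [3 / 4 * e]. The squared displacement of [K] is at most
    [e ^+ 2 / 8] from the elapsed time plus [e ^+ 2 / 8] from the variation, so [K] moves by at most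
    [e / 2] and [X] by at most [e / 2 + e ^+ 2]. *)
Lemma window_bound a b e : (a <= b)%N -> 0 < e <= window_radius ->
  (forall i, (a < i <= b)%N -> enorm (X i - X a) <= e) ->
  (forall i, (a < i <= b)%N -> enorm (mm i - mm a) <= e ^+ 2) ->
  (3 * L + 4 * rho) * (h * (b%:R - a%:R)) <= e ->
  16 * (2 * L + rho) * (h * (b%:R - a%:R)) <= e ^+ 2 ->
  [/\ enorm (K b - K a) <= e / 2, enorm (X b - X a) <= 3 / 4 * e &
    \sum_(a <= i < b) enorm (dK i) <= 3 * e / sigma].
Proof.
move=> ab; rewrite !le_min => /and4P[e0 ed e4 es] Xe me t1 t2.
have gs : 0 < 48 * (gamma + 1) :> R by rewrite mulr_gt0// ltr_wpDl.
move: es; rewrite ler_pdivlMr// => es.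
set S := \sum_(_ <= _ < _) _.
have S0 : 0 <= S by apply: sumr_ge0 => i _; exact: enorm_ge0.
have [eab|lab] := eqVneq a b.
  rewrite /S eab !subrr enorm0 big_geq//; split; try lra.
  by rewrite divr_ge0 ?ltW//; lra.
have hb : (a < b <= b)%N by rewrite leqnn andbT ltn_neqAle lab.
have Xb := Xe b hb; have mb := me b hb.
have ee : e ^+ 2 <= e by nra.
have Kb : enorm (K b - K a) <= 2 * e.
  by rewrite reflectionB; apply: le_trans (ler_enormB _ _) _; lra.
(* [2 * e] comes from the crude bound [Kb], the third [e] from the elapsed time. *)
have hS : sigma * S <= 3 * e.
  apply: le_trans (window_variation ab _) _; last by lra.
  by move=> i iab; apply: le_trans (Xe i iab) ed.
have hS' : S <= 3 * e / sigma by rewrite ler_pdivlMr// mulrC.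
have hK := @window_displacement a b e (e ^+ 2) ab _ Xe me.
have e01 : 0 <= e <= 1 by apply/andP; split; lra.
have {hK} := hK e01; rewrite -/S => hK.
have Ke : enorm (K b - K a) <= e / 2.
  apply: enorm_le; first by lra.
  rewrite -enorm_sqr; apply: le_trans hK _.
  have -> : 2 * (gamma * e ^+ 2 + e ^+ 2) * S = 2 * (gamma + 1) * S * e ^+ 2 by ring.
  have h1 : (gamma + 1) * S * 16 <= 1.
    rewrite -(ler_pM2l sigma0).
    have -> : sigma * ((gamma + 1) * S * 16) = 16 * (gamma + 1) * (sigma * S) by ring.
    have : 16 * (gamma + 1) * (sigma * S) <= 16 * (gamma + 1) * (3 * e).
      by rewrite ler_wpM2l//; lra.
    by lra.
  have h2 : (gamma + 1) * S * 16 * e ^+ 2 <= 1 * e ^+ 2 by rewrite ler_wpM2r ?sqr_ge0.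
  by lra.
split=> //.
have -> : X b - X a = (mm b - mm a) - (K b - K a) by rewrite reflectionB subKr.
apply: le_trans (ler_enormB _ _) _.
have : e ^+ 2 <= e / 4 by nra.
lra.
Qed.

(** A discrete continuity argument: as long as [X] has stayed within [e] of its start it is in fact
    within [3 / 4 * e], and a jump of at most [e / 4] cannot carry it beyond [e]. *)
Lemma window_stay a b e : (a <= b)%N -> 0 < e <= window_radius ->
  (forall i, (a <= i < b)%N -> enorm (X i.+1 - X i) <= e / 4) ->
  (forall i, (a < i <= b)%N -> enorm (mm i - mm a) <= e ^+ 2) ->
  (3 * L + 4 * rho) * (h * (b%:R - a%:R)) <= e ->
  16 * (2 * L + rho) * (h * (b%:R - a%:R)) <= e ^+ 2 ->
  forall i, (a < i <= b)%N -> enorm (X i - X a) <= e.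
Proof.
move=> ab er jump me t1 t2; move: (rho0) (L0) => rho0' L0'.
suff H : forall c, (a <= c <= b)%N -> forall i, (a < i <= c)%N -> enorm (X i - X a) <= e.
  by apply: H; rewrite ab leqnn.
elim=> [|c ih] /andP[ac cb] i /andP[ai ic].
  by move: ai; rewrite ltnNge (leq_trans ic).
move: ic; rewrite leq_eqVlt => /orP[/eqP ei|ic]; last first.
  rewrite ltnS in ic; apply: ih; last by rewrite ai.
  by rewrite (ltnW (leq_trans ai ic)) ltnW.
rewrite {}ei in ai *; rewrite ltnS in ai.
have hc : h * (c%:R - a%:R) <= h * (b%:R - a%:R).
  by rewrite ler_wpM2l ?(ltW h0)// lerD2r ler_nat ltnW.
have hc0 : 0 <= h * (c%:R - a%:R) by rewrite mulr_ge0 ?(ltW h0)// subr_ge0 ler_nat.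
have [] := @window_bound a c e ai er _ _ _ _.
- by apply: ih; rewrite ai ltnW.
- by move=> j /andP[aj jc]; apply: me; rewrite aj (leq_trans jc)// ltnW.
- by apply: le_trans t1; rewrite ler_wpM2l//; lra.
- by apply: le_trans t2; rewrite ler_wpM2l//; lra.
move=> _ h1 _; have h2 := jump c; rewrite ai cb in h2.
apply: le_trans (ler_enorm_trans _ (X c) _) _.
by have := h2 isT; lra.
Qed.

End Window.

End Scheme.

(** * Equicontinuity and variation bounds uniform in the mesh *)

Section SchemeCompactness.
Context {R : realType} {d : nat}.
Variables (rho gamma L delta sigma : R) (D : set 'rV[R]_d) (f : 'rV[R]_d -> R).
Hypotheses (rho0 : 0 <= rho) (gamma0 : 0 <= gamma) (L0 : 0 <= L)
  (delta0 : 0 < delta) (sigma0 : 0 < sigma).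
Hypothesis fL : forall x y, D x -> D y -> `|f x - f y| <= L + L * enorm (x - y).
Hypothesis Dball : shifted_interior_ball gamma delta sigma D.
Variable m : R -> 'rV[R]_d.
Hypothesis cm : continuous_Rplus m.

Definition sampled h (i : nat) := m (i%:R * h).
Local Notation scheme h X := (is_scheme rho gamma L D f h (sampled h) X).

Lemma scheme_equicontinuous (T e : R) : 0 < e ->
  exists tau h1 : R, [/\ 0 < tau, 0 < h1 &
    forall h X, 0 < h <= h1 -> scheme h X ->
    forall a b, (a <= b)%N -> b%:R * h <= T -> h * (b%:R - a%:R) <= tau ->
    [/\ enorm (X b - X a) <= e,
       enorm (reflection (sampled h) X b - reflection (sampled h) X a) <= e &
       \sum_(a <= i < b) enorm (reflection_step (sampled h) X i) <= 3 / sigma]].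
Proof.
move=> e_gt0; move: (rho0) (gamma0) (L0) (sigma0) => r0 g0 l0 s0.
have rad0 := window_radius_gt0 gamma0 delta0 sigma0.
set rad := window_radius _ _ _ in rad0.
pose e' := Num.min e rad.
have e'0 : 0 < e' by rewrite lt_min e_gt0.
have e'e : e' <= e by rewrite ge_min lexx.
have e'r : e' <= rad by rewrite ge_min lexx orbT.
have r4 : rad <= 1 / 4 by rewrite !ge_min lexx orbT.
have [eta eta0 Heta] := continuous_Rplus_unif T cm (exprn_gt0 2 e'0).
have e20 : 0 < e' / 20 by lra.
have [eta2 eta20 Heta2] := continuous_Rplus_unif T cm e20.
have C10 : 0 < 3 * L + 4 * rho + 1 by lra.
have C20 : 0 < 16 * (2 * L + rho) + 1 by lra.
(* The three terms meet the conditions of [window_stay] on [m] and on the elapsed time, at orders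
   [e'] and [e' ^+ 2]; the added 1 avoids a division by 0. *)
pose tau := Num.min (eta / 2) (Num.min (e' / (3 * L + 4 * rho + 1))
   (e' ^+ 2 / (16 * (2 * L + rho) + 1))).
have C30 : 0 < 2 * L + 1 by lra.
pose h1 := Num.min (eta2 / 2) ((e' / 5) ^+ 2 / 16 / (2 * L + 1)).
exists tau, h1; split.
- by rewrite !lt_min !divr_gt0// exprn_gt0.
- by rewrite !lt_min !divr_gt0// exprn_gt0// divr_gt0.
move=> h X /andP[h0 hh1] sX a b ab bT hab.
move: hab; rewrite !le_min => /and3P[t1 t2 t3].
move: hh1; rewrite le_min => /andP[hh1 hh2].
rewrite ler_pdivlMr// in t2; rewrite ler_pdivlMr// in t3; rewrite ler_pdivlMr// in hh2.
have hab0 : 0 <= h * (b%:R - a%:R) by rewrite mulr_ge0 ?(ltW h0)// subr_ge0 ler_nat.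
have iT i : (i <= b)%N -> 0 <= i%:R * h <= T.
  move=> ib; rewrite mulr_ge0 ?(ltW h0)//=; apply: le_trans bT.
  by rewrite ler_wpM2r ?(ltW h0)// ler_nat.
have mw i : (a < i <= b)%N -> enorm (sampled h i - sampled h a) <= e' ^+ 2.
  move=> /andP[ai ib]; apply/ltW/Heta; [exact: iT|exact: iT|].
  rewrite -mulrBl ger0_norm; last first.
    by rewrite mulr_ge0 ?(ltW h0)// subr_ge0 ler_nat ltnW.
  have : h * (i%:R - a%:R) <= h * (b%:R - a%:R).
    by rewrite ler_wpM2l ?(ltW h0)// lerD2r ler_nat.
  by lra.
have jump i : (a <= i < b)%N -> enorm (X i.+1 - X i) <= e' / 4.
  move=> /andP[ai ib];
  have := @scheme_jump _ _ rho gamma L D f L0 h (sampled h) X h0 sX (e' / 5) i _ _ _.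
  have -> : 5 / 4 * (e' / 5) = e' / 4 by lra.
  apply.
  - by apply/andP; split; lra.
  - apply/ltW; have -> : e' / 5 / 4 = e' / 20 by lra.
    apply: Heta2; [exact/iT/ltnW|exact: iT|].
    by rewrite -mulrBl -natr1 addrAC subrr add0r mul1r gtr0_norm//; lra.
  - by lra.
have t1' : (3 * L + 4 * rho) * (h * (b%:R - a%:R)) <= e' by lra.
have t2' : 16 * (2 * L + rho) * (h * (b%:R - a%:R)) <= e' ^+ 2 by lra.
have e'rad : 0 < e' <= rad by rewrite e'0.
have stay := window_stay rho0 gamma0 L0 sigma0 fL Dball h0 sX ab e'rad jump mw t1' t2'.
have [h2 h3 h4] := window_bound rho0 gamma0 L0 sigma0 fL Dball h0 sX ab e'rad stay mw t1' t2'.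
split; [lra|lra|apply: le_trans h4 _].
by rewrite ler_pM2r ?invr_gt0//; lra.
Qed.

(** [0, T] is covered by [J] windows, each of variation at most [3 / sigma]. The windows have length
    [tau / 2] and the mesh is at most [tau / 2], so rounding an end down to the mesh keeps the
    length at most [tau]. *)
Lemma scheme_variation (T : R) : 0 <= T ->
  exists V h1 : R, [/\ 0 <= V, 0 < h1 &
    forall h X, 0 < h <= h1 -> scheme h X ->
    forall b, b%:R * h <= T ->
      \sum_(0 <= i < b) enorm (reflection_step (sampled h) X i) <= V].
Proof.
move=> T0; move: (sigma0) => s0.
have [tau [h1 [tau0 h10 H]]] := scheme_equicontinuous T ltr01.
pose h2 := Num.min h1 (tau / 2).
have [J _ HJ] : exists2 J : nat, True & T <= J%:R * (tau / 2).
  exists (Num.trunc (T / (tau / 2))).+1 => //.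
  rewrite -ler_pdivrMr ?divr_gt0//; apply/ltW.
  by rewrite truncnS_gt.
exists (J%:R * (3 / sigma)), h2; split.
- by rewrite mulr_ge0// divr_ge0// ltW.
- by rewrite lt_min h10 divr_gt0.
move=> h X /andP[h0]; rewrite le_min => /andP[hh1 htau] sX b bT.
have h01 : 0 < h <= h1 by rewrite h0.
have {}HJ : b%:R * h <= J%:R * (tau / 2) by exact: le_trans HJ.
elim: J b bT HJ => [|J ih] b bT bJ.
  have : (b%:R : R) <= 0 by rewrite -(pmulr_lle0 _ h0) (le_trans bJ)// mul0r.
  rewrite -[0]/(0%:R) ler_nat leqn0 => /eqP ->.
  by rewrite big_geq// mul0r.
have J0 : 0 <= J%:R * (tau / 2) / h by rewrite divr_ge0 ?(ltW h0)// mulr_ge0// ltW// divr_gt0.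
(* The last mesh index not beyond the end of the first [J] windows. *)
pose a0 := Num.trunc (J%:R * (tau / 2) / h).
have /andP[a1 a2] := truncn_itv J0.
rewrite -/a0 in a1 a2.
pose a := minn a0 b.
have ab : (a <= b)%N by exact: geq_minr.
have aJ : a%:R * h <= J%:R * (tau / 2).
  rewrite -ler_pdivlMr//; apply: le_trans a1.
  by rewrite ler_nat geq_minl.
have aT : a%:R * h <= T.
  by apply: le_trans bT; rewrite ler_wpM2r ?(ltW h0)// ler_nat.
have ba : h * (b%:R - a%:R) <= tau.
  rewrite ltr_pdivrMr// -[a0.+1%:R]natr1 in a2; rewrite -[J.+1%:R]natr1 in bJ.
  rewrite /a; case: leqP => ?; last by rewrite subrr mulr0 ltW.
  lra.
have [_ _ h3] := H h X h01 sX a b ab bT ba.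
rewrite (big_cat_nat (n := a))//= -[J.+1%:R]natr1 mulrDl mul1r.
by apply: lerD => //; apply: ih.
Qed.

End SchemeCompactness.

(** * From single steps to blocks of steps *)

Section Coarsening.
Context {R : realType} {d : nat}.
Variables (rho gamma L : R) (D : set 'rV[R]_d) (f : 'rV[R]_d -> R).
Hypotheses (rho0 : 0 <= rho) (gamma0 : 0 <= gamma) (L0 : 0 <= L).

(** By the first-order condition, [a - (2 * c) *: (y - p)] is [h] times a subgradient at the
    minimiser [y]. The scheme takes [a = 0] and [c = 1 / 2]; the coarse inequality takes for [a] the
    increment of [K] over a block, with a penalty proportional to [Q + tau]. *)
Definition proximal_points := forall (h c : R) (a p : 'rV[R]_d), 0 < h -> 0 < c ->
  exists y, [/\ D y,
    forall z, D z -> h * f y - dotv a (y - p) + c * enorm (y - p) ^+ 2 <=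
      h * f z - dotv a (z - p) + c * enorm (z - p) ^+ 2 &
    forall z, D z -> dotv (a - (2 * c) *: (y - p)) (z - y) + h * f y <=
      h * f z + (rho * h + gamma * enorm (a - (2 * c) *: (y - p))) * enorm (z - y) ^+ 2].

Hypothesis Dprox : proximal_points.

Variables (h : R) (mm X : nat -> 'rV[R]_d).
Hypotheses (h0 : 0 < h) (sX : is_scheme rho gamma L D f h mm X).
Local Notation K := (reflection mm X).
Local Notation dK := (reflection_step mm X).

Variables (a b : nat) (eta : R).
Hypotheses (ab : (a < b)%N) (eta01 : 0 < eta <= 1).
Hypothesis Xeta : forall i, (a < i <= b)%N -> enorm (X i - X a) <= eta ^+ 2.

Let tau := h * (b%:R - a%:R).
Let Q := \sum_(a <= i < b) enorm (dK i).
Let S := \sum_(a <= i < b) h * f (X i.+1).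
Let M := 2 * (rho + gamma) + 1.

Let tau0 : 0 < tau.
Proof. by rewrite mulr_gt0// subr_gt0 ltr_nat. Qed.

Let Q0 : 0 <= Q.
Proof. by apply: sumr_ge0 => i _; exact: enorm_ge0. Qed.

Let M1 : 1 <= M.
Proof. by rewrite /M; move: rho0 gamma0; lra. Qed.

Let KQ : enorm (K b - K a) <= Q.
Proof.
by rewrite (reflection_sum _ _ (ltnW ab)); exact: ler_enorm_sum.
Qed.

Let tauE : tau = \sum_(a <= i < b) h.
Proof. by rewrite sumr_const_nat /tau -natrB ?(ltnW ab)// mulr_natr. Qed.

(** Direct summation of the step inequalities leaves the sum [Q] of step lengths in the quadratic
    term, which would lead to the limit of the discrete variations. The inequality is therefore
    applied at a proximal point close to [X a], where that term is small. *)
Lemma coarse_rough z : D z ->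
  dotv (K b - K a) (z - X a) + S <= tau * f z +
    M * (Q + tau) * (enorm (z - X a) ^+ 2 + eta ^+ 2) + eta ^+ 2 * (Q + tau).
Proof.
move=> Dz; case: sX => _ _ Xvi.
set e := eta ^+ 2; set Z := enorm (z - X a).
have Z0 : 0 <= Z by exact: enorm_ge0.
have e0 : 0 <= e by exact: sqr_ge0.
have e1 : e <= 1 by rewrite /e; case/andP: eta01 => ? ?; nra.
apply: (@le_trans _ _ (tau * f z + 2 * (rho * tau + gamma * Q) * (Z ^+ 2 + e ^+ 2) + e * Q)).
  rewrite (reflection_sum _ _ (ltnW ab)) dotv_suml -big_split/= tauE /Q.
  rewrite [in leRHS]mulr_suml [rho * _]mulr_sumr [gamma * _]mulr_sumr -big_split/=.
  rewrite [2 * _]mulr_sumr [X in _ + X + _]mulr_suml [e * _]mulr_sumr -!big_split/=.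
  rewrite big_nat_cond [leRHS]big_nat_cond; apply: ler_sum => i; rewrite andbT => iab.
  have := Xvi i z Dz.
  have xi : enorm (X i.+1 - X a) <= e by apply: Xeta; rewrite ltnS.
  set q := enorm (dK i); set x := enorm (X i.+1 - X a) in xi.
  have q0 : 0 <= q by exact: enorm_ge0.
  have x0 : 0 <= x by exact: enorm_ge0.
  have dd : dotv (dK i) (X i.+1 - X a) <= q * e.
    by apply: le_trans (dotv_le _ _) _; rewrite ler_wpM2l.
  have -> : dotv (dK i) (z - X a) = dotv (dK i) (z - X i.+1) + dotv (dK i) (X i.+1 - X a).
    by rewrite -dotvDr addrA subrK.
  have zz : enorm (z - X i.+1) <= Z + e.
    apply: le_trans (ler_enorm_trans _ (X a) _) _.
    by rewrite lerD2l enormB.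
  have zz2 : enorm (z - X i.+1) ^+ 2 <= 2 * (Z ^+ 2 + e ^+ 2).
    apply: (@le_trans _ _ ((Z + e) ^+ 2)).
      by rewrite lerXn2r ?nnegrE ?enorm_ge0// addr_ge0.
    by have := sqr_ge0 (Z - e); lra.
  have : (rho * h + gamma * q) * enorm (z - X i.+1) ^+ 2 <=
     (rho * h + gamma * q) * (2 * (Z ^+ 2 + e ^+ 2)).
    by rewrite ler_wpM2l// addr_ge0// mulr_ge0// ltW.
  lra.
have h1 : 2 * (rho * tau + gamma * Q) <= M * (Q + tau).
  have -> : M * (Q + tau) = 2 * (rho * tau + gamma * Q) + 2 * rho * Q + 2 * gamma * tau + Q + tau.
    by rewrite /M; ring.
  have : 0 <= rho * Q by rewrite mulr_ge0.
  have : 0 <= gamma * tau by rewrite mulr_ge0// ltW.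
  have := Q0; have := tau0; lra.
have h2 : 2 * (rho * tau + gamma * Q) * (Z ^+ 2 + e ^+ 2) <= M * (Q + tau) * (Z ^+ 2 + e).
  apply: ler_pM => //.
  - by rewrite mulr_ge0// addr_ge0// mulr_ge0// ltW.
  - by rewrite addr_ge0 ?sqr_ge0.
  - by rewrite lerD2l; nra.
have : e * Q <= e * (Q + tau) by rewrite ler_wpM2l// lerDl ltW.
lra.
Qed.

(** In units of [eta * (Q + tau) * (1 + |z - X a|^2)]: replacing [y] by [X a] and the subgradient by
    the increment of [K] in the quadratic term costs [12 * (rho + gamma) + 216 * gamma * M], the
    gradient of the penalty [48 * M], and [coarse_rough] at [y] costs [10 * M + 1]. *)
Definition coarse_const := 12 * (rho + gamma) + 216 * gamma * M + 58 * M + 1.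

(* Let [y] minimise [tau f z - <kap, z - X a> + 2 M (Q + tau) |z - X a|^2].  By
   [coarse_rough], [y] is within [3 eta] of [X a]; semiconvexity at [y] then has
   [|kap|] in place of the possibly larger [Q]. *)
Lemma coarse_inequality z : D z ->
  dotv (K b - K a) (z - X a) + S <= tau * f z +
    (rho * tau + gamma * enorm (K b - K a)) * enorm (z - X a) ^+ 2
    + coarse_const * eta * (Q + tau) * (1 + enorm (z - X a) ^+ 2).
Proof.
move=> Dz; case: sX => XD _ _; case/andP: (eta01) => eta0 eta1.
have M1' := M1; have g0 := gamma0; have r0' := rho0; have t0 := tau0; have q0 := Q0.
set Lam := Q + tau; have Lam0 : 0 < Lam by rewrite /Lam; lra.
have M0 : 0 < M by lra.
have c0 : 0 < 2 * M * Lam by rewrite !mulr_gt0.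
have [y [Dy ymin ysharp]] := Dprox (K b - K a) (X a) t0 c0.
set e := eta ^+ 2.
have e0 : 0 <= e by exact: sqr_ge0.
have e1 : e <= eta by rewrite /e; nra.
set A := enorm (K b - K a).
have A0 : 0 <= A by exact: enorm_ge0.
have AL : A <= Lam by have := KQ; rewrite -/A /Lam; lra.
set r := enorm (y - X a) in ymin *; have r0 : 0 <= r by exact: enorm_ge0.
set kap := K b - K a in ymin ysharp *.
(* Minimality of [y] against each competitor [X i.+1], averaged with weights [h]; all of them lie
   within [e] of [X a]. *)
have avg : tau * f y - dotv kap (y - X a) + 2 * M * Lam * r ^+ 2 <=
    S + A * e + 2 * M * Lam * e ^+ 2.
  set V := (X in X <= _); set B := 2 * M * Lam * e ^+ 2.
  rewrite -(ler_pM2l t0).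
  have -> : tau * V = \sum_(a <= i < b) h * V by rewrite -mulr_suml -tauE.
  have -> : tau * (S + A * e + B) = \sum_(a <= i < b) h * (tau * f (X i.+1) + A * e + B).
    under eq_bigr do rewrite 2!mulrDr.
    rewrite !big_split/= -!mulr_suml -tauE 2!mulrDr; congr (_ + _ + _).
    by rewrite mulr_sumr; apply: eq_bigr => i _; rewrite mulrCA.
  rewrite big_nat_cond [leRHS]big_nat_cond; apply: ler_sum => i; rewrite andbT => iab.
  rewrite ler_wpM2l ?(ltW h0)//; apply: le_trans (ymin _ (XD i.+1)) _.
  have xi : enorm (X i.+1 - X a) <= e by apply: Xeta; rewrite ltnS.
  rewrite !lerD//.
    have : dotv kap (X a - X i.+1) <= A * e.
      by apply: le_trans (dotv_le _ _) _; rewrite enormB ler_wpM2l.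
    by rewrite -[X a - _]opprB dotvNr.
  rewrite ler_wpM2l ?(ltW c0)// lerXn2r ?nnegrE ?enorm_ge0//.
have ry := coarse_rough Dy; rewrite -/r -/kap -/Lam -/e in ry.
(* [coarse_rough] at [y] allows [M * Lam * r ^+ 2] while the penalty contributes twice as much; the
   surplus bounds [r] by the order of the square root of [e], which is why the oscillation is
   assumed to be [eta ^+ 2]. *)
have r2 : r ^+ 2 <= 9 * eta ^+ 2.
  have h1 : Lam * (M * r ^+ 2) <= Lam * (2 * e + 3 * M * e).
    have : A * e <= Lam * e by rewrite ler_wpM2r.
    have : M * Lam * e ^+ 2 <= M * Lam * e.
      by rewrite ler_wpM2l ?mulr_ge0 ?(ltW M0) ?(ltW Lam0)//; nra.
    lra.
  rewrite (ler_pM2l Lam0) in h1.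
  have h2 : M * r ^+ 2 <= M * (9 * e).
    have : e <= M * e by rewrite ler_peMl.
    lra.
  by rewrite (ler_pM2l M0) in h2.
have r3 : r <= 3 * eta.
  by rewrite -(ler_pXn2r (n := 2)) ?nnegrE//; lra.
set Z := enorm (z - X a); have Z0 : 0 <= Z by exact: enorm_ge0.
set a' := kap - _ *: (y - X a) in ysharp.
have a'A : enorm a' <= A + 4 * M * Lam * r.
  apply: le_trans (ler_enormB _ _) _; rewrite enormZ gtr0_norm; last by rewrite mulr_gt0.
  by rewrite -/A -/r lerD2l; lra.
have zy : enorm (z - y) <= Z + r.
  apply: le_trans (ler_enorm_trans _ (X a) _) _.
  by rewrite lerD2l enormB.
have zy2 : enorm (z - y) ^+ 2 <= (Z + r) ^+ 2.
  by rewrite lerXn2r ?nnegrE ?enorm_ge0// addr_ge0.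
have sharp := ysharp z Dz.
have a'z : dotv a' (z - y) = dotv kap (z - X a) - dotv kap (y - X a)
    - 2 * (2 * M * Lam) * dotv (y - X a) (z - y).
  have -> : z - X a = (z - y) + (y - X a) by rewrite addrA subrK.
  rewrite /a' [dotv (kap - _) _]dotvBl [dotv (_ *: _) _]dotvZl.
  by rewrite [dotv kap (_ + (y - X a))]dotvDr; ring.
have yz : dotv (y - X a) (z - y) <= r * (Z + r).
  by apply: le_trans (dotv_le _ _) _; rewrite ler_wpM2l.
set P := eta * Lam * (1 + Z ^+ 2).
have ML0 : 0 <= M * Lam by rewrite mulr_ge0 ?(ltW M0) ?(ltW Lam0).
have yz' : 2 * (2 * M * Lam) * dotv (y - X a) (z - y) <= 48 * M * P.
  have h1 : r * (Z + r) <= 12 * (eta * (1 + Z ^+ 2)).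
    apply: (@le_trans _ _ (3 * eta * (Z + 3))); first by apply: ler_pM => //; lra.
    have : 0 <= eta * (2 * Z ^+ 2 - 2 * Z + 1) by rewrite mulr_ge0 ?(ltW eta0)//; nra.
    have : 0 <= eta * Z ^+ 2 by rewrite mulr_ge0 ?(ltW eta0)// sqr_ge0.
    have : 0 <= eta * Z by rewrite mulr_ge0 ?(ltW eta0).
    lra.
  have : M * Lam * dotv (y - X a) (z - y) <= M * Lam * (12 * (eta * (1 + Z ^+ 2))).
    by rewrite ler_wpM2l// (le_trans yz).
  by rewrite /P; lra.
have quad : (rho * tau + gamma * enorm a') * enorm (z - y) ^+ 2 <=
    (rho * tau + gamma * A) * Z ^+ 2 + 12 * (rho + gamma) * P + 216 * gamma * M * P.
  have h1 : rho * tau + gamma * enorm a' <= rho * tau + gamma * A + 4 * gamma * M * Lam * r.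
    by have := ler_wpM2l g0 a'A; lra.
  apply: (@le_trans _ _ ((rho * tau + gamma * A + 4 * gamma * M * Lam * r) * (Z + r) ^+ 2)).
    apply: ler_pM => //; last exact: sqr_ge0.
    by rewrite addr_ge0// mulr_ge0// ?(ltW t0)// enorm_ge0.
  have h2 : (Z + r) ^+ 2 <= Z ^+ 2 + 12 * (eta * (1 + Z ^+ 2)).
    have : r * Z <= 3 * eta * Z by rewrite ler_wpM2r.
    have : 0 <= eta * (Z - 1) ^+ 2 by rewrite mulr_ge0 ?(ltW eta0)// sqr_ge0.
    have : 0 <= eta * Z ^+ 2 by rewrite mulr_ge0 ?(ltW eta0)// sqr_ge0.
    have : eta ^+ 2 <= eta by [].
    lra.
  have h3 : r * (Z + r) ^+ 2 <= 54 * (eta * (1 + Z ^+ 2)).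
    apply: (@le_trans _ _ (3 * eta * (2 * Z ^+ 2 + 18))).
      apply: ler_pM => //; first exact: sqr_ge0.
      by have := sqr_ge0 (Z - r); nra.
    have : 0 <= eta * Z ^+ 2 by rewrite mulr_ge0 ?(ltW eta0)// sqr_ge0.
    lra.
  have rt0 : 0 <= rho * tau + gamma * A by rewrite addr_ge0// mulr_ge0// ltW.
  have gM0 : 0 <= gamma * (M * Lam) by rewrite mulr_ge0.
  have h4 := ler_wpM2l rt0 h2.
  have h5 := ler_wpM2l gM0 h3.
  have h6 : rho * tau + gamma * A <= (rho + gamma) * Lam.
    have : rho * tau <= rho * Lam by rewrite ler_wpM2l// /Lam; lra.
    have : gamma * A <= gamma * Lam by rewrite ler_wpM2l.
    lra.
  have e2 : 0 <= 12 * (eta * (1 + Z ^+ 2)).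
    by rewrite mulr_ge0// mulr_ge0 ?(ltW eta0)// addr_ge0// sqr_ge0.
  have h7 := ler_wpM2r e2 h6.
  by rewrite /P; lra.
have rough' : M * Lam * (r ^+ 2 + e) + e * Lam <= (10 * M + 1) * P.
  have h1 : r ^+ 2 + e <= 10 * eta by rewrite /e in e1 *; lra.
  have h2 := ler_wpM2l ML0 h1.
  have h3 : e * Lam <= eta * Lam by rewrite ler_wpM2r ?(ltW Lam0).
  have h4 : eta * Lam <= P by rewrite /P ler_peMr ?mulr_ge0 ?(ltW eta0) ?(ltW Lam0)// lerDl sqr_ge0.
  have h5 : M * (eta * Lam) <= M * P by rewrite ler_wpM2l// ltW.
  lra.
have -> : coarse_const * eta * Lam * (1 + Z ^+ 2) =
  12 * (rho + gamma) * P + 216 * gamma * M * P + 48 * M * P + (10 * M + 1) * P.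
  by rewrite /coarse_const /P; ring.
lra.
Qed.

End Coarsening.

(** * The domain of phi, its proximal points, and existence of the scheme *)

Section Proximal.
Context {R : realType} {d : nat}.
Variables (rho gamma L : R) (phi : 'rV[R]_d -> \bar R).
Hypotheses (rho0 : 0 <= rho) (gamma0 : 0 <= gamma) (L0 : 0 <= L).
Hypothesis phi_gtNy : forall v, (-oo < phi v)%E.
Hypothesis Dom_neq0 : Dom phi !=set0.
Hypothesis phi_lsc : lower_semicontinuous phi.
Hypothesis phi_sc : forall x xh, frechet_subdiff phi x xh -> forall y,
  ((dotv xh (y - x))%:E + phi x <=
   phi y + ((rho + gamma * enorm xh) * enorm (y - x) ^+ 2)%:E)%E.
Hypothesis phi_L : forall x y, Dom phi x -> Dom phi y ->
  (`|phi x - phi y| <= (L + L * enorm (x - y))%:E)%E.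

Local Notation D := (Dom phi).
Local Notation f := (fun v => fine (phi v)).

Lemma Dom_fineK v : D v -> phi v = (f v)%:E.
Proof. by move=> Dv; rewrite fineK// fin_real// phi_gtNy. Qed.

Lemma phi_notin_Dom v : ~ D v -> phi v = +oo%E.
Proof. by move=> /negP; rewrite /Dom /= -leNgt leye_eq => /eqP. Qed.

Lemma fine_phi_L x y : D x -> D y -> `|f x - f y| <= L + L * enorm (x - y).
Proof.
move=> Dx Dy; have := phi_L Dx Dy.
by rewrite (Dom_fineK Dx) (Dom_fineK Dy) /= lee_fin.
Qed.

Lemma fine_phi_lsc x e : D x -> 0 < e -> exists2 eta, 0 < eta &
  forall y, D y -> enorm (y - x) < eta -> f x - e < f y.
Proof.
move=> Dx e0; have [|V xV HV] := phi_lsc (x := x) (a := f x - e).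
  by rewrite [X in (_ < X)%E](Dom_fineK Dx) lte_fin; lra.
have /nbhs_enormP[eta eta0 etaV] := xV.
exists eta => // y Dy yx; have := HV y (etaV y yx).
by rewrite [X in (_ < X)%E](Dom_fineK Dy) lte_fin.
Qed.

(** At a limit point outside the domain, where [phi] is [+oo], lower semicontinuity would make [phi]
    exceed any constant at nearby points of the domain, but the bound with [L] keeps it below [C]
    there. *)
Lemma Dom_closure x : closure D x -> D x.
Proof.
move=> Dx; apply: contrapT => nDx; have [y0 Dy0] := Dom_neq0.
pose C := f y0 + L + L * (enorm (x - y0) + 1).
have [|V xV HV] := phi_lsc (x := x) (a := C).
  by rewrite (phi_notin_Dom nDx) ltry.
have /nbhs_enormP[eta eta0 etaV] := xV.
have [y Dy] := closure_enormP Dx (e := Num.min eta 1) ltac:(by rewrite lt_min eta0 /=).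
rewrite lt_min => /andP[/etaV/HV + y1].
rewrite (Dom_fineK Dy) lte_fin ltNge => /negP; apply.
have := ler_normlP _ _ (fine_phi_L Dy Dy0) => -[_ h1].
have : L * enorm (y - y0) <= L * (enorm (x - y0) + 1).
  rewrite ler_wpM2l//; apply: le_trans (ler_enorm_trans _ x _) _; lra.
by rewrite /C; lra.
Qed.

Lemma Dom_closed : closed D.
Proof. by move=> x; exact: Dom_closure. Qed.

(** The difference quotient is at least [- C |z - y|] on the domain and [+oo] off it. *)
Lemma frechet_subdiff_quad (y xh : 'rV[R]_d) (C : R) : D y -> 0 <= C ->
  (forall z, D z -> f y + dotv xh (z - y) - C * enorm (z - y) ^+ 2 <= f z) ->
  frechet_subdiff phi y xh.
Proof.
move=> Dy C0 H; split=> //; rewrite limf_einfE.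
apply/lee_addgt0Pr => e e0; rewrite -leeBlDr//.
apply: le_trans (ereal_sup_ubound _); last first.
  exists [set z | z != y /\ enorm (z - y) < e / (C + 1)] => //.
  have /nbhs_enormP : exists2 eta : R, 0 < eta & forall z, enorm (z - y) < eta ->
      enorm (z - y) < e / (C + 1).
    by exists (e / (C + 1)) => //; rewrite divr_gt0//; lra.
  by apply: filterS => z /= h1 h2; split.
apply: le_ereal_inf_tmp => _ [z [zy ze] <-].
have nz : 0 < enorm (z - y).
  rewrite lt_neqAle enorm_ge0 andbT; apply: contra zy => /eqP/esym/enorm_eq0.
  by move/eqP; rewrite subr_eq0.
have [Dz|nDz] := pselect (D z); last first.
  rewrite (phi_notin_Dom nDz) (Dom_fineK Dy) /= gt0_mulye ?leey//.
  by rewrite lte_fin invr_gt0.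
rewrite (Dom_fineK Dz) (Dom_fineK Dy) -!EFinB -EFinM lee_fin sub0r.
rewrite ler_pdivlMr//.
have := H z Dz; move: ze; rewrite ltr_pdivlMr; last by lra.
move=> ze hz.
have : C * enorm (z - y) ^+ 2 <= e * enorm (z - y).
  rewrite expr2 mulrA ler_wpM2r ?(ltW nz)//; lra.
lra.
Qed.

(** [h f] decreases at most linearly and the penalty is quadratic, so the sublevel set of [F] at
    [y0] lies in a ball, and lower semicontinuity gives a minimum on the compact part of the closed
    domain in that ball. Expanding the penalty around the minimiser shows that [h^-1 *: a'] is a
    subgradient. *)
Lemma Dom_proximal_points : proximal_points rho gamma D f.
Proof.
move=> h c a p h0 c0.
pose G z := - dotv a (z - p) + c * enorm (z - p) ^+ 2.
pose F z := h * f z + G z.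
have [y0 Dy0] := Dom_neq0.
pose b := enorm a + h * L.
pose M1 := F y0 - h * f y0 + h * L + h * L * enorm (y0 - p).
(* For [s > B] both [s > 1] and [c * s - b > |M1|] hold, so [(c * s - b) * s] exceeds [|M1|]. *)
pose B := Num.max 1 ((b + `|M1|) / c).
have bnd z : D z -> F z <= F y0 -> enorm (z - p) <= B.
  move=> Dz Fz; rewrite leNgt; apply/negP; rewrite /B gt_max => /andP[s1].
  set s := enorm (z - p) in s1 *; rewrite ltr_pdivrMr// => s2.
  have h1 : h * f y0 - h * L - h * L * enorm (y0 - p) - h * L * s <= h * f z.
    have := ler_normlP _ _ (fine_phi_L Dy0 Dz) => -[_ h1].
    have h2 : L * enorm (y0 - z) <= L * (enorm (y0 - p) + s).
      by rewrite ler_wpM2l// /s (enormB z); exact: ler_enorm_trans.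
    have := ler_wpM2l (ltW h0) h1; have := ler_wpM2l (ltW h0) h2; lra.
  have h2 : dotv a (z - p) <= enorm a * s by exact: dotv_le.
  have h3 : c * s ^+ 2 - b * s <= M1 by move: Fz; rewrite /M1 /F /G /b -/s; lra.
  have h4 : `|M1| < (c * s - b) * s.
    have h5 : `|M1| < c * s - b by lra.
    apply: lt_le_trans h5 _; rewrite ler_peMr ?ltW//.
    by have := normr_ge0 M1; lra.
  by have := ler_norm M1; lra.
pose K := D `&` [set z | enorm (z - p) <= B].
have Kcpt : compact K.
  apply: bounded_closed_compact.
    exists (B + enorm p); split; first exact: num_real.
    move=> r Br z [_ /= zB]; apply: le_trans (norm_le_enorm _) _.
    by have := ler_enorm_trans z p 0; rewrite !subr0; lra.
  move=> z zK; split.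
    by apply: Dom_closed => V /zK[w [[Dw _] Vw]]; exists w.
  apply/ler_addgt0Pr => e e0.
  have [w [_ /= wB] wz] := closure_enormP zK e0.
  by have := ler_enorm_trans z w p; rewrite (enormB z w); lra.
have Flsc z e : D z -> 0 < e -> exists2 eta, 0 < eta &
    forall w, D w -> enorm (w - z) < eta -> F z - e < F w.
  move=> Dz e0.
  have h2 : 0 < 2 * h by lra.
  have [eta1 eta10 H1] := fine_phi_lsc Dz (divr_gt0 e0 h2).
  pose T := enorm a + 2 * c * enorm (z - p) + 1.
  have T0 : 0 < T.
    by rewrite /T ltr_wpDl// addr_ge0 ?enorm_ge0// mulr_ge0 ?enorm_ge0//; lra.
  exists (Num.min eta1 (e / 2 / T)); first by rewrite lt_min eta10 !divr_gt0.
  move=> w Dw; rewrite lt_min => /andP[w1]; rewrite ltr_pdivlMr// => w2.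
  have := H1 w Dw w1; rewrite ltrBlDr => w3.
  have {}w3 : h * f z < h * f w + e / 2.
    by move: w3; rewrite -(ltr_pM2l h0) mulrDr; congr (_ < _ + _); field; lra.
  have -> : F w = h * f w + G w by [].
  have -> : G w = G z - dotv a (w - z) + c * (2 * dotv (z - p) (w - z) + enorm (w - z) ^+ 2).
    have E : w - p = (z - p) + (w - z) by apply/rowP => j; rewrite !mxE; ring.
    by rewrite /G E dotvDr enormD_sqr; ring.
  have := dotv_le a (w - z); have := dotv_norm (z - p) (w - z).
  rewrite ler_norml => /andP[h3 _].
  have := ler_wpM2l (ltW c0) h3.
  have : 0 <= c * enorm (w - z) ^+ 2 by rewrite mulr_ge0 ?(ltW c0)// sqr_ge0.
  have := enorm_ge0 (w - z).
  by rewrite /F; move: w2; rewrite /T; lra.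
have y0K : K y0 by split=> //; exact: bnd.
have [y Ky Fy] : exists2 y, K y & forall z, K z -> F y <= F z.
  apply: contrapT => nomin.
  have lt z : K z -> exists2 w, K w & F w < F z.
    move=> Kz; apply: contrapT => nw; apply: nomin; exists z => // w Kw.
    by rewrite leNgt; apply/negP => wz; apply: nw; exists w.
  (* Without a minimum, each [z] has a [w] with [F w] strictly below [F] near [z]. Near-covering
     along the filter of sublevel sets then yields one [w] in [K] strictly below all of [K], itself
     included. *)
  move: (Kcpt); rewrite compact_near_coveringP.
  pose fil := filter_from [set w | K w] (fun w => [set w' | K w' /\ F w' <= F w]).
  have ff : Filter fil.
    apply: filter_from_filter; first by exists y0.
    move=> w w' Kw Kw'; case: (leP (F w) (F w')) => ww'.
      by exists w => // v [Kv vw]; split=> //; split=> //; exact: le_trans ww'.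
    by exists w' => // v [Kv vw]; split=> //; split=> //; apply: le_trans (ltW ww').
  move=> /(_ _ fil (fun w z => K z -> F w < F z) ff); case.
    move=> z Kz; have [w Kw wz] := lt z Kz.
    have e0 : 0 < F z - F w by lra.
    have [eta eta0 H] := Flsc z _ Kz.1 e0.
    exists ([set v | enorm (v - z) < eta], [set w' | K w' /\ F w' <= F w]).
      split=> /=; first by apply/nbhs_enormP; exists eta.
      by exists w.
    move=> [v w'] /= [vz [Kw' w'w]] Kv.
    by have := H v Kv.1 vz; lra.
  move=> w Kw H; have := H w (conj Kw (lexx _)) w Kw Kw.
  by rewrite ltxx.
have Fmin z : D z -> F y <= F z.
  move=> Dz; have [Bz|zB] := leP (enorm (z - p)) B; first exact: Fy.
  apply: le_trans (Fy y0 y0K) _; rewrite leNgt; apply/negP => /ltW/(bnd z Dz).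
  by rewrite leNgt zB.
have Dy := Ky.1.
exists y; split=> //; first by move=> z Dz; have := Fmin z Dz; rewrite /F /G; lra.
set a' := a - _.
have quad z : D z -> dotv a' (z - y) + h * f y <= h * f z + c * enorm (z - y) ^+ 2.
  move=> Dz; have := Fmin z Dz; rewrite /F /G /a'.
  have E1 : z - p = (y - p) + (z - y) by apply/rowP => j; rewrite !mxE; ring.
  rewrite E1 enormD_sqr [dotv a (_ + (z - y))]dotvDr [dotv (a - _) _]dotvBl
    [dotv (_ *: _) _]dotvZl; lra.
have sub : frechet_subdiff phi y (h^-1 *: a').
  apply: (@frechet_subdiff_quad _ _ (c / h)) => //; first by rewrite divr_ge0 ?ltW.
  move=> z Dz; rewrite -(ler_pM2l h0) dotvZl.
  have -> : h * (f y + h^-1 * dotv a' (z - y) - c / h * enorm (z - y) ^+ 2) =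
    h * f y + dotv a' (z - y) - c * enorm (z - y) ^+ 2 by field; rewrite gt_eqF.
  by have := quad z Dz; lra.
move=> z Dz; have := phi_sc sub z.
rewrite (Dom_fineK Dz) (Dom_fineK Dy) -!EFinD lee_fin -(ler_pM2l h0) dotvZl.
rewrite enormZ gtr0_norm ?invr_gt0//.
have -> : h * (h^-1 * dotv a' (z - y) + f y) = dotv a' (z - y) + h * f y.
  by field; rewrite gt_eqF.
suff -> : h * (f z + (rho + gamma * (h^-1 * enorm a')) * enorm (z - y) ^+ 2) =
  h * f z + (rho * h + gamma * enorm a') * enorm (z - y) ^+ 2 by [].
by field; rewrite gt_eqF.
Qed.

Lemma scheme_exists (h : R) (mm : nat -> 'rV[R]_d) (x0 : 'rV[R]_d) : 0 < h -> D x0 ->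
  exists X, X 0%N = x0 /\ is_scheme rho gamma L D f h mm X.
Proof.
move=> h0 Dx0; have h2 : 0 < 1 / 2 :> R by lra.
have /choice[prox Hp] : forall p, _ := fun p => Dom_proximal_points 0 p h0 h2.
pose X := nat_rect (fun=> 'rV[R]_d) x0 (fun i x => prox (x + (mm i.+1 - mm i))).
exists X; split=> //.
have XS i : X i.+1 = prox (X i + (mm i.+1 - mm i)) by [].
have XD i : D (X i).
  by case: i => // i; rewrite XS; have [] := Hp (X i + (mm i.+1 - mm i)).
have dKE i : reflection_step mm X i = 0 - (2 * (1 / 2)) *: (X i.+1 - (X i + (mm i.+1 - mm i))).
  have -> : 2 * (1 / 2) = 1 :> R by lra.
  by rewrite /reflection_step /reflection; apply/rowP => j; rewrite !mxE; ring.
split=> // i.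
  have [_ pmin _] := Hp (X i + (mm i.+1 - mm i)).
  (* The competitor [X i] is at distance [|mm i.+1 - mm i|] from the centre of the penalty, the
     minimiser at distance [|dK i|]. *)
  have := pmin (X i) (XD i); rewrite -XS !dotv0l !subr0.
  have -> : enorm (X i - (X i + (mm i.+1 - mm i))) = enorm (mm i.+1 - mm i).
    by rewrite opprD addrA subrr add0r enormN.
  have -> : enorm (X i.+1 - (X i + (mm i.+1 - mm i))) = enorm (reflection_step mm X i).
    by rewrite dKE sub0r enormN enormZ [2 * _]mulrCA mulfV// mulr1 normr1 mul1r.
  have := ler_normlP _ _ (fine_phi_L (XD i) (XD i.+1)) => -[_ h1].
  have := ler_wpM2l (ltW h0) h1; rewrite (enormB (X i)); lra.
move=> z Dz; have [_ _ /(_ z Dz)] := Hp (X i + (mm i.+1 - mm i)).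
by rewrite -XS -dKE.
Qed.

End Proximal.

(** * The limit of the scheme *)

Section CellIndex.
Context {R : realType}.
Implicit Types (h r s t : R).

Definition cell h t : nat := Num.trunc (t / h).

Lemma cellP h t : 0 < h -> 0 <= t -> (cell h t)%:R * h <= t < (cell h t).+1%:R * h.
Proof.
move=> h0 t0; have /truncn_itv/andP[a b] : 0 <= t / h by rewrite divr_ge0// ltW.
by rewrite -ler_pdivlMr// -ltr_pdivrMr// a.
Qed.

Lemma cell_le h s t : 0 < h -> 0 <= s -> s <= t -> (cell h s <= cell h t)%N.
Proof.
move=> h0 s0 st; have /andP[a _] := cellP h0 s0.
have /andP[_ b] := cellP h0 (le_trans s0 st).
rewrite -ltnS -(ltr_nat R) -(ltr_pM2r h0).
exact: le_lt_trans (le_trans a st) b.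
Qed.

Lemma cell_max h t i : 0 < h -> i%:R * h <= t -> (i <= cell h t)%N.
Proof.
move=> h0 it; have t0 : 0 <= t by rewrite (le_trans _ it)// mulr_ge0// ltW.
have /andP[_ b] := cellP h0 t0.
by rewrite -ltnS -(ltr_nat R) -(ltr_pM2r h0) (le_lt_trans it).
Qed.

Lemma cell0 h : cell h 0 = 0%N.
Proof. by rewrite /cell mul0r truncn0. Qed.

End CellIndex.

Section Limit.
Context {R : realType} {d : nat}.
Variables (rho gamma L delta sigma : R) (D : set 'rV[R]_d) (f : 'rV[R]_d -> R).
Hypotheses (rho0 : 0 <= rho) (gamma0 : 0 <= gamma) (L0 : 0 <= L)
  (delta0 : 0 < delta) (sigma0 : 0 < sigma).
Hypothesis fL : forall x y, D x -> D y -> `|f x - f y| <= L + L * enorm (x - y).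
Hypothesis Dball : shifted_interior_ball gamma delta sigma D.
Hypothesis Dcl : closed D.
Variables (m : R -> 'rV[R]_d) (x0 : 'rV[R]_d).
Hypotheses (cm : continuous_Rplus m) (m0 : m 0 = 0).

Definition mesh n : R := n.+1%:R^-1.

Variable X : nat -> nat -> 'rV[R]_d.
Hypothesis X0 : forall n, X n 0%N = x0.
Hypothesis sX : forall n, is_scheme rho gamma L D f (mesh n) (sampled m (mesh n)) (X n).

Variable U : set_system nat.
Hypotheses (UU : UltraFilter U) (Utail : forall N, U [set n | (N <= n)%N]).

Local Notation K n := (reflection (sampled m (mesh n)) (X n)).
Local Notation dK n := (reflection_step (sampled m (mesh n)) (X n)).

Definition dvar n t := \sum_(0 <= i < cell (mesh n) t) enorm (dK n i).

Lemma mesh_gt0 n : 0 < mesh n.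
Proof. by rewrite invr_gt0. Qed.

Lemma mesh_small (e : R) : 0 < e -> U [set n | mesh n < e].
Proof.
move=> e0; have [N _ HN] := near_infty_natSinv_lt (PosNum e0).
by apply: filterS (Utail N) => n /= Nn; exact: HN.
Qed.

Lemma reflection0 n : K n 0%N = 0.
Proof. by rewrite /reflection /sampled mul0r m0 addr0 subrr. Qed.

Lemma dvar_bound (t : R) : 0 <= t -> exists V, U [set n | dvar n t <= V].
Proof.
move=> t0.
have [V [h1 [_ h10 H]]] := scheme_variation rho0 gamma0 L0 delta0 sigma0 fL Dball cm t0.
exists V; apply: filterS (mesh_small h10) => n /= nh.
apply: (H (mesh n) (X n)) => //; first by rewrite mesh_gt0 ltW.
by case/andP: (cellP (mesh_gt0 n) t0).
Qed.

Lemma dvar_ge0 n t : 0 <= dvar n t.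
Proof. by apply: sumr_ge0 => i _; exact: enorm_ge0. Qed.

Lemma dvarB n (s t : R) : 0 <= s -> s <= t -> dvar n t - dvar n s =
  \sum_(cell (mesh n) s <= i < cell (mesh n) t) enorm (dK n i).
Proof.
move=> s0 st; have c := cell_le (mesh_gt0 n) s0 st.
by rewrite /dvar (big_cat_nat (n := cell (mesh n) s) (p := cell (mesh n) t))//= addrAC subrr add0r.
Qed.

Lemma reflection_le_dvar n (s t : R) : 0 <= s -> s <= t ->
  enorm (K n (cell (mesh n) t) - K n (cell (mesh n) s)) <= dvar n t - dvar n s.
Proof.
move=> s0 st; rewrite dvarB// (reflection_sum _ _ (cell_le (mesh_gt0 n) s0 st)).
exact: ler_enorm_sum.
Qed.

(** One ultrafilter serves every [t] simultaneously, so pointwise boundedness suffices; there is no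
    diagonal choice over a dense set of times. *)
Lemma limit_processes : exists (k : R -> 'rV[R]_d) (V : R -> R),
  (forall t e : R, 0 <= t -> 0 < e -> U [set n | enorm (K n (cell (mesh n) t) - k t) < e]) /\
  (forall t e : R, 0 <= t -> 0 < e -> U [set n | `|dvar n t - V t| < e]).
Proof.
have /choice[V HV] : forall t, exists l : _, 0 <= t ->
    forall e, 0 < e -> U [set n | `|dvar n t - l| < e].
  move=> t; have [t0|t0] := boolP (0 <= t); last by exists 0.
  have [V HV] := dvar_bound t0.
  have [|l Hl] := @ultra_real_cvg R U (dvar ^~ t) V UU; last by exists l.
  by apply: filterS HV => n /=; rewrite ger0_norm// dvar_ge0.
have /choice[k Hk] : forall t, exists l : _, 0 <= t ->
    forall e, 0 < e -> U [set n | enorm (K n (cell (mesh n) t) - l) < e].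
  move=> t; have [t0|t0] := boolP (0 <= t); last by exists 0.
  have [B HB] := dvar_bound t0.
  have [|l Hl] := @ultra_enorm_cvg R d U (fun n => K n (cell (mesh n) t)) B UU; last by exists l.
  apply: filterS HB => n /=; apply: le_trans.
  have := reflection_le_dvar n (lexx 0) t0.
  by rewrite cell0 reflection0 subr0 [dvar n 0]big_geq ?cell0// subr0.
by exists k, V; split=> t e t0; [exact: Hk|exact: HV].
Qed.

Variables (k : R -> 'rV[R]_d) (V : R -> R).
Hypothesis Kk : forall t e : R, 0 <= t -> 0 < e ->
  U [set n | enorm (K n (cell (mesh n) t) - k t) < e].
Hypothesis dvarV : forall t e : R, 0 <= t -> 0 < e -> U [set n | `|dvar n t - V t| < e].

Lemma limit_reflection0 : k 0 = 0.
Proof.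
apply: enorm_eq0; apply/eqP; rewrite eq_le enorm_ge0 andbT.
apply/ler_addgt0Pr => e e0; rewrite add0r.
have [n [/= H _ _]] := ultra_ex3 UU (Kk (lexx 0) e0) (Utail 0) (Utail 0).
by move: H; rewrite cell0 reflection0 sub0r enormN => /ltW.
Qed.

Lemma limit_reflection_le (s t : R) : 0 <= s -> s <= t -> enorm (k t - k s) <= V t - V s.
Proof.
move=> s0 st; have t0 := le_trans s0 st; apply/ler_addgt0Pr => e e0.
have e4 : 0 < e / 4 by lra.
have [n [/= [h1 h2] h3 h4]] := ultra_ex3 UU (filterI (Kk s0 e4) (Kk t0 e4))
  (dvarV s0 e4) (dvarV t0 e4).
move: h3 h4; rewrite !ltr_norml => /andP[h3 h3'] /andP[h4 h4'].
have := reflection_le_dvar n s0 st.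
have := ler_enorm_trans (k t) (K n (cell (mesh n) t)) (k s).
have := ler_enorm_trans (K n (cell (mesh n) t)) (K n (cell (mesh n) s)) (k s).
rewrite [enorm (k t - K n _)]enormB; lra.
Qed.

Lemma mesh_gap n (s t : R) : 0 <= s -> s <= t ->
  mesh n * ((cell (mesh n) t)%:R - (cell (mesh n) s)%:R) <= t - s + mesh n.
Proof.
move=> s0 st; have /andP[_] := cellP (mesh_gt0 n) s0.
have /andP[+ _] := cellP (mesh_gt0 n) (le_trans s0 st).
by rewrite -natr1; lra.
Qed.

Lemma limit_reflection_equicontinuous (T e : R) : 0 < e -> exists2 tau : R, 0 < tau &
  forall s t : R, 0 <= s -> s <= t -> t <= T -> t - s <= tau -> enorm (k t - k s) <= e.
Proof.
move=> e0; have [tau [h1 [tau0 h10 H]]] :=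
  scheme_equicontinuous rho0 gamma0 L0 delta0 sigma0 fL Dball cm T e0.
exists (tau / 2) => [|s t s0 st tT ts]; first by lra.
have t0 := le_trans s0 st; apply/ler_addgt0Pr => e' e'0.
have e4 : 0 < e' / 4 by lra.
have th : 0 < Num.min h1 (tau / 2) by rewrite lt_min h10 divr_gt0.
have [n [/= h2 h3]] := ultra_ex3 UU (Kk s0 e4) (Kk t0 e4) (mesh_small th).
rewrite lt_min => /andP[n1 n2].
have [||||_ h5 _] := H (mesh n) (X n) _ (sX n) (cell (mesh n) s) (cell (mesh n) t).
- by rewrite mesh_gt0 ltW.
- by apply: cell_le => //; exact: mesh_gt0.
- by apply: le_trans tT; case/andP: (cellP (mesh_gt0 n) t0).
- by apply: le_trans (mesh_gap n s0 st) _; lra.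
have := ler_enorm_trans (k t) (K n (cell (mesh n) t)) (k s).
have := ler_enorm_trans (K n (cell (mesh n) t)) (K n (cell (mesh n) s)) (k s).
rewrite [enorm (k t - K n _)]enormB; lra.
Qed.

Lemma limit_reflection_continuous : continuous_Rplus k.
Proof.
apply/continuous_RplusP => t t0 e e0.
have e2 : 0 < e / 2 by lra.
have [tau tau0 H] := limit_reflection_equicontinuous (t + 1) e2.
exists (Num.min tau 1); first by rewrite lt_min tau0 /=.
move=> r r0; rewrite lt_min => /andP[rt r1].
have [tr|rt'] := leP t r.
  rewrite ger0_norm ?subr_ge0// in rt r1.
  by have := H t r t0 tr; lra.
rewrite ltr0_norm ?subr_lt0// in rt r1.
by rewrite enormB; have := H r t r0 (ltW rt'); lra.
Qed.

Definition xlim t := x0 + m t - k t.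

Lemma xlim_continuous : continuous_Rplus xlim.
Proof.
apply/continuous_RplusP => t t0 e e0; have e2 : 0 < e / 2 by lra.
move/continuous_RplusP: (cm) => cm'.
move/continuous_RplusP: limit_reflection_continuous => ck.
have [eta1 eta10 H1] := cm' t t0 _ e2.
have [eta2 eta20 H2] := ck t t0 _ e2.
exists (Num.min eta1 eta2); first by rewrite lt_min eta10.
move=> r r0; rewrite lt_min => /andP[r1 r2].
have -> : xlim r - xlim t = (m r - m t) - (k r - k t).
  by rewrite /xlim; apply/rowP => j; rewrite !mxE; ring.
apply: le_lt_trans (ler_enormB _ _) _.
by have := H1 r r0 r1; have := H2 r r0 r2; lra.
Qed.

Lemma scheme_cvg (t e : R) : 0 <= t -> 0 < e ->
  U [set n | enorm (X n (cell (mesh n) t) - xlim t) < e].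
Proof.
move=> t0 e0; have e2 : 0 < e / 2 by lra.
have [eta eta0 H] := continuous_Rplus_unif t cm e2.
apply: filterS (filterI (Kk t0 e2) (mesh_small eta0)) => n /= [h1 h2].
have /andP[c1 c2] := cellP (mesh_gt0 n) t0.
have -> : X n (cell (mesh n) t) - xlim t =
    (m ((cell (mesh n) t)%:R * mesh n) - m t) - (K n (cell (mesh n) t) - k t).
  by rewrite /reflection X0 /xlim /sampled; apply/rowP => j; rewrite !mxE; ring.
apply: le_lt_trans (ler_enormB _ _) _.
suff : enorm (m ((cell (mesh n) t)%:R * mesh n) - m t) < e / 2 by lra.
apply: H; first by rewrite t0 lexx.
  by rewrite c1 mulr_ge0// ltW// mesh_gt0.
by rewrite distrC ger0_norm ?subr_ge0//; rewrite -natr1 in c2; lra.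
Qed.

Lemma xlim_in (t : R) : 0 <= t -> D (xlim t).
Proof.
move=> t0; apply: Dcl => A /nbhs_enormP[e e0 eA].
have [n [/= H _ _]] := ultra_ex3 UU (scheme_cvg t0 e0) (Utail 0) (Utail 0).
by exists (X n (cell (mesh n) t)); split; [case: (sX n)|exact: eA].
Qed.

(** The Arzela-Ascoli argument: a filter is closed under finite intersections, so convergence is
    imposed at the finitely many times [j w], and equicontinuity of the scheme and of its limit
    covers the times between. *)
Lemma scheme_cvg_unif (T e : R) : 0 < T -> 0 < e ->
  U [set n | forall i, i%:R * mesh n <= T -> enorm (X n i - xlim (i%:R * mesh n)) <= e].
Proof.
move=> T0 e0; have e3 : 0 < e / 3 by lra.
have [tau [h1 [tau0 h10 H]]] :=
  scheme_equicontinuous rho0 gamma0 L0 delta0 sigma0 fL Dball cm T e3.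
have [eta eta0 Heta] := continuous_Rplus_unif T xlim_continuous e3.
have th : 0 < Num.min eta (tau / 2) by rewrite lt_min eta0 divr_gt0.
have [N N0 HN] := grid_small 0 T th.
have := HN N (leqnn N); rewrite subr0 lt_min => /andP[N1 N2].
pose w := T / N%:R.
have w0 : 0 < w by rewrite divr_gt0// ltr0n.
have FF : U [set n | forall j : 'I_N.+1,
    enorm (X n (cell (mesh n) (j%:R * w)) - xlim (j%:R * w)) < e / 3].
  by apply: filter_forall => j; apply: scheme_cvg => //; rewrite mulr_ge0// ltW.
have hh : 0 < Num.min h1 (tau / 2) by rewrite lt_min h10 divr_gt0.
apply: filterS (filterI FF (mesh_small hh)) => n /= [Hj].
rewrite lt_min => /andP[n1 n2] i iT.
have mi0 : 0 <= i%:R * mesh n by rewrite mulr_ge0// ltW// mesh_gt0.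
have /andP[j1 j2] := cellP w0 mi0.
set j := cell w _ in j1 j2.
have jN : (j < N.+1)%N.
  rewrite -(ltr_nat R) -(ltr_pM2r w0); apply: (@le_lt_trans _ _ T); first exact: le_trans iT.
  have -> : T = N%:R * w by rewrite /w mulrC divfK// pnatr_eq0 -lt0n.
  by rewrite ltr_pM2r// ltr_nat.
have jw0 : 0 <= j%:R * w by rewrite mulr_ge0// ltW.
have := Hj (Ordinal jN) => /= h3.
have /andP[c1 c2] := cellP (mesh_gt0 n) jw0.
set c := cell (mesh n) _ in h3 c1 c2.
rewrite -natr1 in c2; rewrite -natr1 in j2.
have wN : w < tau / 2 by [].
have weta : w < eta by [].
have [||||h4 _ _] := H (mesh n) (X n) _ (sX n) c i.
- by rewrite mesh_gt0 ltW.
- rewrite -ltnS -(ltr_nat R) -(ltr_pM2r (mesh_gt0 n)) -[i.+1%:R]natr1.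
  by have := mesh_gt0 n; lra.
- exact: iT.
- lra.
have h5 : enorm (xlim (j%:R * w) - xlim (i%:R * mesh n)) < e / 3.
  apply: Heta; [by rewrite mi0|by rewrite jw0 (le_trans j1)|].
  by rewrite distrC ger0_norm ?subr_ge0//; lra.
have := ler_enorm_trans (X n i) (X n c) (xlim (i%:R * mesh n)).
have := ler_enorm_trans (X n c) (xlim (j%:R * w)) (xlim (i%:R * mesh n)).
lra.
Qed.

End Limit.

(** * Fatou's lemma for step functions on a moving mesh *)

Section FatouCells.
Context {R : realType}.
Local Notation mu := (@lebesgue_measure R).

Lemma integral_cell (h c : R) (i : nat) : 0 < h -> 0 <= c ->
  (\int[mu]_r (c%:E * (\1_(`[i%:R * h, i.+1%:R * h[%classic : set R) r)%:E) = (h * c)%:E)%E.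
Proof.
move=> h0 c0; set I : set R := `[_, _[%classic.
have muI : mu I = h%:E.
  rewrite /I lebesgue_measure_itv /= lte_fin ltr_pM2r// ltr_nat ltnSn.
  by rewrite -EFinB -mulrBl -[i.+1%:R]natr1 addrAC subrr add0r mul1r.
have mI : measurable_fun setT (EFin \o (\1_I : R -> R)).
  by apply/measurable_EFinP; apply: measurable_indic; exact: measurable_itv.
rewrite ge0_integralZl_EFin//.
rewrite integral_indic; [|exact: measurableT|exact: measurable_itv].
rewrite setIT; transitivity (c%:E * mu I)%E; first by [].
by rewrite muI -EFinM mulrC.
Qed.

(** The pointwise hypothesis makes [G] a lower bound for the lower limit of the step functions
    [g j]; it is tested on reals [y] below [G r], which also covers infinite values of [G]. *)
Lemma fatou_cells (s t A : R) (G : R -> \bar R) (h : nat -> R) (a b : nat -> nat)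
    (c : nat -> nat -> R) :
  (forall j, 0 < h j) -> (forall j i, 0 <= c j i) ->
  measurable_fun `[s, t[%classic G -> (forall r, s <= r < t -> (0 <= G r)%E) ->
  (forall r, s <= r < t -> forall y : R, (y%:E < G r)%E -> exists N, forall j, (N <= j)%N ->
     exists i, [/\ (a j <= i < b j)%N, i%:R * h j <= r < i.+1%:R * h j & y <= c j i]) ->
  (forall j, \sum_(a j <= i < b j) h j * c j i <= A) ->
  (\int[mu]_(r in `[s, t[) G r <= A%:E)%E.
Proof.
move=> h0 c0 mG G0 Hc HA.
pose I j i : set R := `[i%:R * h j, i.+1%:R * h j[%classic.
pose g j r : \bar R := (\sum_(a j <= i < b j) (c j i)%:E * (\1_(I j i) r)%:E)%E.
have mterm B j i : measurable_fun B (fun r : R => ((c j i)%:E * (\1_(I j i) r)%:E)%E).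
  apply: emeasurable_funM => //.
  have : measurable_fun B (EFin \o (\1_(I j i) : R -> R)).
    by apply/measurable_EFinP; apply: measurable_indic; exact: measurable_itv.
  by [].
have term0 j i r : (0 <= (c j i)%:E * (\1_(I j i) r)%:E)%E.
  by rewrite mule_ge0// lee_fin// c0.
have mg B j : measurable_fun B (g j) by exact: emeasurable_sum.
have g0 j r : (0 <= g j r)%E by apply: sume_ge0 => i _.
have gint j : (\int[mu]_(r in `[s, t[) g j r <= A%:E)%E.
  (* Cells may overhang [s, t[. As [g j] is nonnegative, passing to the whole line only increases
     the integral and gives each cell its full length. *)
  apply: (@le_trans _ _ (\int[mu]_r g j r)%E).
    apply: ge0_subset_integral.
    - exact: measurable_itv.
    - exact: measurableT.
    - exact: mg.
    - by move=> *; exact: g0.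
    - by [].
  rewrite ge0_integral_sum;
    [|exact: measurableT|by move=> *; exact: mterm|by move=> *; exact: term0].
  under eq_bigr do rewrite integral_cell//.
  by rewrite sumEFin lee_fin.
have einfE (u : nat -> \bar R) : limn_einf u = ereal_sup (range (einfs u)).
  by rewrite limn_einf_lim; apply/cvg_lim => //; exact: cvg_einfs_sup.
have H1 : (\int[mu]_(r in `[s, t[) G r <= \int[mu]_(r in `[s, t[) limn_einf (g ^~ r))%E.
  apply: ge0_le_integral.
  - exact: measurable_itv.
  - by move=> r; rewrite /= in_itv/=; exact: G0.
  - exact: mG.
  - rewrite /limn_einf; apply: measurableT_comp => //.
    by apply: measurable_fun_limn_esup => n; apply: measurableT_comp => //; exact: mg.
  move=> r; rewrite /= in_itv/= => srt.
  have le_einf y : (y%:E < G r)%E -> (y%:E <= limn_einf (g ^~ r))%E.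
    move=> /(Hc r srt)[N HN]; rewrite einfE.
    apply: le_trans (ereal_sup_ubound _); last by exists N.
    apply: le_ereal_inf_tmp => _ [j /= Nj <-].
    have [i [ij ri yi]] := HN j Nj.
    rewrite /g (bigD1_seq i) ?mem_index_iota ?iota_uniq//=.
    apply: (@le_trans _ _ (c j i)%:E); first by rewrite lee_fin.
    have Ir : I j i r by rewrite /I /= in_itv.
    rewrite indicE mem_set// mule1 leeDl//.
    by apply: sume_ge0 => i' _.
  case: (G r) le_einf => [z| |] H; last exact: leNye.
    apply/lee_addgt0Pr => e e0; rewrite -leeBlDr//; apply: H.
    by rewrite lte_fin; lra.
  rewrite leye_eq; apply/eqP/eqyP => A' _; apply: H; exact: ltry.
have mst : measurable (`[s, t[%classic : set R) by exact: measurable_itv.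
apply: le_trans H1 (le_trans (fatou mu mst (mg _) (fun n r _ => g0 n r)) _).
rewrite einfE; apply: ge_ereal_sup => _ [N _ <-].
by apply: le_trans (ereal_inf_lbound _) (gint N); exists N => /=.
Qed.

End FatouCells.

Section MeasurableComp.
Context {R : realType} {d : nat}.
Variable phi : 'rV[R]_d -> \bar R.
Hypothesis phi_lsc : lower_semicontinuous phi.

(** Freezing [y] at [y 0] for negative times makes it continuous on the whole line; the composite is
    then lower semicontinuous, hence Borel. *)
Lemma measurable_lsc_comp (y : R -> 'rV[R]_d) (A : set R) :
  continuous_Rplus y -> measurable A -> A `<=` [set r | 0 <= r] ->
  measurable_fun A (phi \o y).
Proof.
move=> /continuous_RplusP cy mA A0.
apply: (@eq_measurable_fun _ _ _ _ A (fun r => phi (y (Num.max r 0)))).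
  by move=> r; rewrite inE => /A0 /= r0; rewrite max_l.
apply: (measurable_funS measurableT) => //.
apply: lower_semicontinuous_measurable => r a /phi_lsc[V yV HV].
have /nbhs_enormP[e e0 eV] := yV.
have [|eta eta0 He] := cy (Num.max r 0) _ e e0; first by rewrite le_max lexx orbT.
exists (ball r eta); first exact: nbhsx_ballx.
move=> r'; rewrite /ball/= => rr'; apply/HV/eV/He; first by rewrite le_max lexx orbT.
apply: le_lt_trans rr'; rewrite distrC.
have [r'0|r'0] := leP r' 0; have [r0|r0] := leP r 0.
- by rewrite subrr normr0.
- by rewrite subr0 gtr0_norm// ger0_norm; lra.
- by rewrite sub0r normrN gtr0_norm// ler0_norm; lra.
- by [].
Qed.

End MeasurableComp.

(** * The integral of phi along the limit path *)

Section PhiAlongPath.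
Context {R : realType} {d : nat}.
Variables (L : R) (phi : 'rV[R]_d -> \bar R).
Hypothesis L0 : 0 <= L.
Hypothesis phi_gtNy : forall v, (-oo < phi v)%E.
Hypothesis phi_lsc : lower_semicontinuous phi.
Hypothesis phi_L : forall x y, Dom phi x -> Dom phi y ->
  (`|phi x - phi y| <= (L + L * enorm (x - y))%:E)%E.
Local Notation D := (Dom phi).
Local Notation f := (fun v => fine (phi v)).
Local Notation mu := (@lebesgue_measure R).

Lemma fine_phi_bounded (x0 : 'rV[R]_d) (B : R) : D x0 ->
  exists2 C : R, 0 <= C & forall z, D z -> enorm z <= B -> `|f z| <= C.
Proof.
move=> Dx0; move: (L0) => l0; have b0 := enorm_ge0 x0.
exists (`|f x0| + L + L * (`|B| + enorm x0)).
  by rewrite !addr_ge0// mulr_ge0// addr_ge0.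
move=> z Dz zB; have := fine_phi_L phi_gtNy phi_L Dz Dx0.
have : L * enorm (z - x0) <= L * (`|B| + enorm x0).
  rewrite ler_wpM2l//; apply: le_trans (ler_enormB _ _) _; rewrite lerD2r.
  exact: le_trans (ler_norm _).
have : `|f z| <= `|f z - f x0| + `|f x0|.
  by rewrite -{1}[f z](subrK (f x0)) ler_normD.
by rewrite /=; lra.
Qed.

Lemma phi_path_integrable (x : R -> 'rV[R]_d) (T : R) :
  continuous_Rplus x -> (forall t, 0 <= t -> D (x t)) ->
  mu.-integrable `[0, T] (fun t => phi (x t)).
Proof.
move=> cx xD; have [B B0 xB] := continuous_Rplus_bounded T cx.
have [C C0 fC] := fine_phi_bounded B (xD 0 (lexx _)).
apply: (@le_integrable _ _ _ mu `[0, T]%classic _ (fun t => phi (x t)) (cst C%:E)).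
- exact: measurable_itv.
- apply: (measurable_lsc_comp phi_lsc cx); first exact: measurable_itv.
  by move=> t; rewrite /= in_itv/= => /andP[].
- move=> t; rewrite /= in_itv/= => tT; have /andP[t0 _] := tT.
  rewrite [phi (x t)](Dom_fineK phi_gtNy (xD t t0)) /= lee_fin (ger0_norm C0).
  by apply: fC; [exact: xD|exact: xB].
apply/integrableP; split; first exact: measurable_cst.
rewrite integral_cst /=; last exact: measurable_itv.
rewrite lebesgue_measure_itv /=; case: ifP => _; last by rewrite mule0 ltry.
by rewrite -EFinB -EFinM ltry.
Qed.

Variables (x : R -> 'rV[R]_d) (X : nat -> nat -> 'rV[R]_d) (U : set_system nat).
Hypotheses (UU : UltraFilter U) (Utail : forall N, U [set n | (N <= n)%N]).
Hypotheses (cx : continuous_Rplus x) (xD : forall t, 0 <= t -> D (x t)).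
Hypothesis XD : forall n i, D (X n i).
Hypothesis Xx : forall T e : R, 0 < T -> 0 < e ->
  U [set n | forall i, i%:R * mesh n <= T -> enorm (X n i - x (i%:R * mesh n)) <= e].

Definition scheme_sum n (s t : R) := \sum_(cell (mesh n) s <= i < cell (mesh n) t)
  mesh n * f (X n i.+1).

Lemma path_integral_fin (s t : R) : 0 <= s -> s <= t ->
  mu.-integrable `[s, t] (fun r => phi (x r)) /\
  (\int[mu]_(r in `[s, t]) phi (x r))%E \is a fin_num.
Proof.
move=> s0 st.
have H : mu.-integrable `[s, t] (fun r => phi (x r)).
  apply: (integrableS _ _ _ (phi_path_integrable t cx xD)).
  - exact: measurable_itv.
  - exact: measurable_itv.
  - by apply: subset_itvr; rewrite bnd_simp.
by split=> //; apply: integrable_fin_num => //; exact: measurable_itv.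
Qed.

(** Lower semicontinuity gives this one-sided bound, which is the side on which the variational
    inequality contains [phi (x r)]. Fatou's lemma works with sequences, so a failure along [U] is
    used to extract an actual sequence [n j]; adding the constant [C] makes the integrands
    nonnegative. *)
Lemma scheme_sum_liminf (s t e : R) : 0 <= s -> s < t -> 0 < e ->
  U [set n | fine (\int[mu]_(r in `[s, t]) phi (x r))%E - e < scheme_sum n s t].
Proof.
move=> s0 st e0; have [intx finx] := path_integral_fin s0 (ltW st).
set I := fine _; have t0 := le_lt_trans s0 st.
have [//|nU] := in_ultra_setVsetC [set n | I - e < scheme_sum n s t] UU; exfalso.
have T0 : 0 < t + 1 by lra.
have [B B0 xB] := continuous_Rplus_bounded (t + 1) cx.
have [C C0 fC] := fine_phi_bounded (B + 1) (xD (lexx 0)).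
have C1 : 0 < 2 * (C + 1) by lra.
(* The second bound keeps the error [C * h j] from rounding the interval to the mesh below [e / 2],
   against a supposed defect of [e]. *)
pose small j : R := Num.min (j.+1%:R^-1) (e / (2 * (C + 1))).
have small0 j : 0 < small j by rewrite lt_min invr_gt0 ltr0n divr_gt0.
have j1 (j : nat) : 0 < j.+1%:R^-1 :> R by rewrite invr_gt0.
have /choice[n Hn] : forall j, exists n, [/\ scheme_sum n s t <= I - e,
    mesh n < small j & forall i, i%:R * mesh n <= t + 1 ->
      enorm (X n i - x (i%:R * mesh n)) <= j.+1%:R^-1].
  move=> j; have [n [/= h1 h2 h3]] := ultra_ex3 UU nU (mesh_small UU Utail (small0 j))
    (Xx T0 (j1 j)).
  by exists n; split=> //; rewrite leNgt; apply/negP.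
pose h j : R := mesh (n j).
have h0 j : 0 < h j by exact: mesh_gt0.
have hsmall j : h j < j.+1%:R^-1 by have [_ + _] := Hn j; rewrite lt_min => /andP[].
have he j : h j * (2 * (C + 1)) < e.
  by have [_ + _] := Hn j; rewrite lt_min => /andP[_]; rewrite ltr_pdivlMr.
pose G r := (phi (x r) + C%:E)%E.
(* The truncation can act only outside the range of summation; [fatou_cells] asks for nonnegativity
   at all indices. *)
pose c j i : R := Num.max 0 (f (X (n j) i.+1) + C).
pose A := I - e / 2 + C * (t - s).
have XB j i : i%:R * h j <= t -> enorm (X (n j) i) <= B + 1.
  move=> it; have [_ _ /(_ i) H] := Hn j.
  have it1 : i%:R * h j <= t + 1 by lra.
  have h1 : enorm (X (n j) i - x (i%:R * h j)) <= j.+1%:R^-1 by exact: H.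
  have h2 : enorm (x (i%:R * h j)) <= B by apply: xB; rewrite it1 mulr_ge0// ltW.
  have h3 : j.+1%:R^-1 <= 1 :> R by rewrite invf_le1 ?ler1n ?ltr0n.
  have := ler_enorm_trans (X (n j) i) (x (i%:R * h j)) 0; rewrite !subr0.
  by move: h1 h3; set u := _^-1; lra.
have mst : measurable (`[s, t[%classic : set R) by exact: measurable_itv.
have mphi : measurable_fun `[s, t[%classic (phi \o x).
  apply: (measurable_lsc_comp phi_lsc cx) => //.
  by move=> r; rewrite /= in_itv/= => /andP[sr _]; exact: le_trans sr.
have sub : (`[s, t[%classic : set R) `<=` `[s, t]%classic.
  by apply: subset_itvl; rewrite bnd_simp.
have intx' : mu.-integrable `[s, t[ (fun r => phi (x r)).
  by apply: (integrableS _ _ _ intx) => //; exact: measurable_itv.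
have intC : mu.-integrable `[s, t[ (fun=> C%:E).
  apply/integrableP; split; first exact: measurable_cst.
  rewrite integral_cst /=; last exact: mst.
  rewrite lebesgue_measure_itv /=; case: ifP => _; last by rewrite mule0 ltry.
  by rewrite -EFinB -EFinM ltry.
have intG : (\int[mu]_(r in `[s, t[) G r = (I + C * (t - s))%:E)%E.
  rewrite integralD// integral_cst; last exact: mst.
  rewrite integral_itv_bndo_bndc//= lebesgue_measure_itv/= lte_fin st.
  by rewrite -[X in (X + _)%E]fineK// -EFinB -EFinM -EFinD.
suff : (\int[mu]_(r in `[s, t[) G r <= A%:E)%E.
  by rewrite intG lee_fin /A; lra.
apply: (@fatou_cells R s t A G h (fun j => cell (h j) s) (fun j => cell (h j) t) c) => //.
- by move=> j i; rewrite /c le_max lexx.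
- apply: emeasurable_funD => //; exact: measurable_cst.
- move=> r /andP[sr rt]; have r0 := le_trans s0 sr.
  rewrite /G [phi (x r)](Dom_fineK phi_gtNy (xD r0)) -EFinD lee_fin.
  have xr : enorm (x r) <= B + 1.
    by apply: (@le_trans _ _ B); [apply: xB; rewrite r0; lra|lra].
  by have /ler_normlP[] := fC _ (xD r0) xr; lra.
- move=> r /andP[sr rt] y; have r0 := le_trans s0 sr.
  rewrite /G [phi (x r)](Dom_fineK phi_gtNy (xD r0)) -EFinD lte_fin => yG.
  have e1 : 0 < f (x r) + C - y by rewrite subr_gt0.
  have [eta eta0 Heta] := fine_phi_lsc phi_gtNy phi_lsc (xD r0) e1.
  have eta2 : 0 < eta / 2 by lra.
  have [eta' eta'0 Heta'] := continuous_Rplus_unif (t + 1) cx eta2.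
  have w0 : 0 < Num.min (eta / 2) (Num.min eta' (t - r)).
    by rewrite !lt_min eta2 eta'0 subr_gt0.
  have [N _ HN] := near_infty_natSinv_lt (PosNum w0).
  exists N => j Nj; have := HN j Nj; rewrite /= !lt_min => /and3P[w1 w2 w3].
  have hw1 := lt_trans (hsmall j) w1; have hw2 := lt_trans (hsmall j) w2.
  have hw3 := lt_trans (hsmall j) w3.
  have /andP[c1 c2] := cellP (h0 j) r0.
  have c3 : (cell (h j) r).+1%:R * h j <= t.
    by rewrite -natr1 mulrDl mul1r; lra.
  exists (cell (h j) r); split.
  + by rewrite cell_le//=; apply: cell_max.
  + by rewrite c1.
  rewrite /c le_max; apply/orP; right.
  have [_ _ /(_ (cell (h j) r).+1)] := Hn j; rewrite -/(h j) => Hx.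
  have c4 : (cell (h j) r).+1%:R * h j <= t + 1 by lra.
  have {}Hx := le_lt_trans (Hx c4) w1.
  have c5 : enorm (x ((cell (h j) r).+1%:R * h j) - x r) < eta / 2.
    apply: Heta'; first by rewrite r0; lra.
      by rewrite c4 mulr_ge0// ltW.
    rewrite ger0_norm; last by rewrite subr_ge0 ltW.
    by rewrite -natr1 mulrDl mul1r; lra.
  have := Heta _ (XD (n j) (cell (h j) r).+1).
  have := ler_enorm_trans (X (n j) (cell (h j) r).+1) (x ((cell (h j) r).+1%:R * h j)) (x r).
  move=> c6 H; have : enorm (X (n j) (cell (h j) r).+1 - x r) < eta by lra.
  by move=> /H; lra.
move=> j.
have -> : \sum_(cell (h j) s <= i < cell (h j) t) h j * c j i =
    scheme_sum (n j) s t + C * (h j * ((cell (h j) t)%:R - (cell (h j) s)%:R)).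
  have -> : C * (h j * ((cell (h j) t)%:R - (cell (h j) s)%:R)) =
      \sum_(cell (h j) s <= i < cell (h j) t) h j * C.
    rewrite sumr_const_nat -natrB ?cell_le// ?(ltW st)//.
    by rewrite -[RHS]mulr_natr; ring.
  rewrite /scheme_sum -big_split/=; apply: eq_big_nat => i /andP[_ it].
  rewrite -mulrDr; congr (_ * _); rewrite /c max_r//.
  have xt : i.+1%:R * h j <= t.
    have /andP[h1 _] := cellP (h0 j) (ltW t0); apply: le_trans h1.
    by rewrite ler_wpM2r ?(ltW (h0 j))// ler_nat.
  by have /ler_normlP[] := fC _ (XD (n j) i.+1) (XB j _ xt); lra.
have [h1 _ _] := Hn j.
have h2 := mesh_gap (n j) s0 (ltW st); rewrite -/(h j) in h2.
have h3 := ler_wpM2l C0 h2.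
by have h4 := he j; have h5 := h0 j; rewrite /A; lra.
Qed.


End PhiAlongPath.

Section SmallErrors.
Context {R : realFieldType}.
Implicit Types (a b c e p q : R).

Lemma ler_small_error a b c : 0 <= c -> (forall e, 0 < e <= 1 -> a <= b + e * c) -> a <= b.
Proof.
move=> c0 H; apply/ler_addgt0Pr => e e0.
have c1 : 0 < c + 1 by lra.
pose e1 := Num.min 1 (e / (c + 1)).
have e10 : 0 < e1 by rewrite lt_min ltr01 divr_gt0.
have e1e : e1 * (c + 1) <= e by rewrite -ler_pdivlMr// ge_min lexx orbT.
have := H e1; rewrite e10 ge_min lexx /= => /(_ isT); lra.
Qed.

Lemma ler_prod_error e p q a b : 0 <= e <= 1 -> 0 <= q -> 0 <= b ->
  (p + e * q) * (a + e * b) <= p * a + e * (p * b + q * a + q * b).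
Proof.
move=> /andP[e0 e1] q0 b0.
have : 0 <= e * (1 - e) * (q * b) by rewrite !mulr_ge0// subr_ge0.
lra.
Qed.

End SmallErrors.

(** * The coarse inequality in the limit *)

Section LimitCoarse.
Context {R : realType} {d : nat}.
Variables (rho gamma L : R) (phi : 'rV[R]_d -> \bar R).
Hypotheses (rho0 : 0 <= rho) (gamma0 : 0 <= gamma) (L0 : 0 <= L).
Hypothesis phi_gtNy : forall v, (-oo < phi v)%E.
Hypothesis phi_lsc : lower_semicontinuous phi.
Hypothesis phi_L : forall x y, Dom phi x -> Dom phi y ->
  (`|phi x - phi y| <= (L + L * enorm (x - y))%:E)%E.
Local Notation D := (Dom phi).
Local Notation f := (fun v => fine (phi v)).
Local Notation mu := (@lebesgue_measure R).
Hypothesis Dprox : proximal_points rho gamma D f.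
Variables (m x k : R -> 'rV[R]_d) (V : R -> R) (X : nat -> nat -> 'rV[R]_d).
Variable U : set_system nat.
Hypotheses (UU : UltraFilter U) (Utail : forall N, U [set n | (N <= n)%N]).
Hypotheses (cx : continuous_Rplus x) (xD : forall t, 0 <= t -> D (x t)).
Local Notation K n := (reflection (sampled m (mesh n)) (X n)).
Hypothesis sX : forall n, is_scheme rho gamma L D f (mesh n) (sampled m (mesh n)) (X n).
Hypothesis Kk : forall t e : R, 0 <= t -> 0 < e ->
  U [set n | enorm (K n (cell (mesh n) t) - k t) < e].
Hypothesis dvarV : forall t e : R, 0 <= t -> 0 < e -> U [set n | `|dvar m X n t - V t| < e].
Hypothesis Xx1 : forall t e : R, 0 <= t -> 0 < e ->
  U [set n | enorm (X n (cell (mesh n) t) - x t) < e].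
Hypothesis Xx : forall T e : R, 0 < T -> 0 < e ->
  U [set n | forall i, i%:R * mesh n <= T -> enorm (X n i - x (i%:R * mesh n)) <= e].

Lemma coarse_const_ge0 : 0 <= coarse_const rho gamma.
Proof.
rewrite /coarse_const; move: rho0 gamma0 => r0 g0.
have : 0 <= gamma * rho by rewrite mulr_ge0.
have : 0 <= gamma * gamma by rewrite mulr_ge0.
lra.
Qed.

(* [V] may exceed [Var k], but enters only the term that vanishes with [eta]. *)
Lemma limit_coarse (s t eta : R) (z : 'rV[R]_d) : 0 <= s -> s < t -> 0 < eta <= 1 ->
  (forall r, s <= r <= t -> enorm (x r - x s) <= eta ^+ 2 / 4) -> D z ->
  dotv (k t - k s) (z - x s) + fine (\int[mu]_(r in `[s, t]) phi (x r))%E <=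
  (t - s) * f z + (rho * (t - s) + gamma * enorm (k t - k s)) * enorm (z - x s) ^+ 2
  + coarse_const rho gamma * eta * (V t - V s + (t - s)) * (1 + enorm (z - x s) ^+ 2).
Proof.
move=> s0 st eta01 xosc Dz; have /andP[eta0 eta1] := eta01.
have st' := ltW st; have t0 : 0 <= t := le_trans s0 st'.
have tpos : 0 < t := le_lt_trans s0 st.
set I := fine _; set kap := k t - k s; set tau := t - s.
set A := enorm kap; set Z := enorm (z - x s).
have A0 : 0 <= A by exact: enorm_ge0.
have Z0 : 0 <= Z by exact: enorm_ge0.
have C0 := coarse_const_ge0; set C := coarse_const _ _ in C0 *.
have tau0 : 0 < tau by rewrite subr_gt0.
pose W := V t - V s + tau.
have W0 : 0 <= W.
  have h1 : enorm kap <= V t - V s := limit_reflection_le UU Kk dvarV s0 st'.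
  by rewrite /W; move: h1; rewrite -/A; lra.
pose P := rho * tau + gamma * A; pose q := rho + 2 * gamma; pose Qz := 2 * Z + 1.
pose C' := C * eta; have C'0 : 0 <= C' by rewrite mulr_ge0// ltW.
have P0 : 0 <= P by rewrite addr_ge0// mulr_ge0// ltW.
have q0 : 0 <= q by rewrite /q; move: rho0 gamma0; lra.
have Qz0 : 0 <= Qz by rewrite /Qz; lra.
(* [big] collects the coefficients of [e] in all the errors. In the quadratic term the perturbed
   factors are at most [P + e * q] and [Z ^+ 2 + e * Qz]. *)
pose big1 := P * Qz + q * Z ^+ 2 + q * Qz.
pose big2 := C' * W * Qz + 3 * C' * (1 + Z ^+ 2) + 3 * C' * Qz.
pose big := 1 + A + 2 * (Z + 1) + `|f z| + big1 + big2.
have Z20 : 0 <= Z ^+ 2 by exact: sqr_ge0.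
have big10 : 0 <= big1 by rewrite /big1 !addr_ge0// mulr_ge0.
have big20 : 0 <= big2.
  have g1 : 0 <= C' * W * Qz by apply: mulr_ge0 => //; exact: mulr_ge0.
  have g2 : 0 <= C' * Z ^+ 2 by exact: mulr_ge0.
  have g3 : 0 <= C' * Qz by exact: mulr_ge0.
  by rewrite /big2; lra.
apply: (@ler_small_error _ _ _ big).
  by rewrite /big; move: (normr_ge0 (f z)); lra.
move=> e /andP[e0 e1].
(* Two errors of [eta ^+ 2 / 8] and the oscillation [eta ^+ 2 / 4] of [x] stay below the [eta ^+ 2]
   required of the scheme. *)
have w0 : 0 < eta ^+ 2 / 8 by rewrite divr_gt0// exprn_gt0.
have e2 : 0 < Num.min e (eta ^+ 2 / 8) by rewrite lt_min e0.
(* A mesh below [tau] leaves at least one mesh point in ]s, t], whence [a < b]. *)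
have e3 : 0 < Num.min e tau by rewrite lt_min e0.
have [n [/= [h1 h2] [[h3 h4] h5] [[h6 h7] h8]]] := ultra_ex3 UU
  (filterI (Kk s0 e0) (Kk t0 e0))
  (filterI (filterI (dvarV s0 e0) (dvarV t0 e0)) (Xx1 s0 e2))
  (filterI (filterI (mesh_small UU Utail e3) (Xx tpos w0))
     (scheme_sum_liminf L0 phi_gtNy phi_lsc phi_L UU Utail cx xD
       (fun n i => let: And3 XD _ _ := sX n in XD i) Xx s0 st e0)).
move: h5 h6; rewrite !lt_min => /andP[h5 h5'] /andP[h6 h6'].
have hm : 0 < mesh n :> R by exact: mesh_gt0.
move: h1 h2 h5 h5'; set a := cell (mesh n) s; set b := cell (mesh n) t => h1 h2 h5 h5'.
have /andP[a1 a2] := cellP hm s0; rewrite -/a in a1 a2.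
have /andP[b1 b2] := cellP hm t0; rewrite -/b in b1 b2.
have ab : (a < b)%N.
  by apply: cell_max => //; rewrite -natr1 mulrDl mul1r; move: h6'; rewrite /tau; lra.
have Xeta i : (a < i <= b)%N -> enorm (X n i - X n a) <= eta ^+ 2.
  move=> /andP[ai ib].
  have it : i%:R * mesh n <= t by apply: le_trans b1; rewrite ler_pM2r// ler_nat.
  have si : s <= i%:R * mesh n by apply: (le_trans (ltW a2)); rewrite ler_pM2r// ler_nat.
  have g1 := h7 i it.
  have g2 : enorm (x (i%:R * mesh n) - x s) <= eta ^+ 2 / 4 by apply: xosc; rewrite si.
  have := ler_enorm_trans (X n i) (x (i%:R * mesh n)) (X n a).
  have := ler_enorm_trans (x (i%:R * mesh n)) (x s) (X n a).
  rewrite [enorm (x s - X n a)]enormB; have := sqr_ge0 eta; lra.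
have := coarse_inequality rho0 gamma0 Dprox hm (sX n) ab eta01 Xeta Dz.
rewrite -/(scheme_sum phi X n s t) -(dvarB m X n s0 st') -/C.
set kn := reflection _ _ b - _; set p := X n a; set tn := mesh n * _.
set Sn := scheme_sum _ _ _ _ _ in h8 *.
set Zn := enorm (z - p); set An := enorm kn; set Wn := dvar _ _ _ _ - _ + tn.
move=> coarse.
have tn1 : tn <= tau + e.
  by have := mesh_gap n s0 st'; rewrite -/a -/b -/tn /tau; lra.
have tn2 : tau - e <= tn.
  by rewrite /tn mulrBr -!(mulrC _%:R) /tau; move: b2; rewrite -natr1 mulrDl mul1r; lra.
have dk : enorm (kn - kap) <= 2 * e.
  have -> : kn - kap = (K n b - k t) - (K n a - k s).
    by rewrite /kn /kap; apply/rowP => j; rewrite !mxE; ring.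
  by apply: le_trans (ler_enormB _ _) _; lra.
have An1 : An <= A + 2 * e.
  have -> : An = enorm ((kn - kap) + kap) by rewrite subrK.
  by apply: le_trans (ler_enormD _ _) _; rewrite -/A; lra.
have Zn1 : Zn <= Z + e.
  apply: le_trans (ler_enorm_trans _ (x s) _) _.
  by rewrite lerD2l enormB ltW.
have Zn0 : 0 <= Zn by exact: enorm_ge0.
have Zn2 : Zn ^+ 2 <= Z ^+ 2 + e * Qz.
  apply: (@le_trans _ _ ((Z + e) ^+ 2)); first by rewrite lerXn2r ?nnegrE//; lra.
  have : 0 <= e * (1 - e) by rewrite mulr_ge0 ?subr_ge0// ltW.
  by rewrite /Qz; lra.
have Wn1 : Wn <= W + 3 * e.
  move: h3 h4; rewrite !ltr_norml => /andP[g1 g2] /andP[g3 g4].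
  by rewrite /Wn /W; lra.
have e01 : 0 <= e <= 1 by rewrite ltW.
have dots : dotv kap (z - x s) - e * A - e * (2 * (Z + 1)) <= dotv kn (z - p).
  have -> : dotv kn (z - p) = dotv kap (z - x s) + dotv kap (x s - p) + dotv (kn - kap) (z - p).
    by rewrite !(dotvBl, dotvBr); ring.
  have := dotv_norm kap (x s - p); have := dotv_norm (kn - kap) (z - p).
  rewrite !ler_norml => /andP[g1 _] /andP[g2 _].
  have g3 : enorm (kn - kap) * Zn <= 2 * e * (Z + 1).
    by apply: ler_pM => //; [exact: enorm_ge0|lra].
  have g4 : A * enorm (x s - p) <= A * e.
    by rewrite ler_wpM2l// enormB ltW.
  rewrite -/A -/Zn in g1 g2; lra.
have tf : tn * f z <= tau * f z + e * `|f z|.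
  have g1 : `|(tn - tau) * f z| <= e * `|f z|.
    by rewrite normrM ler_wpM2r// ler_norml; apply/andP; split; lra.
  by have := le_trans (ler_norm _) g1; rewrite /=; lra.
have quad : (rho * tn + gamma * An) * Zn ^+ 2 <= P * Z ^+ 2 + e * big1.
  apply: le_trans (ler_prod_error P (Z ^+ 2) e01 q0 Qz0).
  apply: ler_pM => //.
  - by rewrite addr_ge0// mulr_ge0// ?enorm_ge0// /tn mulr_ge0 ?(ltW hm)// subr_ge0 ler_nat ltnW.
  - exact: sqr_ge0.
  have g1 := ler_wpM2l rho0 tn1; have g2 := ler_wpM2l gamma0 An1.
  by rewrite /P /q; lra.
have quad2 : C * eta * Wn * (1 + Zn ^+ 2) <= C' * W * (1 + Z ^+ 2) + e * big2.
  have q3 : 0 <= 3 * C' by lra.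
  apply: le_trans (ler_prod_error (C' * W) (1 + Z ^+ 2) e01 q3 Qz0).
  apply: ler_pM.
  - rewrite mulr_ge0// /Wn addr_ge0//.
      by rewrite (dvarB m X n s0 st'); apply: sumr_ge0 => i _; exact: enorm_ge0.
    by rewrite /tn mulr_ge0 ?(ltW hm)// subr_ge0 ler_nat ltnW.
  - by rewrite addr_ge0// sqr_ge0.
  - by have := ler_wpM2l C'0 Wn1; rewrite /C'; lra.
  - by lra.
by rewrite /big /I -/C' -/W -/P; lra.
Qed.

End LimitCoarse.

(** * The variational inequality *)

Section GridIntegral.
Context {R : realType}.
Local Notation mu := (@lebesgue_measure R).
Implicit Types (s t p q : R) (g : R -> \bar R).

Lemma integral_itv_split s p q g : s <= p -> p <= q -> measurable_fun `[s, q] g ->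
  (\int[mu]_(r in `[s, q]) g r = \int[mu]_(r in `[s, p]) g r + \int[mu]_(r in `[p, q]) g r)%E.
Proof.
move=> sp pq mg.
have E : (`[s, q]%classic : set R) = `[s, p[ `|` `[p, q].
  by rewrite -itv_bndbnd_setU// bnd_simp.
have msp : measurable_fun `[s, p[ g.
  by apply: measurable_funS mg => //; rewrite E => r; left.
rewrite -[in RHS](@integral_itv_bndo_bndc _ (BLeft s) p)// E integral_setU//.
- by rewrite -E.
by apply/disj_setPRL => r /=; rewrite !in_itv/= => /andP[pr _]; rewrite ltNge pr andbF.
Qed.

Lemma grid_integral s t N g : s <= t -> (0 < N)%N -> measurable_fun `[s, t] g ->
  (\int[mu]_(r in `[s, t]) g r =
   \sum_(j < N) \int[mu]_(r in `[grid s t N j, grid s t N j.+1]) g r)%E.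
Proof.
move=> st N0 mg.
suff H : forall n, (n <= N)%N -> (\int[mu]_(r in `[s, grid s t N n]) g r =
   \sum_(j < n) \int[mu]_(r in `[grid s t N j, grid s t N j.+1]) g r)%E.
  by rewrite -H// gridN.
elim=> [_|n ih nN]; first by rewrite grid0 big_ord0 set_itv1 integral_set1.
rewrite big_ord_recr/= -ih ?(ltnW nN)//.
have /andP[h1 h2] := grid_in st (ltnW nN); have /andP[h3 h4] := grid_in st nN.
apply: integral_itv_split => //; first exact: grid_le.
by apply: measurable_funS mg => //; apply: subset_itvl; rewrite bnd_simp.
Qed.

(** Averages an inequality that holds for each test time [r]. Since [g] may take infinite values,
    the comparison with [c / (t - s)] is made separately on positive and negative parts. *)
Lemma cst_le_integral s t (c : R) g : s <= t -> measurable_fun `[s, t] g ->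
  (forall r, s <= r <= t -> (c%:E <= (t - s)%:E * g r)%E) ->
  (c%:E <= \int[mu]_(r in `[s, t]) g r)%E.
Proof.
rewrite le_eqVlt => /orP[/eqP <-|st] mg H.
  rewrite set_itv1 integral_set1; have := H s.
  by rewrite subrr mul0e lexx; exact.
have ts0 : 0 < t - s by rewrite subr_gt0.
have mst : measurable (`[s, t]%classic : set R) by exact: measurable_itv.
have must : mu (`[s, t]%classic : set R) = (t - s)%:E.
  by rewrite lebesgue_measure_itv /= lte_fin st EFinB.
pose c1 := c / (t - s).
have Hr r : s <= r <= t -> (c1%:E <= g r)%E.
  move=> /H; rewrite muleC -lee_pdivrMr//.
have -> : c%:E = (\int[mu]_(r in `[s, t]) c1%:E)%E.
  rewrite integral_cst//; transitivity (c1%:E * mu `[s, t])%E; last by [].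
  by rewrite must -EFinM /c1 divfK// gt_eqF.
rewrite integralE [leRHS]integralE; apply: leeB.
  apply: ge0_le_integral => //.
  - exact/measurable_funepos.
  - exact/measurable_funepos.
  - move=> r; rewrite /= in_itv/= => /Hr cr; rewrite !funeposE.
    by rewrite ge_max !le_max lexx orbT cr.
apply: ge0_le_integral => //.
- exact/measurable_funeneg.
- exact/measurable_funeneg.
- move=> r; rewrite /= in_itv/= => /Hr cr; rewrite !funenegE.
  by rewrite ge_max !le_max lexx orbT leeN2 cr.
Qed.

End GridIntegral.

Section PathIntegrals.
Context {R : realType} {d : nat}.
Local Notation mu := (@lebesgue_measure R).
Implicit Types (x y : R -> 'rV[R]_d) (s t : R).

Lemma continuous_RplusB x y : continuous_Rplus x -> continuous_Rplus y ->
  continuous_Rplus (fun r => x r - y r).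
Proof.
move=> /continuous_RplusP cx /continuous_RplusP cy.
apply/continuous_RplusP => t t0 e e0; have e2 : 0 < e / 2 by lra.
have [eta eta0 Hx] := cx t t0 _ e2; have [eta' eta'0 Hy] := cy t t0 _ e2.
exists (Num.min eta eta'); first by rewrite lt_min eta0.
move=> r r0; rewrite lt_min => /andP[r1 r2].
have -> : x r - y r - (x t - y t) = (x r - x t) - (y r - y t).
  by apply/rowP => j; rewrite !mxE; ring.
apply: le_lt_trans (ler_enormB _ _) _.
by have := Hx r r0 r1; have := Hy r r0 r2; lra.
Qed.

Lemma sq_enorm_lsc : lower_semicontinuous (fun v : 'rV[R]_d => (enorm v ^+ 2)%:E).
Proof.
move=> v a; rewrite lte_fin => av.
pose e := enorm v ^+ 2 - a; have e0 : 0 < e by rewrite subr_gt0.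
have n0 := enorm_ge0 v; have v1 : 0 < 2 * enorm v + 1 by lra.
exists [set w | enorm (w - v) < e / (2 * enorm v + 1)].
  by apply/nbhs_enormP; exists (e / (2 * enorm v + 1)) => //; rewrite divr_gt0.
move=> w /=; rewrite ltr_pdivlMr// lte_fin => wv.
have := enormD_sqr v (w - v); rewrite addrC subrK => ->.
have /ler_normlP[+ _] := dotv_norm v (w - v).
have := sqr_ge0 (enorm (w - v)); have := enorm_ge0 (w - v).
by move: wv; rewrite /e; nra.
Qed.

Lemma sq_enorm_measurable x s t : continuous_Rplus x -> 0 <= s ->
  measurable_fun `[s, t] (fun r => (enorm (x r) ^+ 2)%:E).
Proof.
move=> cx s0; apply: (measurable_lsc_comp sq_enorm_lsc cx) => //.
by move=> r; rewrite /= in_itv/= => /andP[sr _]; exact: le_trans sr.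
Qed.

Lemma sq_enorm_integrable x s t : continuous_Rplus x -> 0 <= s -> s <= t ->
  mu.-integrable `[s, t] (fun r => (enorm (x r) ^+ 2)%:E).
Proof.
move=> cx s0 st; have [B B0 xB] := continuous_Rplus_bounded t cx.
apply: (@le_integrable _ _ _ mu `[s, t]%classic _ _ (cst (B ^+ 2)%:E)).
- exact: measurable_itv.
- exact: sq_enorm_measurable.
- move=> r; rewrite /= in_itv/= => /andP[sr rt].
  rewrite lee_fin !ger0_norm ?sqr_ge0// lerXn2r ?nnegrE ?enorm_ge0//.
  by apply: xB; rewrite rt (le_trans s0).
apply/integrableP; split; first exact: measurable_cst.
rewrite integral_cst /=; last exact: measurable_itv.
rewrite lebesgue_measure_itv /=; case: ifP => _; last by rewrite mule0 ltry.
by rewrite -EFinB -EFinM ltry.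
Qed.

Lemma EFin_Rintegral_sq_enorm x s t : continuous_Rplus x -> 0 <= s -> s <= t ->
  (\int[mu]_(r in `[s, t]) (enorm (x r) ^+ 2))%:E =
  (\int[mu]_(r in `[s, t]) (enorm (x r) ^+ 2)%:E)%E.
Proof.
move=> cx s0 st; rewrite /Rintegral fineK//; apply: integrable_fin_num => //.
exact: sq_enorm_integrable.
Qed.

Lemma Rintegral_sq_enorm_le x s t (B : R) : continuous_Rplus x -> 0 <= s -> s <= t ->
  (forall r, s <= r <= t -> enorm (x r) ^+ 2 <= B) ->
  \int[mu]_(r in `[s, t]) (enorm (x r) ^+ 2) <= B * (t - s).
Proof.
move=> cx s0 st xB; rewrite -lee_fin EFin_Rintegral_sq_enorm//.
have mst : measurable (`[s, t]%classic : set R) by exact: measurable_itv.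
have must : mu (`[s, t]%classic : set R) = (t - s)%:E.
  rewrite lebesgue_measure_itv /= lte_fin; case: ltP => st'; first by rewrite EFinB.
  by have -> : t = s; [apply: le_anti; rewrite st' st|rewrite subrr].
have cstE : (\int[mu]_(r in `[s, t]) (cst B%:E) r = (B * (t - s))%:E)%E.
  rewrite integral_cst//; transitivity (B%:E * mu `[s, t])%E; first by [].
  by rewrite must -EFinM.
rewrite -cstE; apply: ge0_le_integral => //.
- by move=> r _; rewrite lee_fin sqr_ge0.
- exact: sq_enorm_measurable.
Qed.

Lemma Rintegral_sq_enorm_ge x s t (B : R) : continuous_Rplus x -> 0 <= s -> s <= t ->
  (forall r, s <= r <= t -> B <= enorm (x r) ^+ 2) ->
  B * (t - s) <= \int[mu]_(r in `[s, t]) (enorm (x r) ^+ 2).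
Proof.
move=> cx s0 st xB; rewrite -lee_fin EFin_Rintegral_sq_enorm//.
apply: cst_le_integral => //; first exact: sq_enorm_measurable.
move=> r rst; rewrite -EFinM lee_fin mulrC ler_wpM2l ?subr_ge0//; exact: xB.
Qed.

End PathIntegrals.

Lemma RS_int_same (R : realType) (U V : zmodType) (b : U -> V -> R) f g (s : R) :
  RS_int b f g s s = 0.
Proof.
apply: RS_intE => // e e0; exists 1 => // p xi /itv_partitionxx -> _.
by rewrite /RS_sum big_ord0 subrr normr0.
Qed.

Section VariationalInequality.
Context {R : realType} {d : nat}.
Variables (rho gamma L : R) (phi : 'rV[R]_d -> \bar R).
Hypotheses (rho0 : 0 <= rho) (gamma0 : 0 <= gamma) (L0 : 0 <= L).
Hypothesis phi_gtNy : forall v, (-oo < phi v)%E.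
Hypothesis phi_lsc : lower_semicontinuous phi.
Hypothesis phi_L : forall x y, Dom phi x -> Dom phi y ->
  (`|phi x - phi y| <= (L + L * enorm (x - y))%:E)%E.
Local Notation D := (Dom phi).
Local Notation f := (fun v => fine (phi v)).
Local Notation mu := (@lebesgue_measure R).
Variables (x k : R -> 'rV[R]_d) (V : R -> R) (C : R).
Hypotheses (cx : continuous_Rplus x) (xD : forall t, 0 <= t -> D (x t)).
Hypothesis kV : forall s t : R, 0 <= s -> s <= t -> enorm (k t - k s) <= V t - V s.
Hypothesis C0 : 0 <= C.
Hypothesis coarse : forall (s t eta : R) (z : 'rV[R]_d), 0 <= s -> s < t -> 0 < eta <= 1 ->
  (forall r, s <= r <= t -> enorm (x r - x s) <= eta ^+ 2 / 4) -> D z ->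
  dotv (k t - k s) (z - x s) + fine (\int[mu]_(r in `[s, t]) phi (x r))%E <=
  (t - s) * f z + (rho * (t - s) + gamma * enorm (k t - k s)) * enorm (z - x s) ^+ 2
  + C * eta * (V t - V s + (t - s)) * (1 + enorm (z - x s) ^+ 2).

Lemma BV_loc_dominated : BV_loc k.
Proof. by move=> t t0; apply: le_lt_trans (Var_le kV t0) _; rewrite ltry. Qed.

Variables (y : R -> 'rV[R]_d).
Hypothesis cy : continuous_Rplus y.
Local Notation u := (fun r => y r - x r).
Local Notation W k := (fun r => fine (Var k r)).

Let cu : continuous_Rplus u := continuous_RplusB cy cx.

(** The summands come, in order, from replacing [y r] by [y p] in the scalar product and in the
    square, from the coarse error, and from replacing the square at [p] by its integral over the
    cell. *)
Definition cell_const (B : R) := 2 + (rho + gamma) * (2 * B + 1) + C * (1 + (B + 1) ^+ 2) + rho.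

(* The error is [e] times an increment of an additive function of the cell, so
   it stays of order [e] after summation over a partition. *)
Lemma cell_inequality (p q e B : R) : 0 <= p -> p < q -> 0 < e <= 1 -> 0 <= B ->
  (forall r, p <= r <= q -> enorm (u r) <= B) ->
  (forall r, p <= r <= q -> enorm (x r - x p) <= e ^+ 2 / 4) ->
  (forall r, p <= r <= q -> enorm (y r - y p) <= e) ->
  (forall r, p <= r <= q -> `|enorm (u r) ^+ 2 - enorm (u p) ^+ 2| <= e) ->
  ((dotv (u p) (k q - k p) + fine (\int[mu]_(r in `[p, q]) phi (x r))%E
    - rho * \int[mu]_(r in `[p, q]) (enorm (u r) ^+ 2)
    - gamma * (enorm (u p) ^+ 2 * (fine (Var k q) - fine (Var k p)))
    - e * (cell_const B * (V q - V p + (q - p))))%:E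
   <= \int[mu]_(r in `[p, q]) phi (y r))%E.
Proof.
move=> p0 pq e01 B0 uB xe ye ue; have pq' := ltW pq; have /andP[e0 e1] := e01.
move: (rho0) (gamma0) (C0) => r0 g0 c0.
have ppq : p <= p <= q by rewrite lexx.
set I := fine _; set Q := \int[mu]_(r in _) _; set kap := k q - k p.
set dW := fine _ - fine _; set A := enorm kap; set up := enorm (u p).
have A0 : 0 <= A by exact: enorm_ge0.
have up0 : 0 <= up by exact: enorm_ge0.
have upB : up <= B by exact: uB.
have up2 : 0 <= up ^+ 2 by exact: sqr_ge0.
have AW : A <= dW by apply: enorm_le_Var => //; exact: BV_loc_dominated.
have AV : A <= V q - V p by exact: kV.
have qp0 : 0 < q - p by rewrite subr_gt0.
have HQ : (up ^+ 2 - e) * (q - p) <= Q.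
  apply: Rintegral_sq_enorm_ge => // r rpq.
  by have /ler_normlP[+ _] := ue r rpq; rewrite -/up; lra.
pose Lam := V q - V p + (q - p).
have Lam0 : 0 <= Lam by rewrite /Lam; lra.
(* For each [r] in the cell the coarse inequality is used with the fixed point [z = y r]; averaging
   over [r] produces the integral of [phi] along [y]. *)
apply: cst_le_integral => //.
  apply: (measurable_lsc_comp phi_lsc cy) => //.
  by move=> r; rewrite /= in_itv/= => /andP[pr _]; exact: le_trans pr.
move=> r rpq; have [Dy|nDy] := pselect (D (y r)); last first.
  by rewrite (phi_notin_Dom nDy) gt0_muley ?lte_fin// leey.
rewrite [phi (y r)](Dom_fineK phi_gtNy Dy) -EFinM lee_fin.
have := coarse p0 pq e01 xe Dy; rewrite -/kap -/I -/A -/Lam.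
set Z := enorm (y r - x p).
have yxp : y r - x p = (u p) + (y r - y p) by apply/rowP => j; rewrite !mxE; ring.
have ye' := ye r rpq.
have Z0 : 0 <= Z by exact: enorm_ge0.
have Zu : Z <= up + e.
  by rewrite /Z yxp; apply: le_trans (ler_enormD _ _) _; rewrite lerD2l.
have ZB : Z <= B + 1 by lra.
have Z2 : Z ^+ 2 <= up ^+ 2 + e * (2 * B + 1).
  apply: (@le_trans _ _ ((up + e) ^+ 2)); first by rewrite lerXn2r ?nnegrE//; lra.
  have : 0 <= e * (1 - e) by rewrite mulr_ge0 ?subr_ge0// ltW.
  have : 0 <= e * (B - up) by rewrite mulr_ge0 ?subr_ge0// ltW.
  by lra.
have ZB2 : 1 + Z ^+ 2 <= 1 + (B + 1) ^+ 2 by rewrite lerD2l lerXn2r ?nnegrE//; lra.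
have dot : dotv (u p) kap - e * Lam <= dotv kap (y r - x p).
  rewrite yxp dotvDr (dotvC kap (u p)).
  have /ler_normlP[+ _] := dotv_norm kap (y r - y p); rewrite -/A => h1.
  have h2 : A * enorm (y r - y p) <= A * e by rewrite ler_wpM2l.
  have h3 : e * A <= e * Lam by rewrite ler_wpM2l ?(ltW e0)// /Lam; lra.
  by lra.
have rg : rho * (q - p) + gamma * A <= (rho + gamma) * Lam.
  have : rho * (q - p) <= rho * Lam by rewrite ler_wpM2l// /Lam; lra.
  have : gamma * A <= gamma * Lam by rewrite ler_wpM2l// /Lam; lra.
  by lra.
have quad : (rho * (q - p) + gamma * A) * Z ^+ 2 <=
    rho * Q + gamma * (up ^+ 2 * dW) + e * ((rho + gamma) * (2 * B + 1) * Lam + rho * Lam).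
  apply: (@le_trans _ _ ((rho * (q - p) + gamma * A) * (up ^+ 2 + e * (2 * B + 1)))).
    by rewrite ler_wpM2l// addr_ge0// mulr_ge0// ltW.
  have e2B : 0 <= e * (2 * B + 1) by rewrite mulr_ge0 ?(ltW e0)//; lra.
  have h1 := ler_wpM2r e2B rg.
  have h2 := ler_wpM2l r0 HQ.
  have h3 : gamma * (up ^+ 2 * A) <= gamma * (up ^+ 2 * dW) by rewrite !ler_wpM2l.
  have h4 : rho * e * (q - p) <= rho * e * Lam.
    by rewrite ler_wpM2l ?mulr_ge0 ?(ltW e0)// /Lam; lra.
  by lra.
have err : C * e * Lam * (1 + Z ^+ 2) <= e * (C * (1 + (B + 1) ^+ 2) * Lam).
  have ceL : 0 <= C * e * Lam by rewrite !mulr_ge0// ltW.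
  by have := ler_wpM2l ceL ZB2; lra.
by rewrite /cell_const -/Lam; have : 0 <= e * Lam by [rewrite mulr_ge0// ltW|]; lra.
Qed.

(** Over a fine grid the cell inequalities add up to Riemann sums of the two Stieltjes integrals,
    tagged at the left ends, and the errors to [e] times a constant. The integral of [phi] along [y]
    may be [+oo], so it stays extended-valued on the right. *)
Lemma variational_ineq_lt (s t : R) : 0 <= s -> s < t ->
  ((RS_int dotv u k s t)%:E + \int[mu]_(r in `[s, t]) phi (x r)
   <= \int[mu]_(r in `[s, t]) phi (y r)
     + (rho * \int[mu]_(r in `[s, t]) (enorm (u r) ^+ 2)
        + gamma * RS_int (fun a c : R => a * c)
                    (fun r => enorm (u r) ^+ 2) (W k) s t)%:E)%E.
Proof.
move=> s0 st; have st' := ltW st; have bk := BV_loc_dominated; have t0 := le_trans s0 st'.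
move: (rho0) (gamma0) (C0) => r0 g0 c0.
have [intx finx] := path_integral_fin L0 phi_gtNy phi_lsc phi_L cx xD s0 st'.
have R1 := RS_dotv_is bk cu s0 st'; have R2 := RS_sq_is bk cu s0 st'.
set RD := RS_int dotv u k s t in R1 *; set RQ := RS_int _ _ _ s t in R2 *.
set Q := \int[mu]_(r in `[s, t]) (enorm _ ^+ 2).
rewrite -[X in (_ + X <= _)%E]fineK//; set I := fine _.
rewrite -EFinD -leeBlDr// -EFinB.
set J := (\int[mu]_(r in _) _)%E.
have [B B0 uB] := continuous_Rplus_bounded t cu.
have K0 : 0 <= cell_const B.
  have h1 : 0 <= (rho + gamma) * (2 * B + 1) by rewrite mulr_ge0//; lra.
  have h2 : 0 <= C * (1 + (B + 1) ^+ 2) by rewrite mulr_ge0// addr_ge0// sqr_ge0.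
  by rewrite /cell_const; lra.
pose Lam := V t - V s + (t - s).
have Lam0 : 0 <= Lam by have := kV s0 st'; have := enorm_ge0 (k t - k s); rewrite /Lam; lra.
have key e : 0 < e <= 1 ->
    ((RD + I - (rho * Q + gamma * RQ) - e * (1 + gamma + cell_const B * Lam))%:E <= J)%E.
  move=> e01; have /andP[e0 e1] := e01.
  have e24 : 0 < e ^+ 2 / 4 by rewrite divr_gt0// exprn_gt0.
  have [eta1 eta10 H1] := continuous_Rplus_unif t cx e24.
  have [eta2 eta20 H2] := continuous_Rplus_unif t cy e0.
  have [eta3 eta30 H3] := sq_enorm_unif cu t e0.
  have w0 : 0 < Num.min eta1 (Num.min eta2 eta3) by rewrite !lt_min eta10 eta20.
  have [N1 N10 HN1] := grid_small s t w0.
  have [N2 N20 HN2] := is_RS_int_grid st R1 e0.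
  have [N3 N30 HN3] := is_RS_int_grid st R2 e0.
  pose N := maxn N1 (maxn N2 N3).
  have N0 : (0 < N)%N by rewrite leq_max N10.
  have := HN1 N (leq_maxl _ _); rewrite !lt_min => /and3P[m1 m2 m3].
  have h2 : (N2 <= N)%N by rewrite /N maxnCA leq_maxl.
  have h3 : (N3 <= N)%N by rewrite /N maxnA leq_maxr.
  have {HN2} := HN2 N h2; have {HN3} := HN3 N h3.
  set S2 := \sum_(i < N) _ * _; set S1 := \sum_(i < N) dotv _ _.
  move=> HS2 HS1.
  pose g := grid s t N.
  have gin (j : nat) : (j <= N)%N -> s <= g j <= t by exact: grid_in.
  have glt (j : nat) : g j < g j.+1.
    by rewrite -subr_gt0 /g gridS divr_gt0 ?subr_gt0// ltr0n.
  have cellin (j : 'I_N) r : g j <= r <= g j.+1 -> 0 <= r <= t /\ `|r - g j| <= (t - s) / N%:R.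
    move=> /andP[gr rg]; have /andP[a1 a2] := gin j (ltnW (ltn_ord j)).
    have /andP[a3 a4] := gin j.+1 (ltn_ord j).
    split; first by apply/andP; split; lra.
    by rewrite ger0_norm ?subr_ge0// -(gridS s t N j) -/g; lra.
  have g0T (j : 'I_N) : 0 <= g j <= t.
    by have /andP[a1 a2] := gin j (ltnW (ltn_ord j)); rewrite (le_trans s0).
  have cells (j : 'I_N) := @cell_inequality (g j) (g j.+1) e B
    (proj1 (andP (g0T j))) (glt j) e01 B0
    (fun r h => uB r (proj1 (cellin j r h)))
    (fun r h => ltW (H1 _ _ (g0T j) (proj1 (cellin j r h))
       (le_lt_trans (proj2 (cellin j r h)) m1)))
    (fun r h => ltW (H2 _ _ (g0T j) (proj1 (cellin j r h))
       (le_lt_trans (proj2 (cellin j r h)) m2)))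
    (fun r h => ltW (H3 _ _ (g0T j) (proj1 (cellin j r h))
       (le_lt_trans (proj2 (cellin j r h)) m3))).
  have my : measurable_fun `[s, t] (fun r => phi (y r)).
    apply: (measurable_lsc_comp phi_lsc cy) => //.
    by move=> r; rewrite /= in_itv/= => /andP[sr _]; exact: le_trans sr.
  have mx : measurable_fun `[s, t] (fun r => phi (x r)).
    apply: (measurable_lsc_comp phi_lsc cx) => //.
    by move=> r; rewrite /= in_itv/= => /andP[sr _]; exact: le_trans sr.
  rewrite /J (grid_integral st' N0 my).
  apply: le_trans (lee_sum _ (fun j _ => cells j)).
  rewrite sumEFin lee_fin !big_split/= !sumrN.
  have -> : \sum_(i < N) dotv (u (g i)) (k (g i.+1) - k (g i)) = S1 by [].
  have -> : \sum_(i < N) fine (\int[mu]_(r in `[g i, g i.+1]) phi (x r))%E = I.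
    rewrite /I (grid_integral st' N0 mx) -[LHS]/(fine (_)%:E) -sumEFin; congr fine.
    apply: eq_bigr => i _; have /andP[a1 a2] := g0T i.
    by have [_ /fineK] := path_integral_fin L0 phi_gtNy phi_lsc phi_L cx xD a1 (ltW (glt i)).
  have -> : \sum_(i < N) rho * \int[mu]_(r in `[g i, g i.+1]) (enorm (u r) ^+ 2) = rho * Q.
    rewrite -mulr_sumr; congr (_ * _); apply: EFin_inj.
    rewrite -sumEFin /Q EFin_Rintegral_sq_enorm// (grid_integral st' N0)//; last first.
      exact: sq_enorm_measurable.
    apply: eq_bigr => i _; have /andP[a1 a2] := g0T i.
    by rewrite EFin_Rintegral_sq_enorm// ltW.
  have -> : \sum_(i < N) gamma * (enorm (u (g i)) ^+ 2 *
     (fine (Var k (g i.+1)) - fine (Var k (g i)))) = gamma * S2 by rewrite -mulr_sumr.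
  have -> : \sum_(i < N) e * (cell_const B * (V (g i.+1) - V (g i) + (g i.+1 - g i))) =
     e * (cell_const B * Lam).
    rewrite -!mulr_sumr; congr (_ * (_ * _)); rewrite big_split/=.
    rewrite -(big_mkord xpredT (fun i => V (g i.+1) - V (g i))).
    rewrite -(big_mkord xpredT (fun i => g i.+1 - g i)).
    by rewrite !telescope_sumr// /g grid0 gridN.
  move: HS1 HS2; rewrite !ltr_norml => /andP[a1 a2] /andP[a3 a4].
  have := ler_wpM2l g0 (ltW a4); lra.
(* An infinite [J] is either harmless or, for [-oo], excluded by [key] at [e = 1]. *)
case: J key => [j| |] key; last 2 first.
- exact: leey.
- by have := key 1; rewrite ltr01 lexx leeNy_eq /= => /(_ isT).
rewrite lee_fin; apply: (@ler_small_error _ _ _ (1 + gamma + cell_const B * Lam)).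
  by rewrite addr_ge0 ?mulr_ge0//; lra.
by move=> e /key; rewrite lee_fin; lra.
Qed.

End VariationalInequality.

(** * Uniqueness *)

Section Uniqueness.
Context {R : realType} {d : nat}.
Variables (rho gamma : R) (phi : 'rV[R]_d -> \bar R).
Hypotheses (rho0 : 0 <= rho) (gamma0 : 0 <= gamma).
Variables (x0 : 'rV[R]_d) (m x k x' k' : R -> 'rV[R]_d).
Hypotheses (sol : skorohod_solution rho gamma phi x0 m x k)
  (sol' : skorohod_solution rho gamma phi x0 m x' k').
Local Notation mu := (@lebesgue_measure R).
Local Notation delta := (fun r => x' r - x r).

Let cx : continuous_Rplus x. Proof. by case: sol => -[[]]. Qed.
Let cx' : continuous_Rplus x'. Proof. by case: sol' => -[[]]. Qed.
Let bk : BV_loc k. Proof. by case: sol => -[_ _ []]. Qed.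
Let bk' : BV_loc k'. Proof. by case: sol' => -[_ _ []]. Qed.

(** The clock A of the formal inequality d|x' - x|^2 <= |x' - x|^2 dA. The outer 2 comes from
    differentiating a square, the inner one from adding two variational inequalities, and the 1 next
    to [gamma] pays for freezing the Stieltjes integrands. *)
Definition total_clock (t : R) :=
  2 * (2 * rho * t + (gamma + 1) * (fine (Var k t) + fine (Var k' t))).

Lemma deltaE (t : R) : 0 <= t -> x' t - x t = k t - k' t.
Proof.
move=> t0; case: sol sol' => _ /(_ t t0) h [_ /(_ t t0)]; rewrite -h => E.
by apply/rowP => j; have := congr1 (fun v : 'rV[R]_d => v ord0 j) E; rewrite !mxE; lra.
Qed.

(** Each solution is the test path in the inequality of the other. In the sum the integrals of [phi]
    cancel, being finite, and the Stieltjes integrals with integrands frozen at [q] give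
    [dotv (delta q) (delta q - delta p)]. *)
Lemma solution_gap (p q e : R) : 0 <= p -> p <= q ->
  (forall r, p <= r <= q -> enorm (delta r - delta q) <= e) ->
  (forall r, p <= r <= q -> enorm (delta r) ^+ 2 <= enorm (delta p) ^+ 2 + e) ->
  enorm (delta q) ^+ 2 - enorm (delta p) ^+ 2 <=
  (total_clock q - total_clock p) * (enorm (delta p) ^+ 2 + e).
Proof.
move=> p0 pq dq dp; have q0 := le_trans p0 pq.
have cd : continuous_Rplus delta by exact: continuous_RplusB.
pose delta' r := x r - x' r.
have cd' : continuous_Rplus delta' by exact: continuous_RplusB.
have d'E r : enorm (delta' r) = enorm (delta r) by rewrite enormB.
have fin y : mu.-integrable `[0, q] (fun r => phi (y r)) ->
    (\int[mu]_(r in `[p, q]) phi (y r))%E \is a fin_num.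
  move=> iy; apply: integrable_fin_num; first exact: measurable_itv.
  apply: (integrableS _ _ _ iy); [exact: measurable_itv|exact: measurable_itv|].
  by apply: subset_itvr; rewrite bnd_simp.
have fx : (\int[mu]_(r in `[p, q]) phi (x r))%E \is a fin_num.
  by apply: fin; case: sol => -[_ [_ h] _ _] _; exact: h.
have fx' : (\int[mu]_(r in `[p, q]) phi (x' r))%E \is a fin_num.
  by apply: fin; case: sol' => -[_ [_ h] _ _] _; exact: h.
have := (let: conj (And4 _ _ _ h) _ := sol in h) p q p0 pq x' cx'.
have := (let: conj (And4 _ _ _ h) _ := sol' in h) p q p0 pq x cx.
rewrite -(fineK fx) -(fineK fx') -!EFinD !lee_fin.
set X := fine _; set X' := fine _.
set R1 := RS_int dotv _ k' p q; set R2 := RS_int dotv _ k p q.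
set S1 := RS_int _ _ _ p q; set S2 := RS_int _ _ _ p q.
set Q1 := (\int[mu]_(r in _) _ ^+ 2); set Q2 := (\int[mu]_(r in _) _ ^+ 2).
move=> ineq1 ineq2.
set B := enorm (delta p) ^+ 2 + e in dp *.
set W := fine (Var k q) - fine (Var k p); set W' := fine (Var k' q) - fine (Var k' p).
have hQ1 : Q1 <= B * (q - p).
  apply: Rintegral_sq_enorm_le => // r rpq; rewrite -/(delta' r) d'E; exact: dp.
have hQ2 : Q2 <= B * (q - p) by exact: (Rintegral_sq_enorm_le cd p0 pq dp).
have hS1 : S1 <= B * W'.
  by apply: (RS_sq_le bk' cd') => // r rpq; rewrite d'E; exact: dp.
have hS2 : S2 <= B * W by apply: (RS_sq_le bk cd).
have hR2 : `|R2 - dotv (delta q) (k q - k p)| <= e * W.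
  by apply: (RS_dotv_near bk cd).
have hR1 : `|R1 - dotv (- delta q) (k' q - k' p)| <= e * W'.
  apply: (RS_dotv_near bk' cd') => // r rpq.
  have -> : delta' r - - delta q = - (delta r - delta q).
    by rewrite /delta'; apply/rowP => j; rewrite !mxE; ring.
  by rewrite enormN; exact: dq.
move: hR1 hR2 => /ler_normlP[hR1 _] /ler_normlP[hR2 _].
have dE : dotv (delta q) (delta q - delta p) =
    dotv (delta q) (k q - k p) + dotv (- delta q) (k' q - k' p).
  by rewrite dotvNl -dotvBr; congr dotv; rewrite !deltaE//; apply/rowP => j; rewrite !mxE; ring.
have sq : enorm (delta q) ^+ 2 - enorm (delta p) ^+ 2 <= 2 * dotv (delta q) (delta q - delta p).
  have := enormD_sqr (delta q) (- (delta q - delta p)).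
  rewrite subKr enormN dotvNr => ->; have := sqr_ge0 (enorm (delta q - delta p)); lra.
have W0 : 0 <= W by rewrite subr_ge0 Var_nd.
have W'0 : 0 <= W' by rewrite subr_ge0 Var_nd.
have eB : e <= B by rewrite lerDr sqr_ge0.
have h1 := ler_wpM2l rho0 hQ1; have h2 := ler_wpM2l rho0 hQ2.
have h3 := ler_wpM2l gamma0 hS1; have h4 := ler_wpM2l gamma0 hS2.
have h5 := ler_wpM2r W0 eB; have h6 := ler_wpM2r W'0 eB.
have -> : (total_clock q - total_clock p) * B =
    2 * (2 * rho * (B * (q - p)) + (gamma + 1) * (B * (W + W'))).
  by rewrite /total_clock /W /W'; ring.
by lra.
Qed.

(** Gronwall on a grid for [|delta|^2 + e], where the added [e] absorbs the discretisation errors: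
    each cell multiplies it by at most 1 plus an increment of the clock, hence by at most an
    exponential, and the exponents telescope. *)
Lemma solution_unique (t : R) : 0 <= t -> x' t = x t /\ k' t = k t.
Proof.
move=> t0; suff d0 : x' t - x t = 0.
  split; first by apply/eqP; rewrite -subr_eq0 d0.
  by apply/eqP; rewrite eq_sym -subr_eq0 -deltaE// d0.
have d00 : delta 0 = 0.
  rewrite deltaE//; case: sol sol' => -[_ _ [_ ->] _] _ [[_ _ [_ ->] _] _].
  by rewrite subrr.
move: t0; rewrite le_eqVlt => /orP[/eqP <-//|tpos]; have t0 := ltW tpos.
have cd : continuous_Rplus delta by exact: continuous_RplusB.
apply: enorm_eq0; apply/eqP; rewrite -sqrf_eq0 eq_le sqr_ge0 andbT.
set E := expR (total_clock t - total_clock 0).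
apply: (@ler_small_error _ _ _ E); first exact: expR_ge0.
move=> e /andP[e0 _]; rewrite add0r.
have [eta1 eta10 H1] := continuous_Rplus_unif t cd e0.
have [eta2 eta20 H2] := sq_enorm_unif cd t e0.
have w0 : 0 < Num.min eta1 eta2 by rewrite lt_min eta10.
have [N N0 HN] := grid_small 0 t w0.
have := HN N (leqnn N); rewrite lt_min => /andP[m1 m2].
pose g := grid 0 t N.
have step j : (j < N)%N -> enorm (delta (g j.+1)) ^+ 2 + e <=
    expR (total_clock (g j.+1) - total_clock (g j)) * (enorm (delta (g j)) ^+ 2 + e).
  move=> jN; have pT : 0 <= g j <= t by apply: grid_in => //; exact: ltnW.
  have qT : 0 <= g j.+1 <= t by exact: grid_in.
  have pq : g j <= g j.+1 by exact: grid_le.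
  have /andP[p0 _] := pT; have /andP[_ qt] := qT.
  have gap : g j.+1 - g j = (t - 0) / N%:R by exact: gridS.
  have rT r : g j <= r <= g j.+1 -> 0 <= r <= t.
    by move=> /andP[a1 a2]; rewrite (le_trans p0)//= (le_trans a2).
  have close1 r : g j <= r <= g j.+1 -> enorm (delta r - delta (g j.+1)) <= e.
    move=> rg; apply/ltW/H1; [exact: qT|exact: rT|].
    by case/andP: rg => a1 a2; rewrite distrC ger0_norm ?subr_ge0//; lra.
  have close2 r : g j <= r <= g j.+1 ->
      enorm (delta r) ^+ 2 <= enorm (delta (g j)) ^+ 2 + e.
    move=> rg; have : `|enorm (delta r) ^+ 2 - enorm (delta (g j)) ^+ 2| < e.
      apply: H2; [exact: pT|exact: rT|].
      by case/andP: rg => a1 a2; rewrite ger0_norm ?subr_ge0//; lra.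
    by move=> /ltr_normlP[_]; lra.
  have gapj := solution_gap p0 pq close1 close2.
  have F0 : 0 <= enorm (delta (g j)) ^+ 2 + e by rewrite addr_ge0 ?sqr_ge0// ltW.
  have := ler_wpM2r F0 (expR_ge1Dx (total_clock (g j.+1) - total_clock (g j))).
  lra.
have all_steps j : (j <= N)%N -> enorm (delta (g j)) ^+ 2 + e <=
    expR (total_clock (g j) - total_clock 0) * e.
  elim: j => [_|j ih jN].
    by rewrite /g grid0 subrr expR0 d00 enorm0 expr0n /= add0r mul1r.
  apply: le_trans (step j jN) _.
  have := ler_wpM2l (expR_ge0 (total_clock (g j.+1) - total_clock (g j))) (ih (ltnW jN)).
  rewrite mulrA -expRD; congr (_ <= expR _ * _); ring.
by have := all_steps N (leqnn N); rewrite /g gridN// -/E; lra.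
Qed.

End Uniqueness.

(** * Existence and uniqueness of the solution *)

Theorem theorem25 (R : realType) (d : nat) (rho gamma L delta sigma : R)
    (phi : 'rV[R]_d -> \bar R) (x0 : 'rV[R]_d) (m : R -> 'rV[R]_d) :
  0 <= rho -> 0 <= gamma -> 0 <= L -> 0 < delta -> 0 < sigma ->
  (forall v, (-oo < phi v)%E) ->
  proper_fun phi ->
  lower_semicontinuous phi ->
  semiconvex_fun rho gamma phi ->
  (forall x y, Dom phi x -> Dom phi y ->
     (`|phi x - phi y| <= (L + L * enorm (x - y))%:E)%E) ->
  shifted_interior_ball gamma delta sigma (Dom phi) ->
  closure (Dom phi) x0 ->
  continuous_Rplus m ->
  m 0 = 0 ->
  exists x k : R -> 'rV[R]_d,
    skorohod_solution rho gamma phi x0 m x k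
    /\ forall x' k' : R -> 'rV[R]_d,
         skorohod_solution rho gamma phi x0 m x' k' ->
         forall t, 0 <= t -> x' t = x t /\ k' t = k t.
Proof.
move=> rho0 gamma0 L0 delta0 sigma0 phi_gtNy [Dom_neq0 _] phi_lsc [_ _ phi_sc] phi_L Dball.
have Dcl := Dom_closed L0 phi_gtNy Dom_neq0 phi_lsc phi_L.
move=> /Dcl Dx0 cm m0.
have fL := fun x y => @fine_phi_L _ _ _ _ phi_gtNy phi_L x y.
have Dprox := Dom_proximal_points L0 phi_gtNy Dom_neq0 phi_lsc phi_sc phi_L.
have /choice[X HX] : forall n, _ := fun n =>
  scheme_exists L0 phi_gtNy Dom_neq0 phi_lsc phi_sc phi_L
    (sampled m (mesh n)) (@mesh_gt0 R n) Dx0.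
have X0 n : X n 0%N = x0 by have [] := HX n.
have sX n := proj2 (HX n).
have [U [UU Utail]] := nat_ultrafilter.
have [k [V [Kk dvarV]]] :=
  limit_processes rho0 gamma0 L0 delta0 sigma0 fL Dball cm m0 sX UU Utail.
pose x := xlim m x0 k.
have cx : continuous_Rplus x :=
  xlim_continuous rho0 gamma0 L0 delta0 sigma0 fL Dball cm sX UU Utail Kk.
have ck : continuous_Rplus k :=
  limit_reflection_continuous rho0 gamma0 L0 delta0 sigma0 fL Dball cm sX UU Utail Kk.
have xD t : 0 <= t -> Dom phi (x t) by exact: (xlim_in Dcl cm X0 sX UU Utail Kk).
have kV s t : 0 <= s -> s <= t -> enorm (k t - k s) <= V t - V s.
  exact: (limit_reflection_le UU Kk dvarV).
have coarse := limit_coarse rho0 gamma0 L0 phi_gtNy phi_lsc phi_L Dprox UU Utail cx xD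
  sX Kk dvarV (fun t e => @scheme_cvg _ _ _ _ cm _ X0 _ UU Utail _ Kk t e)
  (fun T e => @scheme_cvg_unif _ _ _ _ _ _ _ _ _ rho0 gamma0 L0 delta0 sigma0 fL Dball
     _ _ cm _ X0 sX _ UU Utail _ Kk T e).
have sol : skorohod_solution rho gamma phi x0 m x k.
  split; last by move=> t _; rewrite /x /xlim subrK.
  split=> //.
  - split=> [t t0|T _]; first exact/subset_closure/xD.
    exact: (phi_path_integrable L0 phi_gtNy phi_lsc phi_L T cx xD).
  - by split; [exact: (BV_loc_dominated kV)|exact: (limit_reflection0 m0 UU Utail Kk)].
  (* For [s = t] all the integrals vanish; the summation over a grid is for [s < t]. *)
  move=> s t s0; rewrite le_eqVlt => /orP[/eqP <-|st] y cy.
    by rewrite !RS_int_same set_itv1 !integral_set1 Rintegral_set1 !mulr0 !addr0.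
  exact: (variational_ineq_lt rho0 gamma0 L0 phi_gtNy phi_lsc phi_L cx xD kV
    (coarse_const_ge0 rho0 gamma0) coarse cy s0 st).
exists x, k; split=> // x' k' sol' t t0.
exact: (solution_unique rho0 gamma0 sol sol').
Qed.
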